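(* $\mathsf{RCA}_0$ proves the following: for all sets $X$ and $Z$, $X$ is infinitely often $C^Z$-incompressible if and only if $X$ is $2$-random relative to $Z$. Hence the principles $C\mbox{-}\mathsf{INC}$ and $2\mbox{-}\mathsf{MLR}$ are equivalent over $\mathsf{RCA}_0$.
   Context: $\mathsf{RCA}_0$ is the theory in the language of second-order arithmetic with axioms: the basic axioms $\mathsf{PA}^-$ of Peano arithmetic (the natural numbers form a discretely ordered commutative semiring with $1$); the $\Sigma^0_1$ induction scheme, i.e. the universal closures of $(\varphi(0)\wedge\forall n(\varphi(n)\to\varphi(n+1)))\to\forall n\,\varphi(n)$ for $\varphi$ a $\Sigma^0_1$ formula; and the $\Delta^0_1$ comprehension scheme, i.e. the universal closures of $\forall n(\varphi(n)\leftrightarrow\psi(n))\to\exists X\forall n(n\in X\leftrightarrow\varphi(n))$ for $\varphi$ a $\Sigma^0_1$ and $\psi$ a $\Pi^0_1$ formula with $X$ not free in $\varphi$. Set parameters are allowed in formulas. All definitions below are made inside $\mathsf{RCA}_0$. $\mathbb{N}$ is the (possibly nonstandard) first-order part. Finite strings, finite sets and rationals are coded as usual; $(\Phi_e)_{e\in\mathbb{N}}$ is an effective sequence of all Turing functionals; $\leq_{\mathrm T}$ is Turing reducibility. $2^{<\mathbb{N}}$ is the set of finite binary strings, $|\sigma|$ is the length of $\sigma$, $X\restriction n=\langle X(0),\dots,X(n-1)\rangle$. $\forall^\infty m$ means ''for all but finitely many $m$'' ($\exists m_0\forall m\geq m_0$); $\exists^\infty m$ means ''for infinitely many $m$'' ($\forall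 m_0\exists m\geq m_0$). Plain complexity: $\mathbb{V}$ is the standard optimal (universal) plain oracle machine, a partial functional from binary strings to binary strings defined in the usual way from the effective sequence of all Turing functionals. $C^Z(\sigma)\leq n$ means there is $\tau$ with $|\tau|\leq n$ and $\mathbb{V}^Z(\tau)=\sigma$ (similarly with $<$); $C^Z(\sigma)>n$ means not $C^Z(\sigma)\leq n$ (similarly $C^Z(\sigma)\ge n$ means not $C^Z(\sigma)<n$). $X$ is infinitely often $C^Z$-incompressible if $\exists b\,\exists^\infty m\,(C^Z(X\restriction m)\geq m-b)$. $C\mbox{-}\mathsf{INC}$ is the statement ''for every $Z$ there is an $X$ that is infinitely often $C^Z$-incompressible.'' $2$-randomness: A tree is a set of strings closed under initial segments, and $T^n=\{\sigma\in T:|\sigma|=n\}$. A code for a $\mathbf{\Sigma}^0_2$ set is a sequence $(T_i)_{i\in\mathbb{N}}$ of subtrees of $2^{<\mathbb{N}}$; it codes a $\Sigma^{0,Z}_2$ set if $(T_i)_{i\in\mathbb{N}}\leq_{\mathrm T}Z$. A code for a uniform sequence of $\Sigma^{0,Z}_2$ sets is a double sequence $(T_{n,i})_{n,i\in\mathbb{N}}\leq_{\mathrm T}Z$ of such trees, the $n$th set being coded by $(T_{n,i})_{i\in\mathbb{N}}$. If $\mathcal W$ is coded by $(T_i)_{i\in\mathbb{N}}$, then $X\in\mathcal W$ means $\exists i\forall n(X\restriction n\in T_i)$, and for $q\in\mathbb{Q}$, $\mu(\mathcal W)\leq q$ means $\forall i\exists n\,(2^{-n}|\bigcup_{j\leq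 i}T_j^n|\leq q)$. A $\Sigma^{0,Z}_2$-test is a uniform sequence $(\mathcal W_n)_{n\in\mathbb{N}}$ of $\Sigma^{0,Z}_2$ sets with $\mu(\mathcal W_n)\leq 2^{-n}$ for all $n$. $X$ is $2$-random relative to $Z$ if $X\notin\bigcap_n\mathcal W_n$ for every $\Sigma^{0,Z}_2$-test $(\mathcal W_n)_{n\in\mathbb{N}}$. $2\mbox{-}\mathsf{MLR}$ is the statement ''for every $Z$ there is an $X$ that is $2$-random relative to $Z$.'' *)

(* Defs.v *)
(** Second-order arithmetic as a two-sorted
    first-order theory (deep embedding, de Bruijn indices), the system RCA_0,
    and the arithmetized notions of computability and randomness. *)
From Stdlib Require Import List.
Import ListNotations.

(** * Syntax *)

(** Number variables and set variables are two independent families of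
    de Bruijn indices.  The only set terms are variables, and equality of sets
    is not primitive. *)
Inductive term : Type :=
| Var (x : nat)
| Zero
| One
| Add (t u : term)
| Mul (t u : term).

Inductive form : Type :=
| Eq (t u : term)
| Lt (t u : term)
| Mem (t : term) (X : nat)
| Bot
| Imp (A B : form)
| And (A B : form)
| Or (A B : form)
| All (A : form)
| Ex (A : form)
| AllS (A : form)
| ExS (A : form).

Definition Neg (A : form) : form := Imp A Bot.
Definition Iff (A B : form) : form := And (Imp A B) (Imp B A).

Fixpoint tsubst (s : nat -> term) (t : term) : term :=
  match t with
  | Var x => s x
  | Zero => Zero
  | One => One
  | Add t u => Add (tsubst s t) (tsubst s u)
  | Mul t u => Mul (tsubst s t) (tsubst s u)
  end.

Definition tshift : term -> term := tsubst (fun x => Var (S x)).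

Definition scons {A : Type} (a : A) (s : nat -> A) (x : nat) : A :=
  match x with 0 => a | S x => s x end.

Fixpoint subst (s : nat -> term) (A : form) : form :=
  match A with
  | Eq t u => Eq (tsubst s t) (tsubst s u)
  | Lt t u => Lt (tsubst s t) (tsubst s u)
  | Mem t X => Mem (tsubst s t) X
  | Bot => Bot
  | Imp A B => Imp (subst s A) (subst s B)
  | And A B => And (subst s A) (subst s B)
  | Or A B => Or (subst s A) (subst s B)
  | All A => All (subst (scons (Var 0) (fun x => tshift (s x))) A)
  | Ex A => Ex (subst (scons (Var 0) (fun x => tshift (s x))) A)
  | AllS A => AllS (subst s A)
  | ExS A => ExS (subst s A)
  end.

Fixpoint ssubst (r : nat -> nat) (A : form) : form :=
  match A with
  | Eq t u => Eq t u
  | Lt t u => Lt t u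
  | Mem t X => Mem t (r X)
  | Bot => Bot
  | Imp A B => Imp (ssubst r A) (ssubst r B)
  | And A B => And (ssubst r A) (ssubst r B)
  | Or A B => Or (ssubst r A) (ssubst r B)
  | All A => All (ssubst r A)
  | Ex A => Ex (ssubst r A)
  | AllS A => AllS (ssubst (scons 0 (fun X => S (r X))) A)
  | ExS A => ExS (ssubst (scons 0 (fun X => S (r X))) A)
  end.

Definition shift : form -> form := subst (fun x => Var (S x)).
Definition sshift : form -> form := ssubst S.
Definition inst (t : term) : form -> form := subst (scons t Var).
Definition sinst (X : nat) : form -> form := ssubst (scons X (fun Y => Y)).

(** [nbound A] ([sbound A]) is the least [k] such that every free number (set)
    variable of [A] has index less than [k]. *)
Fixpoint tbound (t : term) : nat :=
  match t with
  | Var x => S x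
  | Zero | One => 0
  | Add t u | Mul t u => Nat.max (tbound t) (tbound u)
  end.

Fixpoint nbound (A : form) : nat :=
  match A with
  | Eq t u | Lt t u => Nat.max (tbound t) (tbound u)
  | Mem t _ => tbound t
  | Bot => 0
  | Imp A B | And A B | Or A B => Nat.max (nbound A) (nbound B)
  | All A | Ex A => Nat.pred (nbound A)
  | AllS A | ExS A => nbound A
  end.

Fixpoint sbound (A : form) : nat :=
  match A with
  | Eq _ _ | Lt _ _ | Bot => 0
  | Mem _ X => S X
  | Imp A B | And A B | Or A B => Nat.max (sbound A) (sbound B)
  | All A | Ex A => sbound A
  | AllS A | ExS A => Nat.pred (sbound A)
  end.

Definition univ_closure (A : form) : form :=
  Nat.iter (sbound A) AllS (Nat.iter (nbound A) All A).

(** * Classical natural deduction for two-sorted logic with equality *)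

Inductive nd : list form -> form -> Prop :=
| nd_ax G A : In A G -> nd G A
| nd_raa G A : nd (Neg A :: G) Bot -> nd G A
| nd_impI G A B : nd (A :: G) B -> nd G (Imp A B)
| nd_impE G A B : nd G (Imp A B) -> nd G A -> nd G B
| nd_andI G A B : nd G A -> nd G B -> nd G (And A B)
| nd_andE1 G A B : nd G (And A B) -> nd G A
| nd_andE2 G A B : nd G (And A B) -> nd G B
| nd_orI1 G A B : nd G A -> nd G (Or A B)
| nd_orI2 G A B : nd G B -> nd G (Or A B)
| nd_orE G A B C : nd G (Or A B) -> nd (A :: G) C -> nd (B :: G) C -> nd G C
| nd_allI G A : nd (map shift G) A -> nd G (All A)
| nd_allE G A t : nd G (All A) -> nd G (inst t A)
| nd_exI G A t : nd G (inst t A) -> nd G (Ex A)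
| nd_exE G A C : nd G (Ex A) -> nd (A :: map shift G) (shift C) -> nd G C
| nd_allSI G A : nd (map sshift G) A -> nd G (AllS A)
| nd_allSE G A X : nd G (AllS A) -> nd G (sinst X A)
| nd_exSI G A X : nd G (sinst X A) -> nd G (ExS A)
| nd_exSE G A C : nd G (ExS A) -> nd (A :: map sshift G) (sshift C) -> nd G C
| nd_eqI G t : nd G (Eq t t)
| nd_eqE G A t u : nd G (Eq t u) -> nd G (inst t A) -> nd G (inst u A).

Definition proves (T : form -> Prop) (A : form) : Prop :=
  exists G : list form, Forall T G /\ nd G A.

(** * Writing formulas with named binders *)

(** An [fm] is a formula awaiting the numbers [d] and [s] of number and set
    quantifiers above it (a [tm] awaits only [d]).  A bound variable is passed
    around as its de Bruijn level, counted from the outermost quantifier, and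
    turned into an index at each place where it is used; so no explicit shifts
    are needed.  [sentence] starts the count at [0]. *)
Definition tm : Type := nat -> term.
Definition sv : Type := nat -> nat.
Definition fm : Type := nat -> nat -> form.

Declare Scope tm_scope.
Delimit Scope tm_scope with tm.
Bind Scope tm_scope with tm.
Declare Scope fm_scope.
Delimit Scope fm_scope with fm.
Bind Scope fm_scope with fm.

Definition sentence (A : fm) : form := A 0 0.

Definition level (l : nat) : nat -> nat := fun d => d - S l.

Definition bzero : tm := fun _ => Zero.
Definition bone : tm := fun _ => One.
Definition badd (t u : tm) : tm := fun d => Add (t d) (u d).
Definition bmul (t u : tm) : tm := fun d => Mul (t d) (u d).
Fixpoint num (n : nat) : tm :=
  match n with 0 => bzero | S n => badd (num n) bone end.

Definition beq (t u : tm) : fm := fun d _ => Eq (t d) (u d).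
Definition blt (t u : tm) : fm := fun d _ => Lt (t d) (u d).
Definition bmem (t : tm) (X : sv) : fm := fun d s => Mem (t d) (X s).
Definition bneg (A : fm) : fm := fun d s => Neg (A d s).
Definition bimp (A B : fm) : fm := fun d s => Imp (A d s) (B d s).
Definition band (A B : fm) : fm := fun d s => And (A d s) (B d s).
Definition bor (A B : fm) : fm := fun d s => Or (A d s) (B d s).
Definition biff (A B : fm) : fm := fun d s => Iff (A d s) (B d s).
Definition ball (F : tm -> fm) : fm :=
  fun d s => All (F (fun d' => Var (level d d')) (S d) s).
Definition bex (F : tm -> fm) : fm :=
  fun d s => Ex (F (fun d' => Var (level d d')) (S d) s).
Definition ballS (F : sv -> fm) : fm :=
  fun d s => AllS (F (level s) d (S s)).
Definition bexS (F : sv -> fm) : fm :=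
  fun d s => ExS (F (level s) d (S s)).

Module FormNotations.
Notation "0" := bzero : tm_scope.
Notation "1" := bone : tm_scope.
Notation "t + u" := (badd t u) : tm_scope.
Notation "t * u" := (bmul t u) : tm_scope.
Notation "t = u" := (beq t%tm u%tm) : fm_scope.
Notation "t < u" := (blt t%tm u%tm) : fm_scope.
Notation "t <= u" := (blt t%tm (badd u%tm bone)) : fm_scope.
Notation "t 'IN' X" := (bmem t%tm X) (at level 70) : fm_scope.
Notation "~ A" := (bneg A) : fm_scope.
Notation "A -> B" := (bimp A B) : fm_scope.
Notation "A /\ B" := (band A B) : fm_scope.
Notation "A \/ B" := (bor A B) : fm_scope.
Notation "A <-> B" := (biff A B) : fm_scope.
Notation "'ALL' x , A" := (ball (fun x => A%fm))
  (at level 200, x name, A at level 200) : fm_scope.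
Notation "'ALL' x < t , A" := (ball (fun x => bimp (blt x t%tm) A%fm))
  (at level 200, x name, t at level 69, A at level 200) : fm_scope.
Notation "'ALL' x <= t , A" :=
  (ball (fun x => bimp (blt x (badd t%tm bone)) A%fm))
  (at level 200, x name, t at level 69, A at level 200) : fm_scope.
Notation "'EX' x , A" := (bex (fun x => A%fm))
  (at level 200, x name, A at level 200) : fm_scope.
Notation "'EX' x < t , A" := (bex (fun x => band (blt x t%tm) A%fm))
  (at level 200, x name, t at level 69, A at level 200) : fm_scope.
Notation "'EX' x <= t , A" :=
  (bex (fun x => band (blt x (badd t%tm bone)) A%fm))
  (at level 200, x name, t at level 69, A at level 200) : fm_scope.
Notation "'ALLSET' X , A" := (ballS (fun X => A%fm))
  (at level 200, X name, A at level 200) : fm_scope.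
Notation "'EXSET' X , A" := (bexS (fun X => A%fm))
  (at level 200, X name, A at level 200) : fm_scope.
End FormNotations.
Import FormNotations.

(** * The theory RCA_0 *)

Definition PA_minus : list form := map sentence [
  (ALL x, ALL y, ALL z, (x + y) + z = x + (y + z))%fm;
  (ALL x, ALL y, x + y = y + x)%fm;
  (ALL x, ALL y, ALL z, (x * y) * z = x * (y * z))%fm;
  (ALL x, ALL y, x * y = y * x)%fm;
  (ALL x, ALL y, ALL z, x * (y + z) = x * y + x * z)%fm;
  (ALL x, x + 0 = x)%fm;
  (ALL x, x * 0 = 0)%fm;
  (ALL x, x * 1 = x)%fm;
  (ALL x, ~ x < x)%fm;
  (ALL x, ALL y, ALL z, x < y /\ y < z -> x < z)%fm;
  (ALL x, ALL y, x < y \/ x = y \/ y < x)%fm;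
  (ALL x, ALL y, ALL z, x < y -> x + z < y + z)%fm;
  (ALL x, ALL y, ALL z, 0 < z /\ x < y -> x * z < y * z)%fm;
  (ALL x, ALL y, x < y -> EX z, x + z = y)%fm;
  (0 < 1)%fm;
  (ALL x, 0 < x -> 1 < x \/ 1 = x)%fm;
  (ALL x, 0 < x \/ 0 = x)%fm ].

(** In a bounded quantifier the bound does not contain the bound variable. *)
Inductive bounded : form -> Prop :=
| bounded_eq t u : bounded (Eq t u)
| bounded_lt t u : bounded (Lt t u)
| bounded_mem t X : bounded (Mem t X)
| bounded_bot : bounded Bot
| bounded_imp A B : bounded A -> bounded B -> bounded (Imp A B)
| bounded_and A B : bounded A -> bounded B -> bounded (And A B)
| bounded_or A B : bounded A -> bounded B -> bounded (Or A B)
| bounded_all t A : bounded A -> bounded (All (Imp (Lt (Var 0) (tshift t)) A))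
| bounded_ex t A : bounded A -> bounded (Ex (And (Lt (Var 0) (tshift t)) A)).

Definition Sigma01 (A : form) : Prop := exists B, bounded B /\ A = Ex B.
Definition Pi01 (A : form) : Prop := exists B, bounded B /\ A = All B.

(** The induction variable is number variable [0] of [A]. *)
Definition induction_ax (A : form) : form :=
  Imp (And (inst Zero A)
           (All (Imp A (subst (scons (Add (Var 0) One) (fun x => Var (S x))) A))))
      (All A).

(** The comprehension variable is number variable [0] of [A] and [B]; shifting
    the set variables of [A] keeps the new set from occurring in it. *)
Definition comprehension_ax (A B : form) : form :=
  Imp (All (Iff A B)) (ExS (All (Iff (Mem (Var 0) 0) (sshift A)))).

Inductive RCA0 : form -> Prop :=
| RCA0_PA_minus A : In A PA_minus -> RCA0 A
| RCA0_induction A : Sigma01 A -> RCA0 (univ_closure (induction_ax A))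
| RCA0_comprehension A B : Sigma01 A -> Pi01 B ->
    RCA0 (univ_closure (comprehension_ax A B)).

Local Open Scope tm_scope.
Local Open Scope fm_scope.

(** * Coding *)

(** The pairing (x + y)^2 + x is injective but not surjective. *)
Definition Pair (x y : tm) : tm := (x + y) * (x + y) + x.

Definition Rem (a m x : tm) : fm := x < m /\ EX q <= a, a = q * m + x.

(** Goedel's beta function: [s] codes, for every length, the finite sequence
    of its first entries. *)
Definition Nth (s i x : tm) : fm :=
  EX a <= s, EX b <= s, s = Pair a b /\ Rem a (1 + (i + 1) * b) x.

(** [p = 2 ^ n] *)
Definition Exp2 (n p : tm) : fm :=
  EX s, Nth s 0 1 /\
        (ALL i < n, EX x <= s, Nth s i x /\ Nth s (i + 1) (x + x)) /\
        Nth s n p.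

(** The number of elements of [A] is [c]: some sequence of length [c] lists
    them without repetition. *)
Definition Card (A : tm -> fm) (c : tm) : fm :=
  EX s, (ALL i < c, EX x <= s, Nth s i x /\ A x) /\
        (ALL i < c, ALL j < c, ALL x <= s, Nth s i x /\ Nth s j x -> i = j) /\
        (ALL x, A x -> EX i < c, Nth s i x).

(** A binary string is coded by the positive number whose binary expansion is
    that string preceded by a digit 1; so the empty string is [1], and
    appending a digit [b] to [s] gives [s + s + b]. *)
Definition Str (s : tm) : fm := 0 < s.
Definition Len (s n : tm) : fm := EX p, Exp2 n p /\ p <= s /\ s < p + p.

(** [s] is the concatenation of [t] and [r]: if [r] has length [n], then [r]
    is [2 ^ n] plus the value of its digits. *)
Definition Cat (t r s : tm) : fm :=
  Str t /\ EX n, EX p, Len r n /\ Exp2 n p /\ s + p = t * p + r.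
Definition Prefix (t s : tm) : fm := EX r, Cat t r s.

(** [s] is the restriction of [X] to [n]. *)
Definition Restr (X : sv) (n s : tm) : fm :=
  Len s n /\
  ALL i < n, (i IN X <-> EX t, Len t i /\ Prefix (t + t + 1) s).

(** * Turing functionals *)

(** Indices of partial [Z]-recursive functions, built from initial functions
    by pairing, composition, primitive recursion and minimization; numbers of
    no listed form are indices of the empty function. *)
Definition op (k : nat) (a b : tm) : tm := Pair (num k) (Pair a b).

(** [d] codes a list of triples.  The triple [(e, x, y)], read as
    "the function with index [e] maps [x] to [y]", occurs among its first
    [k] entries. *)
Definition Occurs (d k e x y : tm) : fm :=
  EX j < k, Nth d j (Pair e (Pair x y)).

(** [(e, x, y)] follows by one clause from the first [k] entries of [d]. *)
Definition Justified (Z : sv) (d k e x y : tm) : fm :=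
  (* zero, successor, identity *)
  (e = op 0 0 0 /\ y = 0) \/
  (e = op 1 0 0 /\ y = x + 1) \/
  (e = op 2 0 0 /\ y = x) \/
  (* projections of pairs *)
  (e = op 3 0 0 /\ EX v <= x, x = Pair y v) \/
  (e = op 4 0 0 /\ EX v <= x, x = Pair v y) \/
  (* oracle *)
  (e = op 5 0 0 /\ ((x IN Z /\ y = 1) \/ (~ x IN Z /\ y = 0))) \/
  (* x |-> (a(x), b(x)) *)
  (EX a <= e, EX b <= e, e = op 6 a b /\
     EX u <= y, EX v <= y,
       y = Pair u v /\ Occurs d k a x u /\ Occurs d k b x v) \/
  (* x |-> b(a(x)) *)
  (EX a <= e, EX b <= e, e = op 7 a b /\
     EX u <= d, Occurs d k a x u /\ Occurs d k b u y) \/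
  (* (w, 0) |-> a(w), and (w, n + 1) |-> b((w, n), value at (w, n)) *)
  (EX a <= e, EX b <= e, e = op 8 a b /\
     ((EX w <= x, x = Pair w 0 /\ Occurs d k a w y) \/
      (EX w <= x, EX n <= x, x = Pair w (n + 1) /\
         EX u <= d, Occurs d k e (Pair w n) u /\
                    Occurs d k b (Pair (Pair w n) u) y))) \/
  (* x |-> least y with a(x, y) = 0, all earlier values being defined *)
  (EX a <= e, e = op 9 a 0 /\
     Occurs d k a (Pair x y) 0 /\
     ALL z < y, EX v <= d, Occurs d k a (Pair x z) (v + 1)).

(** [Phi_e^Z(x) = y]: some derivation contains [(e, x, y)]. *)
Definition Phi (Z : sv) (e x y : tm) : fm :=
  EX d, EX n,
    (ALL k < n, EX e' <= d, EX x' <= d, EX y' <= d,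
       Nth d k (Pair e' (Pair x' y')) /\ Justified Z d k e' x' y') /\
    Occurs d n e x y.

Definition TuringLe (X Z : sv) : fm :=
  EX e, ALL x, (x IN X -> Phi Z e x 1) /\ (~ x IN X -> Phi Z e x 0).

(** * Plain complexity *)

(** The universal machine maps 0^e 1 r to [Phi_e^Z(r)].  The string 0^e 1 is
    coded by [2 ^ e + 2 ^ e + 1]. *)
Definition UnivMachine (Z : sv) (t s : tm) : fm :=
  Str s /\
  EX e, EX p, EX r, Exp2 e p /\ Cat (p + p + 1) r t /\ Phi Z e r s.

(** [C^Z(s) < n] *)
Definition ComplexityLt (Z : sv) (s n : tm) : fm :=
  EX t, EX l, Len t l /\ l < n /\ UnivMachine Z t s.

(** If [m < b], the condition [C^Z >= m - b] holds since [m - b] is negative. *)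
Definition io_incompressible (X Z : sv) : fm :=
  EX b, ALL m0, EX m, m0 <= m /\
    EX s, Restr X m s /\ ALL n, n + b = m -> ~ ComplexityLt Z s n.

Definition C_INC : fm := ALLSET Z, EXSET X, io_incompressible X Z.

(** * 2-randomness *)

Definition Tree (T : tm -> fm) : fm :=
  ALL s, T s -> Str s /\ ALL t, Prefix t s -> T t.

(** For a code [(T i)_i] of a Sigma^0_2 set: membership of [X] in it. *)
Definition InSigma2 (X : sv) (T : tm -> tm -> fm) : fm :=
  EX i, ALL n, EX s, Restr X n s /\ T i s.

(** Measure at most the nonnegative rational [a / b], where [b] is positive. *)
Definition MeasureLe (T : tm -> tm -> fm) (a b : tm) : fm :=
  ALL i, EX n, EX p, EX c,
    Exp2 n p /\ Card (fun s => Len s n /\ EX j <= i, T j s) c /\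
    c * b <= a * p.

(** The trees of a double sequence coded by the set [W]. *)
Definition Tree_at (W : sv) (n i s : tm) : fm := Pair n (Pair i s) IN W.

Definition Sigma2_test (W Z : sv) : fm :=
  TuringLe W Z /\
  (ALL n, ALL i, Tree (Tree_at W n i)) /\
  (ALL n, EX p, Exp2 n p /\ MeasureLe (Tree_at W n) 1 p).

Definition two_random (X Z : sv) : fm :=
  ALLSET W, Sigma2_test W Z -> ~ (ALL n, InSigma2 X (Tree_at W n)).

Definition MLR2 : fm := ALLSET Z, EXSET X, two_random X Z.

(** * The two sentences *)

Definition incompressible_iff_two_random : form :=
  sentence (ALLSET X, ALLSET Z, io_incompressible X Z <-> two_random X Z).

Definition C_INC_iff_MLR2 : form := sentence (C_INC <-> MLR2).

(* Main.v *)
(** By completeness of the deduction system it suffices to argue in an arbitrary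
    model of RCA_0.

    Suppose that [X] belongs to every set of a test [W].  For a large constant [c],
    let [m = l + 2 c] and list the strings of length [m] in the largest finite stage of
    [W_2c] having at most [2^l] of them.  As [W_2c] has measure at most [2^-2c], for
    large [m] the initial segment of [X] of length [m] is listed, so it is described
    by its place in the list and by [c], with [m - c + O(1)] bits.

    Conversely suppose that, for every [b], almost every initial segment of [X] lies
    in [U_i], the set of strings of length [i] with complexity less than [i - b],
    which has measure at most [2^-b].  The union over [j] of the intersections of all
    [U_i], [i >= j], has measure at most [2^-b], but to see this at a finite stage
    for every [j] takes more than Sigma_1 bounding.  Therefore only the [U_i] with
    [j <= i <= j + k] are intersected, where [k] grows with the stages: whenever
    adding some later [U_i] to the union of the first [j + 1] intersections makes
    the measure exceed [2^-b (2 - 2^-(j+1))], the least such level [j] acts and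
    the ranges of all levels from [j] on are extended past [i].  Every action of level
    [j] not interrupted by lower levels removes measure [2^-(b+j+1)] from its
    intersection, so at most [2^((j+1)^2)] actions have level below [j], by
    Sigma_1 induction.  Hence every level eventually stops acting, the limit ranges
    cover [X], and the measure of the union stays below [2^(1-b)]. *)

From Stdlib Require Import List Lia Classical ClassicalEpsilon FunctionalExtensionality PropExtensionality.
From Stdlib Require Import ssreflect ssrfun ssrbool.
From Stdlib Require Import Ring ZArith QArith.
From Stdlib Require Import OrderedRing RingMicromega ZCoeff EnvRing Lqa.
From Stdlib Require Cantor.
From Stdlib.micromega Require Tauto.
Require Import Defs.
Import ListNotations.
Set Implicit Arguments.
Unset Strict Implicit.
Unset Printing Implicit Defensive.
Open Scope nat_scope.
Set Bullet Behavior "None".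

(** * Quotients by equivalence relations *)

(** The measure of a member of the test must be bounded for every finite union of its trees, while
    the limit ranges are never known at a finite stage. A tree therefore guesses a level and a stage
    after which all levels up to it are quiet. A later action refutes a wrong guess, and strong
    collection, which follows from Sigma_1 induction, gives one stage by which all wrong guesses
    among finitely many are refuted. The budget [2^-b (2 - 2^-j)] grows by [2^-(b+j+1)] from [j] to
    [j + 1]. As long as level [j - 1] is not violated, the union without level [j] respects the
    smaller budget, so a violation at level [j] must put more than the difference into the part that
    its action cuts off. That level [j] acts finitely often is a Sigma_2 statement, for which no
    induction is at hand. The explicit bound on the number of actions is Delta_1 at a fixed stage
    and does not depend on the stage. In the other direction, the place in the list costs
    [l = m - 2c] digits and the self-delimiting [c] costs [c + 1]; doubling [c] thus saves [c]
    digits up to a constant. *)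

Section Quotient.
Variables (T : Type) (R : T -> T -> Prop).
Hypotheses (R_refl : forall t, R t t) (R_sym : forall t u, R t u -> R u t)
  (R_trans : forall t u v, R t u -> R u v -> R t v).

Definition canon (t : T) : T := epsilon (inhabits t) (R t).

Lemma canon_eq t : R t (canon t).
Proof. by apply: (epsilon_spec (inhabits t) (R t)); exists t. Qed.

Lemma canon_spec t u : canon t = canon u <-> R t u.
Proof.
split=> [E|H].
  by apply: R_trans (canon_eq t) _; rewrite E; apply: R_sym; apply: canon_eq.
(* Besides the predicate, [epsilon] takes a proof of inhabitation, and the two proofs mention [t]
   and [u]; both arguments have to be identified. *)
rewrite /canon; have -> : inhabits t = inhabits u by exact: proof_irrelevance.
congr epsilon; apply: functional_extensionality => v; apply: propositional_extensionality.
by split; apply: R_trans => //; apply: R_sym.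
Qed.

(** Classes are the fixed points of a choice function, so that equivalent terms get Leibniz equal
    classes, as the clause of [sat] for [Eq] demands. *)
Definition quotient : Type := { t : T | canon t = t }.

Lemma canonK t : canon (canon t) = canon t.
Proof. by apply/canon_spec; apply: R_sym; apply: canon_eq. Qed.

Definition cls (t : T) : quotient := exist _ (canon t) (canonK t).

Definition repr (t : quotient) : T := proj1_sig t.

Lemma repr_cls t : R t (repr (cls t)).
Proof. exact: canon_eq. Qed.

Lemma cls_eq t u : cls t = cls u <-> R t u.
Proof.
rewrite -canon_spec; split=> [[]//|E].
by apply: eq_sig_hprop => // x; apply: proof_irrelevance.
Qed.

Lemma cls_repr (t : quotient) : cls (repr t) = t.
Proof.
by case: t => t Ht; apply: eq_sig_hprop => // x; apply: proof_irrelevance.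
Qed.

End Quotient.

(** * Completeness of the deduction system *)

(** Henkin semantics: the sets are a second sort of their own. The language cannot compare sets, so
    extensionality is not imposed, whereas numbers are compared by true equality. *)
Record model : Type := Model {
  num_of :> Type;
  set_of : Type;
  mzero : num_of;
  mone : num_of;
  madd : num_of -> num_of -> num_of;
  mmul : num_of -> num_of -> num_of;
  mlt : num_of -> num_of -> Prop;
  mmem : num_of -> set_of -> Prop }.

Fixpoint teval (M : model) (v : nat -> M) (t : term) : M :=
  match t with
  | Var x => v x
  | Zero => mzero M
  | One => mone M
  | Add t u => madd (teval v t) (teval v u)
  | Mul t u => mmul (teval v t) (teval v u)
  end.

Fixpoint sat (M : model) (v : nat -> M) (w : nat -> set_of M) (A : form) : Prop :=
  match A with
  | Eq t u => teval v t = teval v u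
  | Lt t u => mlt (teval v t) (teval v u)
  | Mem t X => mmem (teval v t) (w X)
  | Bot => False
  | Imp A B => sat v w A -> sat v w B
  | And A B => sat v w A /\ sat v w B
  | Or A B => sat v w A \/ sat v w B
  | All A => forall a, sat (scons a v) w A
  | Ex A => exists a, sat (scons a v) w A
  | AllS A => forall X, sat v (scons X w) A
  | ExS A => exists X, sat v (scons X w) A
  end.

(** * Substitution and renaming *)

Definition up (s : nat -> term) : nat -> term := scons (Var 0) (fun x => tshift (s x)).
Definition sup (r : nat -> nat) : nat -> nat := scons 0 (fun X => S (r X)).

Lemma tsubst_comp s s' t : tsubst s' (tsubst s t) = tsubst (fun x => tsubst s' (s x)) t.
Proof. by elim: t => //= t -> u ->. Qed.

Lemma tsubst_id t : tsubst Var t = t.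
Proof. by elim: t => //= t -> u ->. Qed.

Lemma scons_eta (T : Type) (f : nat -> T) : scons (f 0) (fun x => f (S x)) = f.
Proof. by apply: functional_extensionality => -[]. Qed.

Lemma up_comp s s' : (fun x => tsubst (up s') (up s x)) = up (fun x => tsubst s' (s x)).
Proof.
apply: functional_extensionality => -[|x] //=.
by rewrite /tshift !tsubst_comp.
Qed.

Lemma subst_comp A s s' : subst s' (subst s A) = subst (fun x => tsubst s' (s x)) A.
Proof.
by elim: A s s' => //= [t u|t u|t X|A IA B IB|A IA B IB|A IA B IB|A IA|A IA|A IA|A IA] s s';
   rewrite -/(up s) -/(up s') ?tsubst_comp ?IA ?IB ?up_comp.
Qed.

Lemma up_id : up Var = Var.
Proof. by apply: functional_extensionality => -[]. Qed.

Lemma subst_id A : subst Var A = A.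
Proof.
by elim: A => //= [t u|t u|t X|A IA B IB|A IA B IB|A IA B IB|A IA|A IA|A IA|A IA];
   rewrite -/(up Var) ?up_id ?tsubst_id ?IA ?IB.
Qed.

Lemma sup_comp r r' : (fun x => sup r' (sup r x)) = sup (fun x => r' (r x)).
Proof. by apply: functional_extensionality => -[]. Qed.

Lemma ssubst_comp A r r' : ssubst r' (ssubst r A) = ssubst (fun x => r' (r x)) A.
Proof.
by elim: A r r' => //= [A IA B IB|A IA B IB|A IA B IB|A IA|A IA|A IA|A IA] r r';
   rewrite -/(sup r) -/(sup r') ?IA ?IB ?sup_comp.
Qed.

Lemma sup_id : sup (fun X => X) = fun X => X.
Proof. by apply: functional_extensionality => -[]. Qed.

Lemma ssubst_id A : ssubst (fun X => X) A = A.
Proof.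
by elim: A => //= [A IA B IB|A IA B IB|A IA B IB|A IA|A IA|A IA|A IA];
   rewrite -/(sup _) ?sup_id ?IA ?IB.
Qed.

Lemma subst_ssubst A s r : ssubst r (subst s A) = subst s (ssubst r A).
Proof.
by elim: A s r => //= [A IA B IB|A IA B IB|A IA B IB|A IA|A IA|A IA|A IA] s r;
   rewrite ?IA ?IB.
Qed.

Lemma tsubst_bound t s s' :
  (forall x, x < tbound t -> s x = s' x) -> tsubst s t = tsubst s' t.
Proof.
elim: t => //= [x|t It u Iu|t It u Iu] H; first by apply: H; lia.
- by rewrite It ?Iu // => x Hx; apply: H; lia.
- by rewrite It ?Iu // => x Hx; apply: H; lia.
Qed.

Lemma subst_bound A s s' :
  (forall x, x < nbound A -> s x = s' x) -> subst s A = subst s' A.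
Proof.
elim: A s s' => //= [t u|t u|t X|A IA B IB|A IA B IB|A IA B IB|A IA|A IA|A IA|A IA] s s' H.
1,2: by rewrite (@tsubst_bound t s s') ?(@tsubst_bound u s s') // => x Hx; apply: H; lia.
1: by rewrite (@tsubst_bound t s s').
1-3: by rewrite (IA s s') ?(IB s s') // => x Hx; apply: H; lia.
1,2: by f_equal; apply: IA => -[|x] Hx //=; rewrite H //; lia.
all: by rewrite (IA s s').
Qed.

Lemma ssubst_bound A r r' :
  (forall x, x < sbound A -> r x = r' x) -> ssubst r A = ssubst r' A.
Proof.
elim: A r r' => //= [t X|A IA B IB|A IA B IB|A IA B IB|A IA|A IA|A IA|A IA] r r' H.
1: by rewrite H.
1-3: by rewrite (IA r r') ?(IB r r') // => x Hx; apply: H; lia.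
1,2: by rewrite (IA r r').
all: by f_equal; apply: IA => -[|x] Hx //=; rewrite H //; lia.
Qed.

Lemma subst_inst A s t : subst s (inst t A) = inst (tsubst s t) (subst (up s) A).
Proof.
rewrite /inst !subst_comp; congr subst; apply: functional_extensionality => -[|x] //=.
by rewrite /tshift tsubst_comp /= tsubst_id.
Qed.

Lemma subst_shift A s : subst (up s) (shift A) = shift (subst s A).
Proof. by rewrite /shift !subst_comp; congr subst. Qed.

Lemma ssubst_sinst A r X : ssubst r (sinst X A) = sinst (r X) (ssubst (sup r) A).
Proof.
by rewrite /sinst !ssubst_comp; congr ssubst; apply: functional_extensionality => -[|x].
Qed.

Lemma ssubst_sshift A r : ssubst (sup r) (sshift A) = sshift (ssubst r A).
Proof. by rewrite /sshift !ssubst_comp; congr ssubst. Qed.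

Arguments nd_ax {G A}.
Arguments nd_raa {G A}.
Arguments nd_impI {G A B}.
Arguments nd_impE {G A B}.
Arguments nd_andI {G A B}.
Arguments nd_andE1 {G A B}.
Arguments nd_andE2 {G A B}.
Arguments nd_orI1 {G A B}.
Arguments nd_orI2 {G A B}.
Arguments nd_orE {G A B C}.
Arguments nd_allI {G A}.
Arguments nd_allE {G A}.
Arguments nd_exI {G A} t.
Arguments nd_exE {G A C}.
Arguments nd_allSI {G A}.
Arguments nd_allSE {G A}.
Arguments nd_exSI {G A} X.
Arguments nd_exSE {G A C}.
Arguments nd_eqE {G A t u}.

(** * Derivability is stable under substitution, renaming and weakening *)

Lemma nd_subst G A s : nd G A -> nd (map (subst s) G) (subst s A).
Proof.
move=> H; elim: H s => {G A}.
- by move=> G A H s; apply/nd_ax/in_map.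
- by move=> G A _ IH s; apply: nd_raa; apply: IH.
- by move=> G A B _ IH s; apply: nd_impI; apply: IH.
- by move=> G A B _ IA _ IB s; apply: nd_impE (IA s) (IB s).
- by move=> G A B _ IA _ IB s; apply: nd_andI (IA s) (IB s).
- by move=> G A B _ IA s; apply: nd_andE1 (IA s).
- by move=> G A B _ IA s; apply: nd_andE2 (IA s).
- by move=> G A B _ IA s; apply: nd_orI1 (IA s).
- by move=> G A B _ IA s; apply: nd_orI2 (IA s).
- by move=> G A B C _ IA _ IB _ IC s; apply: nd_orE (IA s) (IB s) (IC s).
- move=> G A _ IA s; apply: nd_allI; rewrite -/(up s).
  have := IA (up s); rewrite !map_map; congr (nd _ _).
  by apply: map_ext => B; rewrite subst_shift.
- by move=> G A t _ IA s; rewrite subst_inst; apply: nd_allE (IA s).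
- move=> G A t _ IA s; apply: (nd_exI (tsubst s t)); rewrite -/(up s) -subst_inst.
  exact: IA.
- move=> G A C _ IA _ IC s; apply: nd_exE (IA s) _; rewrite -/(up s) -subst_shift.
  have := IC (up s); rewrite /= !map_map; congr (nd (_ :: _) _).
  by apply: map_ext => B; rewrite subst_shift.
- move=> G A _ IA s; apply: nd_allSI; have := IA s; rewrite !map_map; congr (nd _ _).
  by apply: map_ext => B; rewrite /sshift subst_ssubst.
- by move=> G A X _ IA s; rewrite /sinst -subst_ssubst; apply: nd_allSE (IA s).
- move=> G A X _ IA s; apply: (nd_exSI (X)); rewrite /sinst subst_ssubst.
  exact: IA.
- move=> G A C _ IA _ IC s; apply: nd_exSE (IA s) _; rewrite /sshift subst_ssubst.
  have := IC s; rewrite /= !map_map; congr (nd (_ :: _) _).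
  by apply: map_ext => B; rewrite /sshift subst_ssubst.
- by move=> G t s; apply: nd_eqI.
- move=> G A t u _ IA _ IB s; rewrite subst_inst; apply: nd_eqE (IA s) _.
  rewrite -subst_inst; exact: IB.
Qed.

Lemma nd_ssubst G A r : nd G A -> nd (map (ssubst r) G) (ssubst r A).
Proof.
move=> H; elim: H r => {G A}.
- by move=> G A H s; apply/nd_ax/in_map.
- by move=> G A _ IH s; apply: nd_raa; apply: IH.
- by move=> G A B _ IH s; apply: nd_impI; apply: IH.
- by move=> G A B _ IA _ IB s; apply: nd_impE (IA s) (IB s).
- by move=> G A B _ IA _ IB s; apply: nd_andI (IA s) (IB s).
- by move=> G A B _ IA s; apply: nd_andE1 (IA s).
- by move=> G A B _ IA s; apply: nd_andE2 (IA s).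
- by move=> G A B _ IA s; apply: nd_orI1 (IA s).
- by move=> G A B _ IA s; apply: nd_orI2 (IA s).
- by move=> G A B C _ IA _ IB _ IC s; apply: nd_orE (IA s) (IB s) (IC s).
- move=> G A _ IA s; apply: nd_allI; have := IA s; rewrite !map_map; congr (nd _ _).
  by apply: map_ext => B; rewrite /shift subst_ssubst.
- by move=> G A X _ IA s; rewrite /inst subst_ssubst; apply: nd_allE (IA s).
- move=> G A t _ IA s; apply: (nd_exI (t)); rewrite /inst -subst_ssubst.
  exact: IA.
- move=> G A C _ IA _ IC s; apply: nd_exE (IA s) _; rewrite /shift -subst_ssubst.
  have := IC s; rewrite /= !map_map; congr (nd (_ :: _) _).
  by apply: map_ext => B; rewrite /shift subst_ssubst.
- move=> G A _ IA s; apply: nd_allSI; rewrite -/(sup s).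
  have := IA (sup s); rewrite !map_map; congr (nd _ _).
  by apply: map_ext => B; rewrite ssubst_sshift.
- by move=> G A t _ IA s; rewrite ssubst_sinst; apply: nd_allSE (IA s).
- move=> G A t _ IA s; apply: (nd_exSI (s t)); rewrite -/(sup s) -ssubst_sinst.
  exact: IA.
- move=> G A C _ IA _ IC s; apply: nd_exSE (IA s) _; rewrite -/(sup s) -ssubst_sshift.
  have := IC (sup s); rewrite /= !map_map; congr (nd (_ :: _) _).
  by apply: map_ext => B; rewrite ssubst_sshift.
- by move=> G t s; apply: nd_eqI.
- move=> G A t u _ IA _ IB s; rewrite /inst subst_ssubst; apply: nd_eqE (IA s) _.
  rewrite -/(inst _ _) /inst -subst_ssubst; exact: IB.
Qed.

Lemma nd_weaken G G' A : nd G A -> incl G G' -> nd G' A.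
Proof.
move=> H; elim: H G' => {G A}.
- by move=> G A H G' I; apply/nd_ax/I.
- move=> G A _ IH G' I; apply: nd_raa; apply: IH; exact: incl_cons (in_eq _ _) (incl_tl _ I).
- move=> G A B _ IH G' I; apply: nd_impI; apply: IH; exact: incl_cons (in_eq _ _) (incl_tl _ I).
- by move=> G A B _ IA _ IB G' I; apply: nd_impE (IA _ I) (IB _ I).
- by move=> G A B _ IA _ IB G' I; apply: nd_andI (IA _ I) (IB _ I).
- by move=> G A B _ IA G' I; apply: nd_andE1 (IA _ I).
- by move=> G A B _ IA G' I; apply: nd_andE2 (IA _ I).
- by move=> G A B _ IA G' I; apply: nd_orI1 (IA _ I).
- by move=> G A B _ IA G' I; apply: nd_orI2 (IA _ I).
- move=> G A B C _ IA _ IB _ IC G' I.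
  apply: nd_orE (IA _ I) (IB _ _) (IC _ _); exact: incl_cons (in_eq _ _) (incl_tl _ I).
- by move=> G A _ IA G' I; apply: nd_allI; apply: IA; apply: incl_map.
- by move=> G A t _ IA G' I; apply: nd_allE (IA _ I).
- by move=> G A t _ IA G' I; apply: nd_exI (IA _ I).
- move=> G A C _ IA _ IC G' I; apply: nd_exE (IA _ I) (IC _ _).
  apply: incl_cons (in_eq _ _) (incl_tl _ _); exact: incl_map.
- by move=> G A _ IA G' I; apply: nd_allSI; apply: IA; apply: incl_map.
- by move=> G A t _ IA G' I; apply: nd_allSE (IA _ I).
- by move=> G A t _ IA G' I; apply: nd_exSI (IA _ I).
- move=> G A C _ IA _ IC G' I; apply: nd_exSE (IA _ I) (IC _ _).
  apply: incl_cons (in_eq _ _) (incl_tl _ _); exact: incl_map.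
- by move=> G t G' I; apply: nd_eqI.
- by move=> G A t u _ IA _ IB G' I; apply: nd_eqE (IA _ I) (IB _ I).
Qed.

Lemma subst_fresh A x : nbound A <= x ->
  subst (fun y => if Nat.eqb y x then Var 0 else Var (S y)) A = shift A.
Proof.
move=> H; apply: subst_bound => y Hy; case: (Nat.eqb_spec y x) => // E; lia.
Qed.

(** The rule [nd_exE] wants the witness to be variable 0 above a shifted context. Renaming a fresh
    [x] to 0 and shifting all other variables brings a derivation into this form, so ordinary
    variables can serve as Henkin constants. *)
Lemma nd_ex_fresh G A x :
  nd (inst (Var x) A :: G) Bot -> nbound (Ex A) <= x ->
  Forall (fun B => nbound B <= x) G -> nd (Ex A :: G) Bot.
Proof.
move=> H HA HG; apply: (nd_exE (A := A) (C := Bot)); first by apply/nd_ax/in_eq.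
have := nd_subst (fun y => if Nat.eqb y x then Var 0 else Var (S y)) H.
rewrite /= => H'; apply: nd_weaken H' _; apply: incl_cons.
  left; rewrite /inst subst_comp -[LHS]subst_id; apply: subst_bound => -[|y] /= Hy.
    by rewrite Nat.eqb_refl.
  simpl in HA; case: (Nat.eqb_spec y x) => // E; lia.
move=> B /in_map_iff [C [<- HC]]; right; right; apply/in_map_iff; exists C; split=> //.
by rewrite subst_fresh //; move/Forall_forall: HG; apply.
Qed.

Lemma ssubst_fresh A x : sbound A <= x ->
  ssubst (fun y => if Nat.eqb y x then 0 else S y) A = sshift A.
Proof.
move=> H; apply: ssubst_bound => y Hy; case: (Nat.eqb_spec y x) => // E; lia.
Qed.

Lemma nd_exS_fresh G A x :
  nd (sinst x A :: G) Bot -> sbound (ExS A) <= x ->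
  Forall (fun B => sbound B <= x) G -> nd (ExS A :: G) Bot.
Proof.
move=> H HA HG; apply: (nd_exSE (A := A) (C := Bot)); first by apply/nd_ax/in_eq.
have := nd_ssubst (fun y => if Nat.eqb y x then 0 else S y) H.
rewrite /= => H'; apply: nd_weaken H' _; apply: incl_cons.
  left; rewrite /sinst ssubst_comp -[LHS]ssubst_id; apply: ssubst_bound => -[|y] /= Hy.
    by rewrite Nat.eqb_refl.
  simpl in HA; case: (Nat.eqb_spec y x) => // E; lia.
move=> B /in_map_iff [C [<- HC]]; right; right; apply/in_map_iff; exists C; split=> //.
by rewrite ssubst_fresh //; move/Forall_forall: HG; apply.
Qed.

(** * Enumeration of the formulas *)

Fixpoint term_code (t : term) : nat :=
  match t with
  | Var x => Cantor.to_nat (0, x)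
  | Zero => Cantor.to_nat (1, 0)
  | One => Cantor.to_nat (2, 0)
  | Add t u => Cantor.to_nat (3, Cantor.to_nat (term_code t, term_code u))
  | Mul t u => Cantor.to_nat (4, Cantor.to_nat (term_code t, term_code u))
  end.

Fixpoint form_code (A : form) : nat :=
  match A with
  | Eq t u => Cantor.to_nat (0, Cantor.to_nat (term_code t, term_code u))
  | Lt t u => Cantor.to_nat (1, Cantor.to_nat (term_code t, term_code u))
  | Mem t X => Cantor.to_nat (2, Cantor.to_nat (term_code t, X))
  | Bot => Cantor.to_nat (3, 0)
  | Imp A B => Cantor.to_nat (4, Cantor.to_nat (form_code A, form_code B))
  | And A B => Cantor.to_nat (5, Cantor.to_nat (form_code A, form_code B))
  | Or A B => Cantor.to_nat (6, Cantor.to_nat (form_code A, form_code B))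
  | All A => Cantor.to_nat (7, form_code A)
  | Ex A => Cantor.to_nat (8, form_code A)
  | AllS A => Cantor.to_nat (9, form_code A)
  | ExS A => Cantor.to_nat (10, form_code A)
  end.

Lemma cantor_inj a b c d : Cantor.to_nat (a, b) = Cantor.to_nat (c, d) -> a = c /\ b = d.
Proof. by move/Cantor.to_nat_inj=> [-> ->]. Qed.

Lemma term_code_inj t u : term_code t = term_code u -> t = u.
Proof.
elim: t u => [x||| t It v Iv|t It v Iv] [y|||t' v'|t' v'] /cantor_inj [] // _.
- by move=> ->.
- by case/cantor_inj => /It -> /Iv ->.
- by case/cantor_inj => /It -> /Iv ->.
Qed.

Lemma form_code_inj A B : form_code A = form_code B -> A = B.
Proof.
elim: A B => [t u|t u|t X||A IA B IB|A IA B IB|A IA B IB|A IA|A IA|A IA|A IA]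
  [t' u'|t' u'|t' X'||A' B'|A' B'|A' B'|A'|A'|A'|A'] /cantor_inj [] // _.
1,2: by case/cantor_inj => /term_code_inj -> /term_code_inj ->.
1: by case/cantor_inj => /term_code_inj -> ->.
1-3: by case/cantor_inj => /IA -> /IB ->.
all: by move/IA ->.
Qed.

Definition form_at (n : nat) : form := epsilon (inhabits Bot) (fun A => form_code A = n).

Lemma form_atK A : form_at (form_code A) = A.
Proof.
by apply: form_code_inj; apply: (epsilon_spec (inhabits Bot) (fun B => form_code B = form_code A)); exists A.
Qed.

Lemma bounds_above (f : form -> nat) (G : list form) :
  exists k, forall k', k <= k' -> Forall (fun B => f B <= k') G.
Proof.
elim: G => [|A G [k IH]]; first by exists 0 => k' _; constructor.
exists (k + f A) => k' H; constructor; first lia.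
apply: IH; lia.
Qed.

(** * The Henkin construction *)

Section Henkin.
Variables (T : form -> Prop) (goal : form).
Hypothesis T_closed : forall A, T A -> nbound A = 0 /\ sbound A = 0.
Hypothesis T_goal : ~ proves T goal.

Definition consistent (G : list form) : Prop := ~ exists G', Forall T G' /\ nd (G' ++ G) Bot.

(** The witness is a variable above everything free in the formula and in [G]. It is fresh for [T]
    as well, because the axioms are sentences. *)
Definition witness_of (A : form) (G : list form) : list form :=
  match A with
  | Ex B => [inst (Var (epsilon (inhabits 0) (fun k => nbound (Ex B) <= k /\ Forall (fun C => nbound C <= k) G))) B]
  | ExS B => [sinst (epsilon (inhabits 0) (fun k => sbound (ExS B) <= k /\ Forall (fun C => sbound C <= k) G)) B]
  | _ => []
  end.

Definition extend (A : form) (G : list form) : list form :=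
  if excluded_middle_informative (consistent (A :: G)) then witness_of A G ++ A :: G else G.

Fixpoint stage (n : nat) : list form :=
  match n with 0 => [Neg goal] | S n => extend (form_at n) (stage n) end.

Lemma T_fresh G k : Forall T G -> Forall (fun C => nbound C <= k) G.
Proof. by apply: Forall_impl => A /T_closed []; lia. Qed.

Lemma T_sfresh G k : Forall T G -> Forall (fun C => sbound C <= k) G.
Proof. by apply: Forall_impl => A /T_closed []; lia. Qed.

Lemma nd_swap G A G' B : nd (G ++ A :: G') B -> nd (A :: G ++ G') B.
Proof.
move/nd_weaken; apply=> C; rewrite /= !in_app_iff /=; tauto.
Qed.

Lemma extend_consistent A G : consistent G -> consistent (extend A G).
Proof.
rewrite /extend; case: excluded_middle_informative => // HA HG.
case: A HA => //= A HA [G' [TG']].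
- set x := epsilon _ _ => H; apply: HA; exists G'; split=> //.
  have [Hx HxG] : nbound (Ex A) <= x /\ Forall (fun C => nbound C <= x) G.
    apply: (epsilon_spec (inhabits 0) (fun k => nbound (Ex A) <= k /\ Forall (fun C => nbound C <= k) G)).
    have [k Hk] := bounds_above nbound G.
    exists (k + nbound (Ex A)); split; first lia.
    apply: Hk; lia.
  apply: nd_weaken (nd_ex_fresh (nd_swap H) Hx _) _.
    apply/Forall_app; split; first exact: T_fresh.
    by constructor.
  by move=> C; rewrite /= !in_app_iff /=; tauto.
- set x := epsilon _ _ => H; apply: HA; exists G'; split=> //.
  have [Hx HxG] : sbound (ExS A) <= x /\ Forall (fun C => sbound C <= x) G.
    apply: (epsilon_spec (inhabits 0) (fun k => sbound (ExS A) <= k /\ Forall (fun C => sbound C <= k) G)).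
    have [k Hk] := bounds_above sbound G.
    exists (k + sbound (ExS A)); split; first lia.
    apply: Hk; lia.
  apply: nd_weaken (nd_exS_fresh (nd_swap H) Hx _) _.
    apply/Forall_app; split; first exact: T_sfresh.
    by constructor.
  by move=> C; rewrite /= !in_app_iff /=; tauto.
Qed.

Lemma stage_consistent n : consistent (stage n).
Proof.
elim: n => [|n IH]; last exact: extend_consistent.
move=> [G [TG H]]; apply: T_goal; exists G; split=> //.
by apply: nd_raa; have := nd_swap H; rewrite app_nil_r.
Qed.

(** Truth is derivability from [T] and some stage, not membership in a stage; closure under
    deduction then only requires going to a common later stage. *)
Definition holds (A : form) : Prop := exists G n, Forall T G /\ nd (G ++ stage n) A.

Lemma stage_incl m n : m <= n -> incl (stage m) (stage n).
Proof.
elim=> [|k _ IH]; first exact: incl_refl.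
apply: incl_tran IH _ => A HA; rewrite /= /extend.
by case: excluded_middle_informative => //= _; rewrite in_app_iff /=; tauto.
Qed.

Lemma holds_nd G A : nd G A -> Forall holds G -> holds A.
Proof.
elim: G A => [|B G IH] A H HG; first by exists [], 0; split=> //; apply: nd_weaken H _ => C [].
inversion HG as [|? ? [GB [nB [TB HB]]] HG']; subst.
have [GA [nA [TA HA]]] := IH _ (nd_impI H) HG'.
exists (GA ++ GB), (nA + nB); split; first by apply/Forall_app.
apply: (nd_impE (A := B)).
- apply: nd_weaken HA _ => C; rewrite !in_app_iff => -[|]; first tauto.
  by move/(@stage_incl nA (nA + nB) ltac:(lia)); tauto.
- apply: nd_weaken HB _ => C; rewrite !in_app_iff => -[|]; first tauto.
  by move/(@stage_incl nB (nA + nB) ltac:(lia)); tauto.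
Qed.

Lemma holds_nd1 A B : nd [A] B -> holds A -> holds B.
Proof. by move=> H HA; apply: holds_nd H _; constructor. Qed.

Lemma holds_nd2 A B C : nd [A; B] C -> holds A -> holds B -> holds C.
Proof. by move=> H HA HB; apply: holds_nd H _; constructor=> //; constructor. Qed.

Lemma holds_bot : ~ holds Bot.
Proof. by move=> [G [n [TG H]]]; apply: (@stage_consistent n); exists G. Qed.

Lemma holds_T A : T A -> holds A.
Proof. by move=> TA; exists [A], 0; split; [constructor|apply: nd_ax; left]. Qed.

(** A formula is treated at the stage numbered by its code: it is added there together with its
    witness, or it contradicts that stage, which then derives its negation. *)
Lemma stage_cases A :
  (exists n, incl (witness_of A (stage n) ++ [A]) (stage (S n))) \/ holds (Neg A).
Proof.
set n := form_code A.
case: (excluded_middle_informative (consistent (A :: stage n))) => H.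
  left; exists n => B; rewrite /= form_atK /extend.
  by destruct excluded_middle_informative; rewrite ?in_app_iff /=; tauto.
right; case: (NNPP _ H) => G [TG HG].
by exists G, n; split=> //; apply: nd_impI; apply: nd_swap.
Qed.

Lemma holds_stage n A : In A (stage n) -> holds A.
Proof. by move=> H; exists [], n; split=> //; apply: nd_ax. Qed.

Lemma holds_em A : holds A \/ holds (Neg A).
Proof.
case: (stage_cases A) => [[n H]|]; last by right.
by left; apply: (@holds_stage (S n)); apply: H; apply/in_app_iff; right; left.
Qed.

Lemma holds_neg A : holds (Neg A) <-> ~ holds A.
Proof.
split=> [H HA|H]; last by case: (holds_em A).
apply: holds_bot; apply: holds_nd2 H HA; apply: (nd_impE (A := A)); apply: nd_ax => /=; tauto.
Qed.

Lemma holds_imp A B : holds (Imp A B) <-> (holds A -> holds B).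
Proof.
split=> [H HA|H].
  apply: holds_nd2 H HA; apply: (nd_impE (A := A)); apply: nd_ax => /=; tauto.
case: (holds_em A) => [/H|].
  apply: holds_nd1; apply: nd_impI; apply: nd_ax => /=; tauto.
apply: holds_nd1; apply: nd_impI; apply: nd_raa; apply: (nd_impE (A := A)); apply: nd_ax => /=; tauto.
Qed.

Lemma holds_and A B : holds (And A B) <-> holds A /\ holds B.
Proof.
split=> [H|[HA HB]].
  split; [apply: holds_nd1 H; apply: (nd_andE1 (B := B))|apply: holds_nd1 H; apply: (nd_andE2 (A := A))];
  by apply: nd_ax; left.
by apply: holds_nd2 HA HB; apply: nd_andI; apply: nd_ax => /=; tauto.
Qed.

Lemma holds_or A B : holds (Or A B) <-> holds A \/ holds B.
Proof.
split=> [H|[]].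
- apply: NNPP => HN; apply: holds_bot.
  have [/holds_neg HA /holds_neg HB] : ~ holds A /\ ~ holds B by tauto.
  apply: (@holds_nd [Or A B; Neg A; Neg B]); last by repeat constructor.
  apply: (nd_orE (A := A) (B := B)); first by apply: nd_ax; left.
  + apply: (nd_impE (A := A)); apply: nd_ax => /=; tauto.
  + apply: (nd_impE (A := B)); apply: nd_ax => /=; tauto.
- by apply: holds_nd1; apply: nd_orI1; apply: nd_ax; left.
- by apply: holds_nd1; apply: nd_orI2; apply: nd_ax; left.
Qed.

Lemma holds_ex A : holds (Ex A) <-> exists t, holds (inst t A).
Proof.
split=> [H|[t]]; last by apply: holds_nd1; apply: (nd_exI (t)); apply: nd_ax; left.
case: (stage_cases (Ex A)) => [[n Hn]|/holds_neg //].
by eexists; apply: (@holds_stage (S n)); apply: Hn; left.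
Qed.

Lemma holds_exS A : holds (ExS A) <-> exists X, holds (sinst X A).
Proof.
split=> [H|[t]]; last by apply: holds_nd1; apply: (nd_exSI (t)); apply: nd_ax; left.
case: (stage_cases (ExS A)) => [[n Hn]|/holds_neg //].
by eexists; apply: (@holds_stage (S n)); apply: Hn; left.
Qed.

Lemma holds_all A : holds (All A) <-> forall t, holds (inst t A).
Proof.
split=> [H t|H].
  by apply: holds_nd1 H; apply: nd_allE; apply: nd_ax; left.
apply: NNPP => /holds_neg HN.
have /holds_ex [t] : holds (Ex (Neg A)).
  apply: holds_nd1 HN; apply: nd_raa; apply: (nd_impE (A := All A)); first by apply: nd_ax; right; left.
  apply: nd_allI; apply: nd_raa; apply: (nd_impE (A := shift (Ex (Neg A)))); first by apply: nd_ax; right; left.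
  apply: (nd_exI (Var 0)); 
  match goal with |- nd ?G _ =>
    change (nd G (subst (scons (Var 0) Var) (subst (up (fun x => Var (S x))) (Neg A)))) end.
  rewrite subst_comp.
  have -> : (fun x => tsubst (scons (Var 0) Var) (up (fun x => Var (S x)) x)) = Var
    by apply: functional_extensionality => -[].
  by rewrite subst_id; apply: nd_ax; left.
by move=> Ht; exact: (proj1 (holds_neg _) Ht (H t)).
Qed.

Lemma holds_allS A : holds (AllS A) <-> forall t, holds (sinst t A).
Proof.
split=> [H t|H].
  by apply: holds_nd1 H; apply: nd_allSE; apply: nd_ax; left.
apply: NNPP => /holds_neg HN.
have /holds_exS [t] : holds (ExS (Neg A)).
  apply: holds_nd1 HN; apply: nd_raa; apply: (nd_impE (A := AllS A)); first by apply: nd_ax; right; left.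
  apply: nd_allSI; apply: nd_raa; apply: (nd_impE (A := sshift (ExS (Neg A)))); first by apply: nd_ax; right; left.
  apply: (nd_exSI 0); 
  match goal with |- nd ?G _ =>
    change (nd G (ssubst (scons 0 id) (ssubst (sup S) (Neg A)))) end.
  rewrite ssubst_comp.
  have -> : (fun x => scons 0 id (sup S x)) = id by apply: functional_extensionality => -[].
  by rewrite ssubst_id; apply: nd_ax; left.
by move=> Ht; exact: (proj1 (holds_neg _) Ht (H t)).
Qed.

Lemma holds_eq_sub A t u : holds (Eq t u) -> holds (inst t A) -> holds (inst u A).
Proof.
apply: holds_nd2; apply: (nd_eqE (t := t)); apply: nd_ax => /=; tauto.
Qed.

Lemma holds_eq_refl t : holds (Eq t t).
Proof. by exists [], 0; split=> //; apply: nd_eqI. Qed.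

Lemma inst_shift_term t u : tsubst (scons u Var) (tshift t) = t.
Proof. by rewrite /tshift tsubst_comp tsubst_id. Qed.

Lemma holds_eq_sym t u : holds (Eq t u) -> holds (Eq u t).
Proof.
move=> H; have := @holds_eq_sub (Eq (Var 0) (tshift t)) t u H.
by rewrite /inst /= !inst_shift_term; apply; apply: holds_eq_refl.
Qed.

Lemma holds_eq_trans t u v : holds (Eq t u) -> holds (Eq u v) -> holds (Eq t v).
Proof.
move=> H1 H2; have := @holds_eq_sub (Eq (tshift t) (Var 0)) u v H2.
by rewrite /inst /= !inst_shift_term; apply.
Qed.

Notation tcls := (cls holds_eq_refl holds_eq_sym holds_eq_trans).

(** Only the numbers are divided by provable equality. The set variables themselves are the sets,
    since they are the only set terms. *)
Definition term_model : model :=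
  @Model (quotient (fun t u => holds (Eq t u))) nat (tcls Zero) (tcls One)
    (fun a b => tcls (Add (repr a) (repr b)))
    (fun a b => tcls (Mul (repr a) (repr b)))
    (fun a b => holds (Lt (repr a) (repr b)))
    (fun a X => holds (Mem (repr a) X)).

Lemma holds_lt t u t' u' : holds (Eq t t') -> holds (Eq u u') -> holds (Lt t u) -> holds (Lt t' u').
Proof.
move=> Ht Hu H.
have := @holds_eq_sub (Lt (Var 0) (tshift u)) t t' Ht; rewrite /inst /= !inst_shift_term => /(_ H).
by have := @holds_eq_sub (Lt (tshift t') (Var 0)) u u' Hu; rewrite /inst /= !inst_shift_term.
Qed.

Lemma holds_mem t t' X : holds (Eq t t') -> holds (Mem t X) -> holds (Mem t' X).
Proof. by move=> Ht H; have := @holds_eq_sub (Mem (Var 0) X) t t' Ht; apply. Qed.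

Lemma holds_add t u t' u' : holds (Eq t t') -> holds (Eq u u') -> holds (Eq (Add t u) (Add t' u')).
Proof.
move=> Ht Hu.
have := @holds_eq_sub (Eq (tshift (Add t u)) (Add (Var 0) (tshift u))) t t' Ht.
rewrite /inst /= !inst_shift_term => /(_ (holds_eq_refl _)).
by have := @holds_eq_sub (Eq (tshift (Add t u)) (Add (tshift t') (Var 0))) u u' Hu;
   rewrite /inst /= !inst_shift_term.
Qed.

Lemma holds_mul t u t' u' : holds (Eq t t') -> holds (Eq u u') -> holds (Eq (Mul t u) (Mul t' u')).
Proof.
move=> Ht Hu.
have := @holds_eq_sub (Eq (tshift (Mul t u)) (Mul (Var 0) (tshift u))) t t' Ht.
rewrite /inst /= !inst_shift_term => /(_ (holds_eq_refl _)).
by have := @holds_eq_sub (Eq (tshift (Mul t u)) (Mul (tshift t') (Var 0))) u u' Hu;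
   rewrite /inst /= !inst_shift_term.
Qed.

Lemma teval_term_model (s : nat -> term) t :
  teval (M := term_model) (fun x => tcls (s x)) t = tcls (tsubst s t).
Proof.
elim: t => //= t -> u ->; apply/(cls_eq holds_eq_refl); apply: holds_eq_sym;
  [apply: holds_add|apply: holds_mul]; exact: (repr_cls holds_eq_refl holds_eq_sym holds_eq_trans).
Qed.

(** The truth lemma, for assignments given by substitutions: in the quantifier cases an element of
    the model is the class of a term, by which [s] is extended. *)
Lemma sat_term_model A (s : nat -> term) (r : nat -> nat) :
  sat (M := term_model) (fun x => tcls (s x)) r A <-> holds (ssubst r (subst s A)).
Proof.
have E t := repr_cls holds_eq_refl holds_eq_sym holds_eq_trans t.
have E' t := holds_eq_sym (E t).
elim: A s r => [t u|t u|t X||A IA B IB|A IA B IB|A IA B IB|A IA|A IA|A IA|A IA] s r;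
  cbn [sat subst ssubst].
- by rewrite !teval_term_model; exact: (cls_eq holds_eq_refl holds_eq_sym holds_eq_trans).
- by cbn; rewrite !teval_term_model; split; apply: holds_lt; (exact: E || exact: E').
- by cbn; rewrite !teval_term_model; split; apply: holds_mem; (exact: E || exact: E').
- by split=> // /holds_bot.
- by rewrite IA IB holds_imp.
- by rewrite IA IB holds_and.
- by rewrite IA IB holds_or.
- have K t : (fun x => tcls (scons t s x)) = scons (tcls t) (fun x => tcls (s x)).
    by apply: functional_extensionality => -[].
  have L t : inst t (ssubst r (subst (up s) A)) = ssubst r (subst (scons t s) A).
    rewrite /inst -subst_ssubst subst_comp; congr (ssubst _ (subst _ _)).
    by apply: functional_extensionality => -[|x] //=; rewrite inst_shift_term.
  rewrite holds_all; split=> H t.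
  + by rewrite L -IA K; apply: H.
  + by rewrite -((cls_repr holds_eq_refl holds_eq_sym holds_eq_trans) t) -K IA -L; apply: H.
- have K t : (fun x => tcls (scons t s x)) = scons (tcls t) (fun x => tcls (s x)).
    by apply: functional_extensionality => -[].
  have L t : inst t (ssubst r (subst (up s) A)) = ssubst r (subst (scons t s) A).
    rewrite /inst -subst_ssubst subst_comp; congr (ssubst _ (subst _ _)).
    by apply: functional_extensionality => -[|x] //=; rewrite inst_shift_term.
  rewrite holds_ex; split=> -[t H].
  + by exists (repr t); rewrite L -IA K (cls_repr holds_eq_refl holds_eq_sym holds_eq_trans).
  + by exists (tcls t); rewrite -K IA -L.
- have L t : sinst t (ssubst (sup r) (subst s A)) = ssubst (scons t r) (subst s A).
    by rewrite /sinst ssubst_comp; congr ssubst; apply: functional_extensionality => -[].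
  rewrite holds_allS; split=> H t; first by rewrite L -IA; apply: H.
  by rewrite IA -L; apply: H.
- have L t : sinst t (ssubst (sup r) (subst s A)) = ssubst (scons t r) (subst s A).
    by rewrite /sinst ssubst_comp; congr ssubst; apply: functional_extensionality => -[].
  rewrite holds_exS; split=> -[t H]; exists t; first by rewrite L -IA.
  by rewrite IA -L.
Qed.

Lemma subst_closed A (s : nat -> term) (r : nat -> nat) : nbound A = 0 -> sbound A = 0 -> ssubst r (subst s A) = A.
Proof.
move=> HA HS; have -> : subst s A = subst Var A by apply: subst_bound => x; lia.
by rewrite subst_id -[RHS]ssubst_id; apply: ssubst_bound => x; lia.
Qed.

Lemma term_model_T A v w : T A -> sat (M := term_model) v w A.
Proof.
move=> TA; have [HA HS] := T_closed TA.
have -> : v = fun x => tcls (repr (v x))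
  by apply: functional_extensionality => x; rewrite (cls_repr holds_eq_refl holds_eq_sym holds_eq_trans).
by apply/sat_term_model; rewrite subst_closed //; apply: holds_T.
Qed.

Lemma term_model_goal : ~ sat (M := term_model) (fun x => tcls (Var x)) id goal.
Proof.
move/sat_term_model; rewrite subst_id ssubst_id; apply/holds_neg.
by exists [], 0; split=> //; apply: nd_ax; left.
Qed.

End Henkin.

Theorem completeness (T : form -> Prop) (goal : form) :
  (forall A, T A -> nbound A = 0 /\ sbound A = 0) ->
  (forall M : model, (forall A v w, T A -> sat (M := M) v w A) ->
     forall v w, sat (M := M) v w goal) ->
  proves T goal.
Proof.
move=> HT H; apply: NNPP => Hgoal.
apply: (term_model_goal HT Hgoal); apply: H => A v w; exact: term_model_T.
Qed.

(** * Axioms are closed; removing universal closures *)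

Lemma univ_closure_closed A : nbound (univ_closure A) = 0 /\ sbound (univ_closure A) = 0.
Proof.
have N n B : nbound (Nat.iter n All B) = nbound B - n by elim: n => [|n IH] /=; rewrite ?IH; lia.
have N' n B : nbound (Nat.iter n AllS B) = nbound B by elim: n => [|n IH] /=; rewrite ?IH; lia.
have S n B : sbound (Nat.iter n All B) = sbound B by elim: n => [|n IH] /=; rewrite ?IH; lia.
have S' n B : sbound (Nat.iter n AllS B) = sbound B - n by elim: n => [|n IH] /=; rewrite ?IH; lia.
by rewrite /univ_closure N' S' N S; lia.
Qed.

Lemma RCA0_closed A : RCA0 A -> nbound A = 0 /\ sbound A = 0.
Proof.
case=> [B|B _|B C _ _]; try exact: univ_closure_closed.
by rewrite /PA_minus /=; intuition (subst; split; reflexivity).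
Qed.

Lemma sat_univ_closure (M : model) A :
  (forall v w, sat (M := M) v w (univ_closure A)) -> forall v w, sat (M := M) v w A.
Proof.
rewrite /univ_closure => H.
have {}H : forall v w, sat (M := M) v w (Nat.iter (nbound A) All A).
  elim: (sbound A) H => //= n IH H; apply: IH => v w.
  by have := H v (fun x => w (S x)) (w 0); rewrite scons_eta.
elim: (nbound A) H => //= n IH H; apply: IH => v w.
by have := H (fun x => v (S x)) w (v 0); rewrite scons_eta.
Qed.

(** * Ordered arithmetic in a model of RCA_0 *)

(** [rca_set] witnesses that the sort of sets is nonempty, which is needed to form assignments; for
    numbers [0] does this. *)
Record rca : Type := Rca {
  rca_model :> model;
  rca_set : set_of rca_model;
  rca_sat : forall A v w, RCA0 A -> sat (M := rca_model) v w A }.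

Declare Scope m_scope.
Delimit Scope m_scope with m.
Bind Scope m_scope with num_of.

Notation "0" := (mzero _) : m_scope.
Notation "1" := (mone _) : m_scope.
Notation "x + y" := (madd x y) : m_scope.
Notation "x * y" := (mmul x y) : m_scope.
Notation "x < y" := (mlt x y) : m_scope.
Notation "x <= y" := (mlt x (madd y (mone _))) : m_scope.
Notation "x '\in' X" := (mmem x X) (at level 70) : m_scope.

Section Arith.
Context {M : rca}.
Local Open Scope m_scope.
Implicit Types x y z u v : M.

Lemma pa_nth n A : nth_error PA_minus n = Some A ->
  sat (M := M) (fun _ => 0) (fun _ => rca_set M) A.
Proof. by move=> E; apply: rca_sat; apply: RCA0_PA_minus; apply: nth_error_In E. Qed.

Lemma maddA x y z : x + y + z = x + (y + z).
Proof. exact: (@pa_nth 0 _ eq_refl). Qed.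
Lemma maddC x y : x + y = y + x.
Proof. exact: (@pa_nth 1 _ eq_refl). Qed.
Lemma mmulA x y z : x * y * z = x * (y * z).
Proof. exact: (@pa_nth 2 _ eq_refl). Qed.
Lemma mmulC x y : x * y = y * x.
Proof. exact: (@pa_nth 3 _ eq_refl). Qed.
Lemma mmulDr x y z : x * (y + z) = x * y + x * z.
Proof. exact: (@pa_nth 4 _ eq_refl). Qed.
Lemma madd0 x : x + 0 = x.
Proof. exact: (@pa_nth 5 _ eq_refl). Qed.
Lemma mmul0 x : x * 0 = 0.
Proof. exact: (@pa_nth 6 _ eq_refl). Qed.
Lemma mmul1 x : x * 1 = x.
Proof. exact: (@pa_nth 7 _ eq_refl). Qed.
Lemma mlt_irr x : ~ x < x.
Proof. exact: (@pa_nth 8 _ eq_refl). Qed.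
Lemma mlt_trans x y z : x < y -> y < z -> x < z.
Proof. by move=> H1 H2; apply: (@pa_nth 9 _ eq_refl x y z). Qed.
Lemma mlt_total x y : x < y \/ x = y \/ y < x.
Proof. exact: (@pa_nth 10 _ eq_refl x y). Qed.
Lemma mlt_add x y z : x < y -> x + z < y + z.
Proof. exact: (@pa_nth 11 _ eq_refl x y z). Qed.
Lemma mlt_mul x y z : 0 < z -> x < y -> x * z < y * z.
Proof. by move=> H1 H2; apply: (@pa_nth 12 _ eq_refl x y z). Qed.
Lemma mlt_diff x y : x < y -> exists z, x + z = y.
Proof. exact: (@pa_nth 13 _ eq_refl x y). Qed.
Lemma mlt01 : (0 : M) < 1.
Proof. exact: (@pa_nth 14 _ eq_refl). Qed.
Lemma mpos_ge1 x : 0 < x -> 1 < x \/ 1 = x.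
Proof. exact: (@pa_nth 15 _ eq_refl x). Qed.
Lemma mnneg x : 0 < x \/ 0 = x.
Proof. exact: (@pa_nth 16 _ eq_refl x). Qed.

Lemma msemiring : semi_ring_theory (0 : M) 1 (@madd M) (@mmul M) eq.
Proof.
split=> *; rewrite -?maddA -?mmulA //.
- by rewrite maddC madd0.
- exact: maddC.
- by rewrite mmulC mmul1.
- by rewrite mmulC mmul0.
- exact: mmulC.
- by rewrite mmulC mmulDr; congr madd; rewrite mmulC.
Qed.

Add Ring mring : msemiring.

Lemma madd_lt_cancel x y z : x + z < y + z -> x < y.
Proof.
move=> H; case: (mlt_total x y) => [//|[E|/(mlt_add z) H']].
  by case: (@mlt_irr (x + z)); rewrite {2}E.
by case: (mlt_irr (mlt_trans H H')).
Qed.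

Lemma madd_cancel x y z : x + z = y + z -> x = y.
Proof.
move=> E; case: (mlt_total x y) => [|[//|]] /(mlt_add z); rewrite E; by move/mlt_irr.
Qed.

Lemma mlt_le1 x y : x < y <-> x + 1 <= y.
Proof. by split; [apply: mlt_add|apply: madd_lt_cancel]. Qed.

(** As [x <= y] abbreviates [x < y + 1], this is the discreteness of the order, coming from
    [mpos_ge1]. *)
Lemma mle_lteq x y : x <= y <-> x < y \/ x = y.
Proof.
split=> [H|[H|->]].
- case: (mlt_total x y) => [|[|H']]; [by left|by right|].
  have [z Ez] := mlt_diff H'; rewrite -Ez in H.
  have Hz : z < 1.
    apply: (@madd_lt_cancel _ _ y); by rewrite maddC [1 + y]maddC.
  case: (mnneg z) => [/mpos_ge1 [/(mlt_trans Hz)|Hz1]|Hz0].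
  + by move/mlt_irr.
  + by rewrite Hz1 in Hz; move: Hz => /mlt_irr.
  + by rewrite -Ez -Hz0 madd0; right.
- apply: mlt_trans H _; rewrite -{1}(madd0 y) [y + 0]maddC [y + 1]maddC; apply: mlt_add; exact: mlt01.
- rewrite -{1}(madd0 y) [y + 0]maddC [y + 1]maddC; apply: mlt_add; exact: mlt01.
Qed.

Lemma mlt_S x : x < x + 1.
Proof. by apply/mle_lteq; right. Qed.

Lemma mle0 x : 0 <= x.
Proof. by apply/mle_lteq; case: (mnneg x); tauto. Qed.

Lemma mlt_nle x y : ~ x < y <-> y <= x.
Proof.
rewrite mle_lteq; split=> [H|[H H'|-> /mlt_irr//]]; last exact: mlt_irr (mlt_trans H H').
by case: (mlt_total x y) => [//|[]]; auto.
Qed.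

(** ** The ring of formal differences, as a setoid *)

Definition diff : Type := (M * M)%type.
Definition deq (p q : diff) : Prop := fst p + snd q = fst q + snd p.
Definition dle (p q : diff) : Prop := fst p + snd q <= fst q + snd p.
Definition dlt (p q : diff) : Prop := fst p + snd q < fst q + snd p.
Definition dzero : diff := (0, 0).
Definition done_ : diff := (1, 0).
Definition dadd (p q : diff) : diff := (fst p + fst q, snd p + snd q).
Definition dopp (p : diff) : diff := (snd p, fst p).
Definition dsub (p q : diff) : diff := dadd p (dopp q).
Definition dmul (p q : diff) : diff :=
  (fst p * fst q + snd p * snd q, fst p * snd q + snd p * fst q).

Lemma deq_equiv : Setoid_Theory diff deq.
Proof.
split.
- by move=> [a b].
- by move=> [a b] [c d]; rewrite /deq.
- move=> [a b] [c d] [e f]; rewrite /deq /= => H1 H2.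
  apply: (@madd_cancel _ _ (c + d)).
  have -> : a + f + (c + d) = (a + d) + (c + f) by ring.
  by rewrite H1 H2; ring.
Qed.

Lemma dlt_wd p p' q q' : deq p p' -> deq q q' -> dlt p q -> dlt p' q'.
Proof.
case: p p' q q' => [a b] [a' b'] [c d] [c' d']; rewrite /deq /dlt /= => H1 H2 H.
apply: (@madd_lt_cancel _ _ (b + d)).
have -> : a' + d' + (b + d) = a + d + (b' + d').
  by have -> : a' + d' + (b + d) = (a' + b) + d' + d by [ring]; rewrite -H1; ring.
have -> : c' + b' + (b + d) = c + b + (b' + d').
  by have -> : c' + b' + (b + d) = (c' + d) + b' + b by [ring]; rewrite -H2; ring.
exact: mlt_add.
Qed.

Lemma dle_dlt p q : dle p q <-> dlt p q \/ deq p q.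
Proof. exact: mle_lteq. Qed.

Lemma deq_sym p q : deq p q -> deq q p.
Proof. by rewrite /deq. Qed.

Lemma deq_trans p q r : deq p q -> deq q r -> deq p r.
Proof. by case: deq_equiv => _ _; apply. Qed.

Lemma dle_wd p p' q q' : deq p p' -> deq q q' -> dle p q -> dle p' q'.
Proof.
move=> E E'; rewrite !dle_dlt => -[H|H]; [left; exact: dlt_wd E E' H|right].
exact: deq_trans (deq_sym E) (deq_trans H E').
Qed.

(** The certificate checker works over ordered rings, and a model is only a semiring. The notion
    [SOR] is parametric in its equality, so the formal differences need not be divided by [deq]. *)
Lemma diff_sor : SOR dzero done_ dadd dmul dsub dopp deq dle dlt.
Proof.
split.
- exact: deq_equiv.
- move=> [a b] [a' b'] H [c d] [c' d'] H'; rewrite /deq /= in H H' *.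
  have -> : a + c + (b' + d') = (a + b') + (c + d') by ring.
  by rewrite H H'; ring.
- move=> [a b] [a' b'] H [c d] [c' d'] H'; rewrite /deq /= in H H' *.
  apply: (@madd_cancel _ _ (a' * d + b' * c)).
  have -> : a * c + b * d + (a' * d' + b' * c') + (a' * d + b' * c)
          = (a + b') * c + (a' + b) * d + (a' * d' + b' * c') by ring.
  rewrite H.
  have -> : (a' + b) * c + (a' + b) * d + (a' * d' + b' * c')
       = b * c + (a + b') * d  + a' * (c + d') + b' * c' by rewrite H; ring.
  rewrite H'.
  have -> : b * c + (a + b') * d + a' * (c' + d) + b' * c'
     = b * c + a * d + a' * c' + b' * (c' + d) + a' * d by ring.
  by rewrite -H'; ring.
- by move=> [a b] [a' b']; rewrite /deq /= => H; rewrite maddC -H maddC.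
- by move=> p p' E q q' E'; split; apply: dle_wd => //; apply: deq_sym.
- by move=> p p' E q q' E'; split; apply: dlt_wd => //; apply: deq_sym.
- by split=> [[a b]|[a b] [c d]|[a b] [c d] [e f]|[a b]|[a b] [c d]|[a b] [c d] [e f]|[a b] [c d] [e f]|//|[a b]];
    rewrite /deq /=; ring.
- by move=> p; apply/dle_dlt; right.
- move=> p q /dle_dlt [H|//] /dle_dlt [H'|/deq_sym//]; by case: (mlt_irr (mlt_trans H H')).
- move=> p q r; rewrite !dle_dlt => -[H|H] [H'|H'].
  + left; case: p q r H H' => [a b] [c d] [e f]; rewrite /dlt /= => H H'.
    apply: (@madd_lt_cancel _ _ (c + d)).
    apply: (@mlt_trans _ (c + b + (c + f))).
      have -> : a + f + (c + d) = a + d + (c + f) by ring.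
      exact: mlt_add.
    have -> : e + b + (c + d) = e + d + (c + b) by ring.
    by rewrite maddC; apply: mlt_add.
  + left; exact: dlt_wd (deq_equiv.(RelationClasses.Equivalence_Reflexive) p) H' H.
  + left; exact: dlt_wd (deq_sym H) (deq_equiv.(RelationClasses.Equivalence_Reflexive) r) H'.
  + right; exact: deq_trans H H'.
- move=> p q; rewrite dle_dlt; split=> [H|[[//|H]]]; last by case.
  split; first by left.
  by move=> E; rewrite /dlt E in H; case: (mlt_irr H).
- by move=> p q; exact: mlt_total.
- move=> [a b] [c d] [e f]; rewrite /dle /= => H.
  have -> : e + a + (f + d) = a + d + (e + f) by ring.
  have -> : e + c + (f + b) + 1 = c + b + 1 + (e + f) by ring.
  exact: mlt_add.
- move=> [a b] [c d]; rewrite /dlt /= => H H'.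
  have [x Ex] : exists x, b + x = a by apply: mlt_diff; move: H; have -> : 0 + b = b by [ring]; have -> : a + 0 = a by ring.
  have [y Ey] : exists y, d + y = c by apply: mlt_diff; move: H'; have -> : 0 + d = d by [ring]; have -> : c + 0 = c by ring.
  subst a c.
  have Hx : 0 < x by apply: (@madd_lt_cancel _ _ b); move: H; have -> : b + x + 0 = x + b by ring.
  have Hy : 0 < y by apply: (@madd_lt_cancel _ _ d); move: H'; have -> : d + y + 0 = y + d by ring.
  have -> : (b + x) * (d + y) + b * d + 0 = x * y + ((b + x) * d + b * (d + y)) by ring.
  apply: mlt_add; have := mlt_mul Hy Hx; by have -> : 0 * y = 0 by ring.
- by rewrite /deq /= !madd0 => E; have := mlt01; rewrite E => /mlt_irr.
Qed.

(** ** Linear arithmetic by Positivstellensatz certificates *)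

Definition phiZ : Z -> diff := gen_order_phi_Z dzero done_ dadd dmul dopp.

Definition dpow : diff -> N -> diff := pow_N done_ dmul.

Lemma diff_addon : SORaddon dzero done_ dadd dmul dsub dopp deq dle 0%Z 1%Z Z.add Z.mul Z.sub Z.opp
  Z.eqb Z.leb phiZ (fun n => n) dpow.
Proof.
split.
- exact: (Zring_morph diff_sor).
- by split=> *; apply: (SORsetoid diff_sor).(RelationClasses.Equivalence_Reflexive).
- exact: (Zcneqb_morph diff_sor).
- exact: (Zcleb_morph diff_sor).
Qed.

Inductive mexp : Type :=
| MVar (p : positive)
| MZero
| MOne
| MAdd (e f : mexp)
| MMul (e f : mexp).

Inductive matom : Type :=
| MEq (e f : mexp)
| MLt (e f : mexp).

Fixpoint mexp_eval (env : list M) (e : mexp) : M :=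
  match e with
  | MVar p => nth (Nat.pred (Pos.to_nat p)) env 0
  | MZero => 0
  | MOne => 1
  | MAdd e f => mexp_eval env e + mexp_eval env f
  | MMul e f => mexp_eval env e * mexp_eval env f
  end.

Definition matom_eval (env : list M) (a : matom) : Prop :=
  match a with
  | MEq e f => mexp_eval env e = mexp_eval env f
  | MLt e f => mexp_eval env e < mexp_eval env f
  end.

Fixpoint mexp_pexpr (e : mexp) : PExpr Z :=
  match e with
  | MVar p => PEX p
  | MZero => PEc 0%Z
  | MOne => PEc 1%Z
  | MAdd e f => PEadd (mexp_pexpr e) (mexp_pexpr f)
  | MMul e f => PEmul (mexp_pexpr e) (mexp_pexpr f)
  end.

(* Discreteness: [x < y] is passed to the certificate checker as [x + 1 <= y]. *)
Definition matom_formula (a : matom) : Formula Z :=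
  match a with
  | MEq e f => Build_Formula (mexp_pexpr e) OpEq (mexp_pexpr f)
  | MLt e f => Build_Formula (PEadd (mexp_pexpr e) (PEc 1%Z)) OpLe (mexp_pexpr f)
  end.

(** Passing to differences forgets that numbers are nonnegative. This is restored by extra
    hypotheses, for the variables and also for the products, which the linear search treats as
    atoms. *)
Fixpoint mexp_nonneg (e : mexp) : list mexp :=
  match e with
  | MVar _ => [e]
  | MZero | MOne => []
  | MAdd f g => mexp_nonneg f ++ mexp_nonneg g
  | MMul f g => e :: mexp_nonneg f ++ mexp_nonneg g
  end.

Definition matom_nonneg (a : matom) : list mexp :=
  match a with MEq e f | MLt e f => mexp_nonneg e ++ mexp_nonneg f end.

Definition nonneg_formula (e : mexp) : Formula Z :=
  Build_Formula (PEc 0%Z) OpLe (mexp_pexpr e).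

Definition formulas (hs : list matom) : list (Formula Z) :=
  map matom_formula hs ++ map nonneg_formula (flat_map matom_nonneg hs).

Definition denv (env : list M) : PolEnv diff := fun p => (nth (Nat.pred (Pos.to_nat p)) env 0, 0).

Definition dformula : PolEnv diff -> Formula Z -> Prop :=
  eval_formula dadd dmul dsub dopp deq dle dlt phiZ (fun n => n) dpow.

Lemma mexp_pexpr_eval env e :
  deq (eval_pexpr dadd dmul dsub dopp phiZ (fun n => n) dpow (denv env) (mexp_pexpr e))
      (mexp_eval env e, 0).
Proof.
have Erefl := (SORsetoid diff_sor).(RelationClasses.Equivalence_Reflexive).
elim: e => [p|||e IHe f IHf|e IHe f IHf]; cbn -[dadd dmul deq].
- exact: Erefl.
- exact: Erefl.
- exact: Erefl.
- apply: deq_trans (SORplus_wd diff_sor _ _ IHe _ _ IHf) _.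
  by rewrite /deq /=; ring.
- apply: deq_trans (SORtimes_wd diff_sor _ _ IHe _ _ IHf) _.
  by rewrite /deq /=; ring.
Qed.

Lemma matom_formulaP env a : matom_eval env a -> dformula (denv env) (matom_formula a).
Proof.
case: a => e f /= H.
- apply: deq_trans (mexp_pexpr_eval env e) _; apply: deq_sym.
  by apply: deq_trans (mexp_pexpr_eval env f) _; rewrite /deq /= H.
- apply: (dle_wd (p := dadd (mexp_eval env e, 0) (1, 0)) (q := (mexp_eval env f, 0))).
  + apply: deq_sym; apply: (SORplus_wd diff_sor _ _ (mexp_pexpr_eval env e) _ (1, 0)).
    exact: (SORsetoid diff_sor).(RelationClasses.Equivalence_Reflexive).
  + exact/deq_sym/mexp_pexpr_eval.
  + by rewrite /dle /= !madd0; exact: (proj1 (mlt_le1 _ _) H).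
Qed.

Lemma nonneg_formulaP env e : dformula (denv env) (nonneg_formula e).
Proof.
apply: (dle_wd (p := (0, 0)) (q := (mexp_eval env e, 0))).
- exact: (SORsetoid diff_sor).(RelationClasses.Equivalence_Reflexive).
- exact/deq_sym/mexp_pexpr_eval.
- by rewrite /dle /= !madd0; apply: mle0.
Qed.

Definition refute (fs : list (Formula Z)) : Tauto.BFormula (Formula Z) Tauto.isProp :=
  fold_right (fun f g => Tauto.IMPL (Tauto.A Tauto.isProp f tt) None g) (Tauto.FF Tauto.isProp) fs.

Definition checker (f : Tauto.BFormula (Formula Z) Tauto.isProp) (w : list (Psatz Z)) : bool :=
  Tauto.tauto_checker
    (check_inconsistent 0%Z Z.eqb Z.leb)
    (nformula_plus_nformula 0%Z Z.add Z.eqb)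
    (@cnf_normalise Z 0%Z 1%Z Z.add Z.mul Z.sub Z.opp Z.eqb Z.leb unit)
    (@cnf_negate Z 0%Z 1%Z Z.add Z.mul Z.sub Z.opp Z.eqb Z.leb unit)
    (fun cl => check_normalised_formulas 0%Z 1%Z Z.add Z.mul Z.eqb Z.leb (List.map fst cl)) f w.

Definition dformula_kind (env : PolEnv diff) (k : Tauto.kind) (f : Formula Z) : Tauto.rtyp k :=
  match k with
  | Tauto.isProp => dformula env f
  | Tauto.isBool => if excluded_middle_informative (dformula env f) then true else false
  end.

Lemma dformula_kindP env k f : Tauto.hold k (dformula_kind env k f) <-> dformula env f.
Proof. by case: k => //=; case: excluded_middle_informative. Qed.

Lemma checker_sound f w : checker f w = true ->
  forall env, Tauto.eval_bf (dformula_kind env) f.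
Proof.
pose nf := eval_nformula dzero dadd dmul deq dle dlt phiZ.
apply Tauto.tauto_checker_sound with (eval' := nf).
- exact: (eval_nformula_dec diff_sor).
- by move=> [p o] u env; apply: (check_inconsistent_sound diff_sor diff_addon).
- intros t t' u D env; intros; revert D; apply (nformula_plus_nformula_correct diff_sor diff_addon env t t'); assumption.
- move=> env k t tg /(proj1 (cnf_normalise_correct diff_sor diff_addon env t tg)).
  exact: (proj2 (dformula_kindP env k t)).
- move=> env k t tg /(proj1 (cnf_negate_correct diff_sor diff_addon env t tg)) H.
  by apply/Tauto.hold_eNOT => /dformula_kindP.
- move=> t w0 H env.
  rewrite (Refl.make_impl_map (nf env)) //.
  exact: (checker_nf_sound diff_sor diff_addon) H env.
Qed.

Fixpoint refutes (env : list M) (hs : list matom) : Prop :=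
  match hs with
  | [] => False
  | a :: hs => matom_eval env a -> refutes env hs
  end.

Lemma refutes_sound env hs w : checker (refute (formulas hs)) w = true -> refutes env hs.
Proof.
move=> /checker_sound /(_ (denv env)) H.
have K fs : Tauto.eval_bf (dformula_kind (denv env)) (refute fs) ->
   Forall (dformula (denv env)) fs -> False.
  by elim: fs => //= f fs IH H' HF; inversion HF; subst; apply: IH => //; apply: H'.
have {}H : Forall (matom_eval env) hs -> False.
  move=> Hhs; apply: (K _ H); apply/Forall_app; split.
  - by apply/Forall_map; apply: Forall_impl Hhs => a; apply: matom_formulaP.
  - by apply/Forall_map/Forall_forall => e _; apply: nonneg_formulaP.
elim: hs H {K w} => [|a hs IH] /= H; first by apply: H.
by move=> Ha; apply: IH => Hhs; apply: H; constructor.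
Qed.
End Arith.

(** Certificates are searched over the rationals, but only integers map into [diff]: formulas are
    sent to [Q] and certificates brought back by [psatz_Z]. The default case is harmless because
    [mexp_pexpr] produces just the four constructors listed. *)
Fixpoint pexpr_Q (e : PExpr Z) : PExpr Q :=
  match e with
  | PEX p => PEX p
  | PEc z => PEc (inject_Z z)
  | PEadd e f => PEadd (pexpr_Q e) (pexpr_Q f)
  | PEmul e f => PEmul (pexpr_Q e) (pexpr_Q f)
  | _ => PEc (inject_Z 0)
  end.

Definition formula_Q (f : Formula Z) : Formula Q :=
  Build_Formula (pexpr_Q (Flhs f)) (Fop f) (pexpr_Q (Frhs f)).

Definition refute_Q (hs : list matom) : Tauto.BFormula (Formula Q) Tauto.isProp :=
  Tauto.map_bformula formula_Q (refute (formulas hs)).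

(* A certificate over [Q] is turned into one over [Z], whose value is the
   original one multiplied by the returned denominator. *)
Fixpoint pol_Z (p : Pol Q) : Pol Z * positive :=
  match p with
  | Pc c => (Pc (Qnum c), Qden c)
  | Pinj j p => let (p, d) := pol_Z p in (Pinj j p, d)
  | PX p i q =>
      let (p, d) := pol_Z p in
      let (q, e) := pol_Z q in
      (PX (PmulC 0%Z 1%Z Z.mul Z.eqb p (Zpos e)) i (PmulC 0%Z 1%Z Z.mul Z.eqb q (Zpos d)), Pos.mul d e)
  end.

Fixpoint psatz_Z (l : list positive) (c : Psatz Q) : Psatz Z * positive :=
  match c with
  | PsatzC q => (PsatzC (Qnum q), Qden q)
  | PsatzIn _ n => (PsatzIn _ n, nth n l 1%positive)
  | PsatzZ _ => (PsatzZ _, 1%positive)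
  | PsatzSquare p => let (p, d) := pol_Z p in (PsatzSquare p, Pos.mul d d)
  | PsatzMulC p c =>
      let (p, d) := pol_Z p in
      let (c, e) := psatz_Z l c in (PsatzMulC p c, Pos.mul d e)
  | PsatzMulE b c =>
      let (b, d) := psatz_Z l b in
      let (c, e) := psatz_Z l c in (PsatzMulE b c, Pos.mul d e)
  | PsatzAdd b c =>
      let (b, d) := psatz_Z l b in
      let (c, e) := psatz_Z l c in
      (PsatzAdd (PsatzMulE (PsatzC (Zpos e)) b) (PsatzMulE (PsatzC (Zpos d)) c), Pos.mul d e)
  | PsatzLet b c =>
      let (b, d) := psatz_Z l b in
      let (c, e) := psatz_Z (d :: l) c in (PsatzLet b c, e)
  end.

Ltac m_index x env :=
  lazymatch env with
  | x :: _ => constr:(xH)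
  | _ :: ?env' => let n := m_index x env' in constr:(Pos.succ n)
  end.

Ltac m_atoms M t env :=
  lazymatch t with
  | mzero _ => env
  | mone _ => env
  | madd ?a ?b => let env := m_atoms M a env in m_atoms M b env
  | mmul ?a ?b => let env := m_atoms M a env in m_atoms M b env
  | ?x => match env with
          | context [cons x _] => env
          | _ => constr:(@cons M x env)
          end
  end.

Ltac m_reify t env :=
  lazymatch t with
  | mzero _ => constr:(MZero)
  | mone _ => constr:(MOne)
  | madd ?a ?b => let a := m_reify a env in let b := m_reify b env in constr:(MAdd a b)
  | mmul ?a ?b => let a := m_reify a env in let b := m_reify b env in constr:(MMul a b)
  | ?x => let n := m_index x env in let n := eval compute in n in constr:(MVar n)
  end.

Ltac m_goal_atoms M g env :=
  lazymatch g with
  | @mlt _ ?a ?b -> ?g => let env := m_atoms M a env in let env := m_atoms M b env in m_goal_atoms M g env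
  | ?a = ?b -> ?g => let env := m_atoms M a env in let env := m_atoms M b env in m_goal_atoms M g env
  | _ => env
  end.

Ltac m_goal_reify g env :=
  lazymatch g with
  | @mlt _ ?a ?b -> ?g => let a := m_reify a env in let b := m_reify b env in
      let g := m_goal_reify g env in constr:(MLt a b :: g)
  | ?a = ?b -> ?g => let a := m_reify a env in let b := m_reify b env in
      let g := m_goal_reify g env in constr:(MEq a b :: g)
  | _ => constr:(@nil matom)
  end.

Ltac m_solve M :=
  lazymatch goal with
  | |- ?g =>
    let env := m_goal_atoms M g (@nil M) in
    let hs := m_goal_reify g env in
    let ff := eval vm_compute in (refute_Q hs) in
    let w := fresh "w" in
    wlra_Q w ff;
    let w' := eval vm_compute in (map (fun c => fst (psatz_Z nil c)) w) in
    clear w;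
    refine (@refutes_sound _ env hs w' _); vm_compute; reflexivity
  end.

Ltac m_collect :=
  repeat match goal with
  | H : ~ ~ @mlt _ _ _ |- _ => apply NNPP in H
  | H : @mlt _ _ _ |- _ => revert H
  | H : @eq (num_of _) _ _ |- _ => revert H
  | H : ~ @mlt _ _ _ |- _ => apply mlt_nle in H
  end.

(** [mlra] proves linear goals over a model, with nonlinear monomials as atoms. *)
Ltac mlra_false := m_collect;
  match goal with
  | |- @mlt ?M _ _ -> _ => m_solve M
  | |- @eq (num_of ?M) _ _ -> _ => m_solve M
  end.

Lemma mlt_by_contra (M : rca) (x y : M) : (y <= x -> False)%m -> (x < y)%m.
Proof. by move=> H; apply: NNPP => /mlt_nle /H. Qed.

Lemma meq_by_contra (M : rca) (x y : M) :
  ((y < x -> False) -> (x < y -> False) -> x = y)%m.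
Proof. by case: (mlt_total x y) => [|[]] //; tauto. Qed.

Ltac mlra :=
  intros;
  lazymatch goal with
  | |- _ /\ _ => split; mlra
  | |- @mlt _ _ _ => apply: mlt_by_contra; move=> ?; mlra_false
  | |- @eq (num_of _) _ _ => apply: meq_by_contra; move=> ?; mlra_false
  | |- ~ _ => move=> ?; mlra_false
  | |- _ => exfalso; mlra_false
  end.

(** * Definable predicates *)

Section Formulas.
Context {M : rca}.
Local Open Scope m_scope.

Inductive pterm : Type :=
| PVar (n : nat)
| PConst (c : M)
| PAdd (t u : pterm)
| PMul (t u : pterm).

(* Bounded formulas whose parameters are elements of the model; the bound of a
   quantifier is evaluated outside of it. *)
Inductive pform : Type :=
| PEq (t u : pterm)
| PLt (t u : pterm)
| PMem (t : pterm) (X : set_of M)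
| PBot
| PImp (A B : pform)
| PAnd (A B : pform)
| POr (A B : pform)
| PAll (t : pterm) (A : pform)
| PEx (t : pterm) (A : pform).

Fixpoint peval (v : nat -> M) (t : pterm) : M :=
  match t with
  | PVar n => v n
  | PConst c => c
  | PAdd t u => peval v t + peval v u
  | PMul t u => peval v t * peval v u
  end.

Fixpoint psat (v : nat -> M) (A : pform) : Prop :=
  match A with
  | PEq t u => peval v t = peval v u
  | PLt t u => peval v t < peval v u
  | PMem t X => peval v t \in X
  | PBot => False
  | PImp A B => psat v A -> psat v B
  | PAnd A B => psat v A /\ psat v B
  | POr A B => psat v A \/ psat v B
  | PAll t A => forall x, x < peval v t -> psat (scons x v) A
  | PEx t A => exists x, x < peval v t /\ psat (scons x v) A
  end.

Fixpoint psets (al : set_of M -> Prop) (A : pform) : Prop :=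
  match A with
  | PMem _ X => al X
  | PImp A B | PAnd A B | POr A B => psets al A /\ psets al B
  | PAll _ A | PEx _ A => psets al A
  | _ => True
  end.

(** ** Eliminating the parameters *)

Fixpoint ptbound (t : pterm) : nat :=
  match t with
  | PVar n => S n
  | PConst _ => 0
  | PAdd t u | PMul t u => Nat.max (ptbound t) (ptbound u)
  end.

Fixpoint pbound (A : pform) : nat :=
  match A with
  | PEq t u | PLt t u => Nat.max (ptbound t) (ptbound u)
  | PMem t _ => ptbound t
  | PBot => 0
  | PImp A B | PAnd A B | POr A B => Nat.max (pbound A) (pbound B)
  | PAll t A | PEx t A => Nat.max (ptbound t) (Nat.pred (pbound A))
  end.

Fixpoint ptconsts (t : pterm) : list M :=
  match t with
  | PVar _ => []
  | PConst c => [c]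
  | PAdd t u | PMul t u => ptconsts t ++ ptconsts u
  end.

Fixpoint pconsts (A : pform) : list M :=
  match A with
  | PEq t u | PLt t u => ptconsts t ++ ptconsts u
  | PMem t _ => ptconsts t
  | PBot => []
  | PImp A B | PAnd A B | POr A B => pconsts A ++ pconsts B
  | PAll t A | PEx t A => ptconsts t ++ pconsts A
  end.

Fixpoint psetlist (A : pform) : list (set_of M) :=
  match A with
  | PMem _ X => [X]
  | PImp A B | PAnd A B | POr A B => psetlist A ++ psetlist B
  | PAll _ A | PEx _ A => psetlist A
  | _ => []
  end.

Section Translation.
Variables (idx : M -> nat) (sidx : set_of M -> nat) (par : nat -> M) (w : nat -> set_of M).

Fixpoint tr_term (k : nat) (t : pterm) : term :=
  match t with
  | PVar n => Var n
  | PConst c => Var (k + idx c)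
  | PAdd t u => Add (tr_term k t) (tr_term k u)
  | PMul t u => Mul (tr_term k t) (tr_term k u)
  end.

Fixpoint tr_form (k : nat) (A : pform) : form :=
  match A with
  | PEq t u => Eq (tr_term k t) (tr_term k u)
  | PLt t u => Lt (tr_term k t) (tr_term k u)
  | PMem t X => Mem (tr_term k t) (sidx X)
  | PBot => Bot
  | PImp A B => Imp (tr_form k A) (tr_form k B)
  | PAnd A B => And (tr_form k A) (tr_form k B)
  | POr A B => Or (tr_form k A) (tr_form k B)
  | PAll t A => All (Imp (Lt (Var 0) (tshift (tr_term k t))) (tr_form (S k) A))
  | PEx t A => Ex (And (Lt (Var 0) (tshift (tr_term k t))) (tr_form (S k) A))
  end.

(** Under [k] quantifiers the first [k] variables are those of [v]; the parameters are stored behind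
    them. *)
Fixpoint join (k : nat) (v : nat -> M) : nat -> M :=
  match k with 0%nat => par | S k => scons (v 0%nat) (join k (fun n => v (S n))) end.

Lemma join_lt k v n : (n < k)%nat -> join k v n = v n.
Proof. elim: k v n => [|k IH] v [|n] //= H; first lia; first lia. by rewrite IH //; lia. Qed.

Lemma join_ge k v n : join k v (k + n)%nat = par n.
Proof. by elim: k v => [|k IH] v //=. Qed.

Lemma tr_form_bounded k A : bounded (tr_form k A).
Proof. by elim: A k => /=; constructor. Qed.

Lemma teval_tshift (v : nat -> M) a t : teval (scons a v) (tshift t) = teval v t.
Proof. by rewrite /tshift; elim: t => //= t -> u ->. Qed.

Lemma tr_termP k v t : (ptbound t <= k)%nat -> Forall (fun c => par (idx c) = c) (ptconsts t) ->
  teval (join k v) (tr_term k t) = peval v t.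
Proof.
elim: t => [n|c|t It u Iu|t It u Iu] /= Hk.
- by rewrite join_lt //; lia.
- by move=> H; inversion H; rewrite join_ge.
- by move=> /Forall_app [Ht Hu]; rewrite It ?Iu //; lia.
- by move=> /Forall_app [Ht Hu]; rewrite It ?Iu //; lia.
Qed.

Lemma tr_formP k v A : (pbound A <= k)%nat -> Forall (fun c => par (idx c) = c) (pconsts A) ->
  Forall (fun X => w (sidx X) = X) (psetlist A) ->
  sat (M := M) (join k v) w (tr_form k A) <-> psat v A.
Proof.
elim: A k v => [t u|t u|t X||A IA B IB|A IA B IB|A IA B IB|t A IA|t A IA] k v;
  cbn [pbound pconsts psetlist sat tr_form psat].
- move=> Hk /Forall_app [H1 H2] _; rewrite !tr_termP //; lia.
- move=> Hk /Forall_app [H1 H2] _; rewrite !tr_termP //; lia.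
- by move=> Hk H1 H; inversion H as [|? ? E]; rewrite tr_termP // E.
- done.
- move=> Hk /Forall_app [H1 H2] /Forall_app [H3 H4]; rewrite IA ?IB //; lia.
- move=> Hk /Forall_app [H1 H2] /Forall_app [H3 H4]; rewrite IA ?IB //; lia.
- move=> Hk /Forall_app [H1 H2] /Forall_app [H3 H4]; rewrite IA ?IB //; lia.
- move=> Hk /Forall_app [H1 H2] H3.
  have K a := IA (S k) (scons a v) ltac:(lia) H2 H3.
  have E : teval (join k v) (tr_term k t) = peval v t by apply: tr_termP => //; lia.
  by split=> H a; have := H a; rewrite -K /= teval_tshift E.
- move=> Hk /Forall_app [H1 H2] H3.
  have K a := IA (S k) (scons a v) ltac:(lia) H2 H3.
  have E : teval (join k v) (tr_term k t) = peval v t by apply: tr_termP => //; lia.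
  by split=> -[a H]; exists a; move: H; rewrite -K /= teval_tshift E.
Qed.
End Translation.

Lemma list_index (T : Type) (d : T) (l : list T) :
  exists (idx : T -> nat) (par : nat -> T), Forall (fun c => par (idx c) = c) l.
Proof.
exists (fun c => epsilon (inhabits 0%nat) (fun n => nth n l d = c)), (fun n => nth n l d).
apply/Forall_forall => c Hc; have [n [_ Hn]] := In_nth l c d Hc.
by apply: (epsilon_spec (inhabits 0%nat) (fun n => nth n l d = c)); exists n.
Qed.

(** Both formulas are translated with one assignment, because comprehension takes its Sigma_1 and
    its Pi_1 definition under a common universal closure. *)
Lemma pform_form (A B : pform) (v : nat -> M) :
  exists A' B' v' w, bounded A' /\ bounded B' /\
   forall a b, (sat (M := M) (scons a (scons b v')) w A' <-> psat (scons a (scons b v)) A) /\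
               (sat (M := M) (scons a (scons b v')) w B' <-> psat (scons a (scons b v)) B).
Proof.
have [idx [par Hpar]] := list_index (0 : M) (pconsts A ++ pconsts B).
have [sidx [w Hw]] := list_index (rca_set M) (psetlist A ++ psetlist B).
set k := Nat.max (pbound A) (pbound B).
exists (tr_form idx sidx (S (S k)) A), (tr_form idx sidx (S (S k)) B), (join par k v), w.
move: Hpar Hw => /Forall_app [H1 H2] /Forall_app [H3 H4].
split; [exact: tr_form_bounded|split; first exact: tr_form_bounded].
by move=> a b; split; apply: (@tr_formP _ _ _ _ (S (S k)) (scons a (scons b v))) => //; lia.
Qed.

(** ** Induction and comprehension *)

Lemma teval_tsubst (v : nat -> M) s t : teval v (tsubst s t) = teval (fun x => teval v (s x)) t.
Proof. by elim: t => //= t -> u ->. Qed.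

Lemma sat_subst (v : nat -> M) w s A :
  sat v w (subst s A) <-> sat (fun x => teval v (s x)) w A.
Proof.
have K s' (v' : nat -> M) a : (fun x => teval (scons a v') (scons (Var 0) (fun x => tshift (s' x)) x))
   = scons a (fun x => teval v' (s' x)).
  by apply: functional_extensionality => -[|x] //=; rewrite teval_tshift.
elim: A v w s => [t u|t u|t X||A IA B IB|A IA B IB|A IA B IB|A IA|A IA|A IA|A IA] v w s;
  cbn [sat subst]; rewrite ?teval_tsubst ?IA ?IB //.
- by split=> H a; have := H a; rewrite IA K.
- by split=> -[a H]; exists a; move: H; rewrite IA K.
- by split=> H a; have := H a; rewrite IA.
- by split=> -[a H]; exists a; move: H; rewrite IA.
Qed.

Lemma sat_ssubst (v : nat -> M) w r A :
  sat v w (ssubst r A) <-> sat v (fun X => w (r X)) A.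
Proof.
have K r' (w' : nat -> set_of M) X : (fun x => scons X w' (scons 0%nat (fun x => S (r' x)) x))
   = scons X (fun x => w' (r' x)).
  by apply: functional_extensionality => -[|x].
elim: A v w r => [t u|t u|t X||A IA B IB|A IA B IB|A IA B IB|A IA|A IA|A IA|A IA] v w r;
  cbn [sat ssubst]; rewrite ?IA ?IB //.
- by split=> H a; have := H a; rewrite IA.
- by split=> -[a H]; exists a; move: H; rewrite IA.
- by split=> H a; have := H a; rewrite IA K.
- by split=> -[a H]; exists a; move: H; rewrite IA K.
Qed.

Lemma psat_induction (A : pform) (v : nat -> M) :
  let P n := exists a, psat (scons a (scons n v)) A in
  P 0 -> (forall n, P n -> P (n + 1)) -> forall n, P n.
Proof.
move=> P P0 PS.
have [A' [B' [v' [w [HA [_ H]]]]]] := pform_form A A v.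
have K n : P n <-> sat (M := M) (scons n v') w (Ex A').
  rewrite /P /=; split=> -[a Ha]; exists a; have [E _] := H a n; tauto.
have HS : Sigma01 (Ex A') by exists A'.
have /= J := sat_univ_closure (fun v w => @rca_sat M _ v w (@RCA0_induction _ HS)) v' w.
move=> n; apply/K; apply: J; split.
- apply/(sat_subst v' w (scons Zero Var) (Ex A')).
  have -> : (fun x => teval v' (scons Zero Var x)) = scons 0 v' by apply: functional_extensionality => -[].
  exact/K.
- move=> m Hm; apply/(sat_subst _ w _ (Ex A')).
  have -> : (fun x => teval (scons m v') (scons (Add (Var 0) One) (fun x => Var (S x)) x)) = scons (m + 1) v'
    by apply: functional_extensionality => -[].
  by apply/K/PS/K.
Qed.

Lemma psat_comprehension (A B : pform) (v : nat -> M) :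
  (forall n, (exists a, psat (scons a (scons n v)) A) <-> ~ exists a, psat (scons a (scons n v)) B) ->
  exists X : set_of M, forall n, n \in X <-> exists a, psat (scons a (scons n v)) A.
Proof.
move=> HAB.
have [A' [B' [v' [w [HA [HB H]]]]]] := pform_form A B v.
have HS : Sigma01 (Ex A') by exists A'.
have HP : Pi01 (All (Imp B' Bot)) by exists (Imp B' Bot); split=> //; constructor=> //; constructor.
have /= J := sat_univ_closure (fun v w => @rca_sat M _ v w (@RCA0_comprehension _ _ HS HP)) v' w.
have K n : (exists a, psat (scons a (scons n v)) A) <-> exists a, sat (M := M) (scons a (scons n v')) w A'.
  split=> -[a Ha]; exists a; have [E _] := H a n; tauto.
case: J => [n|X HX]; last first.
  exists X => n; rewrite K; have := HX n; rewrite /= /sshift => -[H1 H2]; split=> [/H1|].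
  - by move=> -[a Ha]; exists a; apply/(sat_ssubst _ (scons X w) S).
  - by move=> -[a Ha]; apply: H2; exists a; apply/(sat_ssubst _ (scons X w) S).
rewrite -K HAB; split=> [N a Ha|N [a Ha]].
- by apply: N; exists a; apply/(proj2 (H a n)).
- by apply: (N a); apply/(proj2 (H a n)).
Qed.
End Formulas.
Arguments pterm M : clear implicits.
Arguments pform M : clear implicits.

(** ** Sigma_1, Pi_1 and Delta_1 predicates of an environment *)

(* [al] restricts the set parameters. *)
Section Classes.
Context {M : rca} (al : set_of M -> Prop).
Local Open Scope m_scope.
Implicit Types P Q : (nat -> M) -> Prop.
Implicit Types f g : (nat -> M) -> M.

(** Definability is semantic: a predicate of environments is in a class if some formula has its
    truth values. Number parameters are free and set parameters limited by [al]. Two instances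
    matter: [allsets] for induction and comprehension, [eq Z] for computability from [Z]. *)
Definition D0 P : Prop := exists A, psets al A /\ forall v, psat v A <-> P v.
Definition Sg P : Prop := exists A, psets al A /\ forall v, (exists a, psat (scons a v) A) <-> P v.
Definition Pi P : Prop := Sg (fun v => ~ P v).
Definition Df f : Prop := Sg (fun v => v 0%nat = f (fun n => v (S n))).

Fixpoint ptren (r : nat -> nat) (t : pterm M) : pterm M :=
  match t with
  | PVar n => PVar (r n)
  | PConst c => PConst c
  | PAdd t u => PAdd (ptren r t) (ptren r u)
  | PMul t u => PMul (ptren r t) (ptren r u)
  end.

Definition pup (s : nat -> pterm M) : nat -> pterm M := scons (PVar 0) (fun n => ptren S (s n)).

Fixpoint ptsubst (s : nat -> pterm M) (t : pterm M) : pterm M :=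
  match t with
  | PVar n => s n
  | PConst c => PConst c
  | PAdd t u => PAdd (ptsubst s t) (ptsubst s u)
  | PMul t u => PMul (ptsubst s t) (ptsubst s u)
  end.

Fixpoint psubst (s : nat -> pterm M) (A : pform M) : pform M :=
  match A with
  | PEq t u => PEq (ptsubst s t) (ptsubst s u)
  | PLt t u => PLt (ptsubst s t) (ptsubst s u)
  | PMem t X => PMem (ptsubst s t) X
  | PBot => PBot (M := M)
  | PImp A B => PImp (psubst s A) (psubst s B)
  | PAnd A B => PAnd (psubst s A) (psubst s B)
  | POr A B => POr (psubst s A) (psubst s B)
  | PAll t A => PAll (ptsubst s t) (psubst (pup s) A)
  | PEx t A => PEx (ptsubst s t) (psubst (pup s) A)
  end.

Lemma peval_ren r (v : nat -> M) t : peval v (ptren r t) = peval (fun n => v (r n)) t.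
Proof. by elim: t => //= t -> u ->. Qed.

Lemma peval_subst s (v : nat -> M) t : peval v (ptsubst s t) = peval (fun n => peval v (s n)) t.
Proof. by elim: t => //= t -> u ->. Qed.

Lemma peval_pup s (v : nat -> M) x :
  (fun n => peval (scons x v) (pup s n)) = scons x (fun n => peval v (s n)).
Proof. by apply: functional_extensionality => -[|n] //=; rewrite peval_ren. Qed.

Lemma psat_subst s (v : nat -> M) A : psat v (psubst s A) <-> psat (fun n => peval v (s n)) A.
Proof.
elim: A s v => [t u|t u|t X||A IA B IB|A IA B IB|A IA B IB|t A IA|t A IA] s v /=;
  rewrite ?peval_subst ?IA ?IB //.
- by split=> H x; have := H x; rewrite IA peval_pup.
- by split=> -[x [H1 H2]]; exists x; split=> //; move: H2; rewrite IA peval_pup.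
Qed.

Lemma psets_subst s A : psets al A -> psets al (psubst s A).
Proof. by elim: A s => //= [A IA B IB|A IA B IB|A IA B IB|t A IA|t A IA] s; intuition. Qed.

Lemma D0_subst P (s : nat -> pterm M) : D0 P -> D0 (fun v => P (fun n => peval v (s n))).
Proof.
move=> [A [HA H]]; exists (psubst s A); split; first exact: psets_subst.
by move=> v; rewrite psat_subst.
Qed.

Lemma D0_ren P r : D0 P -> D0 (fun v => P (fun n => v (r n))).
Proof. exact: (@D0_subst P (fun n => PVar (r n))). Qed.

Lemma D0_ext P Q : (forall v, P v <-> Q v) -> D0 P -> D0 Q.
Proof. by move=> E [A [HA H]]; exists A; split=> // v; rewrite H. Qed.

Lemma Sg_ext P Q : (forall v, P v <-> Q v) -> Sg P -> Sg Q.
Proof. by move=> E [A [HA H]]; exists A; split=> // v; rewrite H. Qed.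

Lemma Sg_iff_D0 P : Sg P <-> exists Q, D0 Q /\ forall v, (exists a, Q (scons a v)) <-> P v.
Proof.
split=> [[A [HA H]]|[Q [[A [HA H]] H']]].
- by exists (fun v => psat v A); split=> //; exists A.
- by exists A; split=> // v; rewrite -H'; split=> -[a Ha]; exists a; apply/H.
Qed.

Lemma D0_and P Q : D0 P -> D0 Q -> D0 (fun v => P v /\ Q v).
Proof. by move=> [A [HA H]] [B [HB H']]; exists (PAnd A B); split=> //= v; rewrite H H'. Qed.
Lemma D0_or P Q : D0 P -> D0 Q -> D0 (fun v => P v \/ Q v).
Proof. by move=> [A [HA H]] [B [HB H']]; exists (POr A B); split=> //= v; rewrite H H'. Qed.
Lemma D0_imp P Q : D0 P -> D0 Q -> D0 (fun v => P v -> Q v).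
Proof. by move=> [A [HA H]] [B [HB H']]; exists (PImp A B); split=> //= v; rewrite H H'. Qed.
Lemma D0_not P : D0 P -> D0 (fun v => ~ P v).
Proof. by move=> [A [HA H]]; exists (PImp A (PBot (M := M))); split=> //= v; rewrite H. Qed.
Lemma D0_ball (P : (nat -> M) -> M -> Prop) t :
  D0 (fun v => P (fun n => v (S n)) (v 0%nat)) -> D0 (fun v => forall x, x < peval v t -> P v x).
Proof.
move=> [A [HA H]]; exists (PAll t A); split=> //= v.
by split=> K x Hx; have := H (scons x v); have := K x Hx; cbn; tauto.
Qed.
Lemma D0_bex (P : (nat -> M) -> M -> Prop) t :
  D0 (fun v => P (fun n => v (S n)) (v 0%nat)) -> D0 (fun v => exists x, x < peval v t /\ P v x).
Proof.
move=> [A [HA H]]; exists (PEx t A); split=> //= v.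
by split=> -[x [Hx K]]; exists x; have := H (scons x v); cbn; tauto.
Qed.

Lemma Sg_D0 P : D0 P -> Sg P.
Proof.
move=> H; apply/Sg_iff_D0; exists (fun v => P (fun n => v (S n))); split; first exact: D0_ren.
by move=> v; split=> [[_]|] //; exists 0.
Qed.

Lemma Sg_subst P (s : nat -> pterm M) : Sg P -> Sg (fun v => P (fun n => peval v (s n))).
Proof.
move=> /Sg_iff_D0 [Q [HQ E]]; apply/Sg_iff_D0.
exists (fun v => Q (fun n => peval v (pup s n))); split; first exact: D0_subst.
move=> v; rewrite -E; split=> -[a Ha]; exists a; move: Ha.
- by have -> : (fun n => peval (scons a v) (pup s n)) = scons a (fun n => peval v (s n)) by exact: peval_pup.
- by have -> : (fun n => peval (scons a v) (pup s n)) = scons a (fun n => peval v (s n)) by exact: peval_pup.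
Qed.

Lemma Sg_ren P r : Sg P -> Sg (fun v => P (fun n => v (r n))).
Proof. exact: (@Sg_subst P (fun n => PVar (r n))). Qed.

Lemma Sg_or P Q : Sg P -> Sg Q -> Sg (fun v => P v \/ Q v).
Proof.
move=> /Sg_iff_D0 [P' [HP E]] /Sg_iff_D0 [Q' [HQ E']]; apply/Sg_iff_D0.
exists (fun v => P' v \/ Q' v); split; first exact: D0_or.
by move=> v; rewrite -E -E'; split=> [[a [H|H]]|[[a H]|[a H]]]; [left|right| |]; exists a; auto.
Qed.

(** Two unbounded quantifiers are merged into a common bound for both witnesses, which avoids
    pairing. *)
Lemma Sg_ex (P : (nat -> M) -> M -> Prop) :
  Sg (fun v => P (fun n => v (S n)) (v 0%nat)) -> Sg (fun v => exists x, P v x).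
Proof.
move=> /Sg_iff_D0 [Q [HQ E]]; apply/Sg_iff_D0.
(* Below the two bounded quantifiers the environment starts with the two witnesses and their common
   bound; [r] skips the bound. *)
pose r n := match n with 0%nat => 0%nat | 1%nat => 1%nat | S n => S (S n) end.
exists (fun v => exists x, x < peval v (PAdd (PVar 0) (PConst 1)) /\
   exists a, a < peval v (PAdd (PVar 0) (PConst 1)) /\ Q (scons a (scons x (fun n => v (S n))))).
split.
  apply: D0_bex; apply: (D0_bex (PAdd (PVar 1) (PConst 1))); apply: D0_ext (D0_ren r HQ) => v.
  by have -> : (fun n => v (r n)) = scons (v 0%nat) (scons (v 1%nat) (fun n => v (S (S (S n)))))
    by apply: functional_extensionality => -[|[|n]].
have E' v x : P v x <-> exists a, Q (scons a (scons x v)).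
  by rewrite E.
move=> v; split=> [[c [x [_ [a [_]]]]]|[x /E' [a Ha]]].
- by move=> H; exists x; apply/E'; exists a.
- exists (x + a), x; split=> /=; first mlra.
  by exists a; split; first mlra.
Qed.

Lemma Sg_and P Q : Sg P -> Sg Q -> Sg (fun v => P v /\ Q v).
Proof.
move=> /Sg_iff_D0 [P' [HP E]] /Sg_iff_D0 [Q' [HQ E']].
apply: (Sg_ext (P := fun v => exists x, exists y, P' (scons x v) /\ Q' (scons y v))).
  by move=> v; rewrite -E -E'; split=> [[x [y []]]|[[x Hx] [y Hy]]]; [split|exists x, y]; eauto.
apply: Sg_ex; apply: Sg_ex; apply: Sg_D0; apply: D0_and.
- apply: D0_ext (D0_ren (fun n => match n with 0 => 1 | S n => S (S n) end)%nat HP) => v.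
  by have -> : (fun n => v (match n with 0 => 1 | S n => S (S n) end)%nat) =
    scons (v 1%nat) (fun n => v (S (S n))) by apply: functional_extensionality => -[].
- apply: D0_ext (D0_ren (fun n => match n with 0 => 0 | S n => S (S n) end)%nat HQ) => v.
  by have -> : (fun n => v (match n with 0 => 0 | S n => S (S n) end)%nat) =
    scons (v 0%nat) (fun n => v (S (S n))) by apply: functional_extensionality => -[].
Qed.
End Classes.

Definition allsets {M : rca} : set_of M -> Prop := fun _ => True.

(** * Induction and comprehension for definable predicates *)

Section Induction.
Context {M : rca}.
Local Open Scope m_scope.

Lemma Sg_mono (al al' : set_of M -> Prop) P : (forall X, al X -> al' X) -> Sg al P -> Sg al' P.
Proof.
move=> H [A [HA E]]; exists A; split=> // {E}.
by elim: A HA => //= [A IA B IB|A IA B IB|A IA B IB]; intuition.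
Qed.

Lemma m_ind (P : M -> Prop) : Sg allsets (fun v => P (v 0%nat)) ->
  P 0 -> (forall n, P n -> P (n + 1)) -> forall n, P n.
Proof.
move=> [A [_ H]] P0 PS.
have K n : (exists a, psat (scons a (scons n (fun _ => 0))) A) <-> P n by rewrite H.
move=> m; apply/K; move: m; apply: psat_induction; first exact/K.
by move=> n /K /PS /K.
Qed.

Lemma m_comprehension (P : M -> Prop) :
  Sg allsets (fun v => P (v 0%nat)) -> Pi allsets (fun v => P (v 0%nat)) ->
  exists X : set_of M, forall n, n \in X <-> P n.
Proof.
move=> [A [_ HA]] [B [_ HB]].
have [n|X HX] := @psat_comprehension M A B (fun _ => 0).
  by rewrite HA HB; split; [tauto|apply: NNPP].
by exists X => n; rewrite HX HA.
Qed.
End Induction.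

(** * Closure properties of the classes *)

Section Closure.
Context {M : rca} {al : set_of M -> Prop}.
Local Open Scope m_scope.
Implicit Types P Q : (nat -> M) -> Prop.
Implicit Types f g : (nat -> M) -> M.

Lemma Sg_all_sets P : Sg al P -> Sg allsets P.
Proof. exact: Sg_mono. Qed.

Lemma Pi_D0 P : D0 al P -> Pi al P.
Proof. by move=> H; apply: Sg_D0; apply: D0_not. Qed.

(** Case distinction suffices, because only dependence on the environment has to be expressed by a
    formula. *)
Lemma Sg_const (P : Prop) : Sg al (fun _ => P).
Proof.
apply: Sg_D0; case: (classic P) => H.
- by exists (PEq (PConst 0) (PConst 0)); split=> //= v; tauto.
- by exists (PBot (M := M)); split=> //= v; tauto.
Qed.

Lemma Sg_var_eq i j : Sg al (fun v => v i = v j).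
Proof. by apply: Sg_D0; exists (PEq (PVar i) (PVar j)). Qed.
Lemma Sg_var_lt i j : Sg al (fun v => v i < v j).
Proof. by apply: Sg_D0; exists (PLt (PVar i) (PVar j)). Qed.

Lemma Df_lift f : Df al f -> Df al (fun v => f (fun n => v (S n))).
Proof.
move=> H.
exact: Sg_ext (Sg_ren (fun n => match n with 0 => 0 | S n => S (S n) end)%nat H).
Qed.

Lemma Df_ren f (r : nat -> nat) : Df al f -> Df al (fun v => f (fun n => v (r n))).
Proof. exact: (Sg_ren (fun n => match n with 0 => 0 | S n => S (r n) end)%nat). Qed.

Lemma Df_var i : Df al (fun v => v i).
Proof. exact: Sg_var_eq. Qed.
Lemma Df_const c : Df al (fun _ => c).
Proof. by apply: Sg_D0; exists (PEq (PVar 0) (PConst c)). Qed.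

(** The value of [f] is quantified existentially. Applied to [~ P], the same argument substitutes a
    function with Sigma_1 graph into a Pi_1 predicate. *)
Lemma Sg_sub1 (P : M -> Prop) f :
  Sg al (fun v => P (v 0%nat)) -> Df al f -> Sg al (fun v => P (f v)).
Proof.
move=> HP Hf; apply: (Sg_ext (P := fun v => exists x, x = f v /\ P x)).
  by move=> v; split=> [[x [-> //]]|H]; exists (f v).
by apply: Sg_ex; apply: Sg_and.
Qed.

Lemma Sg_sub2 (P : M -> M -> Prop) f g :
  Sg al (fun v => P (v 0%nat) (v 1%nat)) -> Df al f -> Df al g -> Sg al (fun v => P (f v) (g v)).
Proof.
move=> HP Hf Hg; apply: (Sg_ext (P := fun v => exists x, x = f v /\ exists y, y = g v /\ P x y)).
  by move=> v; split=> [[x [-> [y [->]]]] //|H]; exists (f v); split=> //; exists (g v).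
apply: Sg_ex; apply: Sg_and => //; apply: Sg_ex; apply: Sg_and; first exact: Df_lift.
exact: Sg_ext (Sg_ren (fun n => match n with 0 => 1 | _ => 0 end)%nat HP).
Qed.

Lemma Sg_sub3 (P : M -> M -> M -> Prop) f g h :
  Sg al (fun v => P (v 0%nat) (v 1%nat) (v 2%nat)) -> Df al f -> Df al g -> Df al h ->
  Sg al (fun v => P (f v) (g v) (h v)).
Proof.
move=> HP Hf Hg Hh; apply: (Sg_ext (P := fun v => exists x, x = f v /\ exists y, y = g v /\ P x y (h v))).
  by move=> v; split=> [[x [-> [y [->]]]] //|H]; exists (f v); split=> //; exists (g v).
apply: Sg_ex; apply: Sg_and => //; apply: Sg_ex; apply: Sg_and; first exact: Df_lift.
apply: (Sg_ext (P := fun v => exists z, z = h (fun n => v (S (S n))) /\ P (v 1%nat) (v 0%nat) z)).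
  by move=> v; split=> [[z [-> //]]|H]; eexists.
apply: Sg_ex; apply: Sg_and; first exact: (Df_lift (Df_lift Hh)).
exact: Sg_ext (Sg_ren (fun n => match n with 0 => 2 | 1 => 1 | _ => 0 end)%nat HP).
Qed.

Lemma Sg_eq f g : Df al f -> Df al g -> Sg al (fun v => f v = g v).
Proof. exact: (Sg_sub2 (P := fun x y => x = y)) (Sg_var_eq 0 1). Qed.
Lemma Sg_lt f g : Df al f -> Df al g -> Sg al (fun v => f v < g v).
Proof. exact: (Sg_sub2 (P := fun x y => x < y)) (Sg_var_lt 0 1). Qed.

Lemma Df_add f g : Df al f -> Df al g -> Df al (fun v => f v + g v).
Proof.
move=> Hf Hg; apply: (Sg_sub3 (P := fun z x y => z = x + y)); [|exact: Df_var|exact: Df_lift|exact: Df_lift].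
by apply: Sg_D0; exists (PEq (PVar 0) (PAdd (PVar 1) (PVar 2))).
Qed.
Lemma Df_mul f g : Df al f -> Df al g -> Df al (fun v => f v * g v).
Proof.
move=> Hf Hg; apply: (Sg_sub3 (P := fun z x y => z = x * y)); [|exact: Df_var|exact: Df_lift|exact: Df_lift].
by apply: Sg_D0; exists (PEq (PVar 0) (PMul (PVar 1) (PVar 2))).
Qed.

Lemma Pi_eq f g : Df al f -> Df al g -> Pi al (fun v => f v = g v).
Proof.
move=> Hf Hg; apply: (Sg_ext (P := fun v => f v < g v \/ g v < f v)).
  by move=> v; split=> [[] H E|]; [rewrite E in H; move/mlt_irr: H|rewrite E in H; move/mlt_irr: H|case: (mlt_total (f v) (g v)); tauto].
by apply: Sg_or; apply: Sg_lt.
Qed.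
Lemma Pi_lt f g : Df al f -> Df al g -> Pi al (fun v => f v < g v).
Proof.
move=> Hf Hg; apply: (Sg_ext (P := fun v => g v < f v + 1)); first by move=> v; rewrite mlt_nle.
by apply: Sg_lt => //; apply: Df_add => //; apply: Df_const.
Qed.
Lemma Sg_mem X f : al X -> Df al f -> Sg al (fun v => f v \in X).
Proof.
by move=> HX; apply: (Sg_sub1 (P := fun x => x \in X)); apply: Sg_D0; exists (PMem (PVar 0) X).
Qed.
Lemma Pi_mem X f : al X -> Df al f -> Pi al (fun v => f v \in X).
Proof.
by move=> HX; apply: (Sg_sub1 (P := fun x => ~ x \in X)); apply: Sg_D0; apply: D0_not; exists (PMem (PVar 0) X).
Qed.

Lemma Pi_and P Q : Pi al P -> Pi al Q -> Pi al (fun v => P v /\ Q v).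
Proof. by move=> HP HQ; apply: Sg_ext (Sg_or HP HQ) => v; tauto. Qed.
Lemma Pi_or P Q : Pi al P -> Pi al Q -> Pi al (fun v => P v \/ Q v).
Proof. by move=> HP HQ; apply: Sg_ext (Sg_and HP HQ) => v; tauto. Qed.
Lemma Sg_imp P Q : Pi al P -> Sg al Q -> Sg al (fun v => P v -> Q v).
Proof. by move=> HP HQ; apply: Sg_ext (Sg_or HP HQ) => v; tauto. Qed.
Lemma Pi_imp P Q : Sg al P -> Pi al Q -> Pi al (fun v => P v -> Q v).
Proof. by move=> HP HQ; apply: Sg_ext (Sg_and HP HQ) => v; tauto. Qed.
Lemma Sg_not P : Pi al P -> Sg al (fun v => ~ P v).
Proof. by []. Qed.
Lemma Pi_not P : Sg al P -> Pi al (fun v => ~ P v).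
Proof. by move=> HP; apply: Sg_ext HP => v; tauto. Qed.
Lemma Pi_const (P : Prop) : Pi al (fun _ => P).
Proof. exact: Sg_const. Qed.
Lemma Pi_all (P : (nat -> M) -> M -> Prop) :
  Pi al (fun v => P (fun n => v (S n)) (v 0%nat)) -> Pi al (fun v => forall x, P v x).
Proof.
move=> H; apply: (Sg_ext (P := fun v => exists x, ~ P v x)).
  by move=> v; split=> [[x Hx] K|/not_all_ex_not //]; apply: Hx.
exact: Sg_ex.
Qed.

End Closure.

(** * Collection for bounded formulas *)

Section Collection.
Context {M : rca}.
Local Open Scope m_scope.

Lemma m_ind_env (P : (nat -> M) -> Prop) (al : set_of M -> Prop) v : Sg al P ->
  P (scons 0 v) -> (forall n, P (scons n v) -> P (scons (n + 1) v)) -> forall n, P (scons n v).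
Proof.
move=> [A [_ H]] P0 PS n; apply/H; move: n; apply: psat_induction; first exact/H.
by move=> n /H /PS /H.
Qed.

(** Induction on an auxiliary [m] bounding [x], with the premise [x < n] moved inside. The induction
    statement is one existential quantifier before a bounded formula; only once this case is known
    does [Sg_ball] become available. *)
Lemma collection_D0 (al : set_of M -> Prop) (Q : (nat -> M) -> Prop) v n : D0 al Q ->
  (forall x, x < n -> exists y, Q (scons y (scons x v))) ->
  exists b, forall x, x < n -> exists y, y < b /\ Q (scons y (scons x v)).
Proof.
move=> HQ H.
pose P (e : nat -> M) := exists b, forall x, x < e 0%nat -> exists y, y < b /\
  (x < e 1%nat -> Q (scons y (scons x (fun n => e (S (S n)))))).
suff : forall m, P (scons m (scons n v)).
  by move/(_ n) => [b Hb]; exists b => x Hx; have [y [Hy K]] := Hb x Hx; exists y; auto.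
apply: (m_ind_env (al := al)).
- apply: Sg_ex; apply: Sg_D0.
  apply: (D0_ball (P := fun e x => exists y, y < e 0%nat /\
    (x < e 2%nat -> Q (scons y (scons x (fun n => e (S (S (S n)))))))) (PVar 1)).
  apply: (D0_bex (P := fun e y => e 0%nat < e 3%nat -> Q (scons y (scons (e 0%nat) (fun n => e (S (S (S (S n)))))))) (PVar 1)).
  apply: D0_imp; first by exists (PLt (PVar 1) (PVar 4)).
  apply: D0_ext (D0_ren (fun n => match n with 0 => 0 | 1 => 1 | S (S n) => S (S (S (S (S n)))) end)%nat HQ) => e.
  by have -> : (fun n => e (match n with 0 => 0 | 1 => 1 | S (S n) => S (S (S (S (S n)))) end)%nat) =
    scons (e 0%nat) (scons (e 1%nat) (fun n => e (S (S (S (S (S n))))))) by apply: functional_extensionality => -[|[|]].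
- by exists 0 => x Hx; cbn in Hx; mlra.
- move=> m [b /= Hb].
  have [y Hy] : exists y, m < n -> Q (scons y (scons m v)).
    by case: (classic (m < n)) => [/H [y Hy]|K]; [exists y|exists 0].
  exists (b + y + 1) => x /= /mle_lteq [Hx|E].
    have {}Hx : x < m by mlra.
    have [y' [H1 H2]] := Hb x Hx; exists y'; split=> //; mlra.
  have -> : x = m by mlra.
  by exists y; split=> //; mlra.
Qed.
End Collection.

Section Bounded.
Context {M : rca} {al : set_of M -> Prop}.
Local Open Scope m_scope.
Implicit Types P Q : (nat -> M) -> Prop.
Implicit Types f g : (nat -> M) -> M.

(** Collection bounds the Sigma_1 witnesses for all [x < f v] at once, so the unbounded quantifier
    can move outside. *)
Lemma Sg_ball (P : (nat -> M) -> M -> Prop) f : Df al f ->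
  Sg al (fun v => P (fun n => v (S n)) (v 0%nat)) -> Sg al (fun v => forall x, x < f v -> P v x).
Proof.
move=> Hf /Sg_iff_D0 [Q [HQ E]].
have {}E v x : P v x <-> exists a, Q (scons a (scons x v)) by rewrite E.
apply: (Sg_ext (P := fun v => exists n, n = f v /\ exists b, forall x, x < n -> exists y, y < b /\ Q (scons y (scons x v)))).
  move=> v; split=> [[n [-> [b Hb]]] x Hx|H].
    by have [y [_ Hy]] := Hb x Hx; apply/E; exists y.
  by exists (f v); split=> //; apply: collection_D0 HQ _ => x /H /E.
apply: Sg_ex; apply: Sg_and => //; apply: Sg_ex; apply: Sg_D0.
apply: (D0_ball (P := fun e x => exists y, y < e 0%nat /\ Q (scons y (scons x (fun n => e (S (S n)))))) (PVar 1)).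
apply: (D0_bex (P := fun e y => Q (scons y (scons (e 0%nat) (fun n => e (S (S (S n))))))) (PVar 1)).
apply: D0_ext (D0_ren (fun n => match n with 0 => 0 | 1 => 1 | S (S n) => S (S (S (S n))) end)%nat HQ) => e.
by have -> : (fun n => e (match n with 0 => 0 | 1 => 1 | S (S n) => S (S (S (S n))) end)%nat) =
  scons (e 0%nat) (scons (e 1%nat) (fun n => e (S (S (S (S n)))))) by apply: functional_extensionality => -[|[|]].
Qed.

Lemma Pi_ball (P : (nat -> M) -> M -> Prop) f : Df al f ->
  Pi al (fun v => P (fun n => v (S n)) (v 0%nat)) -> Pi al (fun v => forall x, x < f v -> P v x).
Proof.
move=> Hf HP; apply: (Sg_ext (P := fun v => exists x, x < f v /\ ~ P v x)).
  move=> v; split=> [[x [Hx H]] K|H]; first by apply: H; apply: K.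
  by apply: NNPP => N; apply: H => x Hx; apply: NNPP => H; apply: N; exists x.
by apply: Sg_ex; apply: Sg_and => //; apply: Sg_lt; [exact: Df_var|exact: Df_lift].
Qed.

Lemma Pi_bex (P : (nat -> M) -> M -> Prop) f : Df al f ->
  Pi al (fun v => P (fun n => v (S n)) (v 0%nat)) -> Pi al (fun v => exists x, x < f v /\ P v x).
Proof.
move=> Hf HP; apply: (Sg_ext (P := fun v => forall x, x < f v -> ~ P v x)).
  by move=> v; split=> [H [x [Hx K]]|H x Hx K]; [exact: H K|apply: H; exists x].
exact: Sg_ball.
Qed.
End Bounded.

(** Definability of a named notion is stated for arbitrary definable arguments, so that [defn] can
    apply it under any substitution. *)
Notation Sg1 al P := (forall f, Df al f -> Sg al (fun v => P (f v))).
Notation Pi1 al P := (forall f, Df al f -> Pi al (fun v => P (f v))).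
Notation Sg2 al P := (forall f g, Df al f -> Df al g -> Sg al (fun v => P (f v) (g v))).
Notation Pi2 al P := (forall f g, Df al f -> Df al g -> Pi al (fun v => P (f v) (g v))).
Notation Sg3 al P := (forall f g h, Df al f -> Df al g -> Df al h -> Sg al (fun v => P (f v) (g v) (h v))).
Notation Pi3 al P := (forall f g h, Df al f -> Df al g -> Df al h -> Pi al (fun v => P (f v) (g v) (h v))).
Notation Sg4 al P := (forall f g h k, Df al f -> Df al g -> Df al h -> Df al k ->
  Sg al (fun v => P (f v) (g v) (h v) (k v))).
Notation Pi4 al P := (forall f g h k, Df al f -> Df al g -> Df al h -> Df al k ->
  Pi al (fun v => P (f v) (g v) (h v) (k v))).
Notation Df1 al F := (forall f, Df al f -> Df al (fun v => F (f v))).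
Notation Df2 al F := (forall f g, Df al f -> Df al g -> Df al (fun v => F (f v) (g v))).
Notation Df3 al F := (forall f g h, Df al f -> Df al g -> Df al h -> Df al (fun v => F (f v) (g v) (h v))).

Section Intro.
Context {M : rca} {al : set_of M -> Prop}.
Local Open Scope m_scope.

Lemma Sg1I (P : M -> Prop) : Sg al (fun v => P (v 0%nat)) -> Sg1 al P.
Proof. by move=> H f; apply: Sg_sub1. Qed.
Lemma Sg2I (P : M -> M -> Prop) : Sg al (fun v => P (v 0%nat) (v 1%nat)) -> Sg2 al P.
Proof. by move=> H f g; apply: Sg_sub2. Qed.
Lemma Pi2I (P : M -> M -> Prop) : Pi al (fun v => P (v 0%nat) (v 1%nat)) -> Pi2 al P.
Proof. by move=> H f g; apply: (Sg_sub2 (P := fun x y => ~ P x y)). Qed.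
Lemma Sg3I (P : M -> M -> M -> Prop) : Sg al (fun v => P (v 0%nat) (v 1%nat) (v 2%nat)) -> Sg3 al P.
Proof. by move=> H f g h; apply: Sg_sub3. Qed.
Lemma Pi3I (P : M -> M -> M -> Prop) : Pi al (fun v => P (v 0%nat) (v 1%nat) (v 2%nat)) -> Pi3 al P.
Proof. by move=> H f g h; apply: (Sg_sub3 (P := fun x y z => ~ P x y z)). Qed.
Lemma Df1I (F : M -> M) : Sg al (fun v => v 0%nat = F (v 1%nat)) -> Df1 al F.
Proof.
move=> H f Hf; apply: (Sg_sub2 (P := fun y x => y = F x)) => //; [exact: Df_var|exact: Df_lift].
Qed.
Lemma Df2I (F : M -> M -> M) : Sg al (fun v => v 0%nat = F (v 1%nat) (v 2%nat)) -> Df2 al F.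
Proof.
move=> H f g Hf Hg; apply: (Sg_sub3 (P := fun z x y => z = F x y)) => //; try exact: Df_lift.
exact: Df_var.
Qed.
End Intro.

(* Extended by [Ltac defn_named ::=] with the definability lemmas of named notions. *)
Ltac defn_named := fail.

Ltac defn_hyp :=
  match goal with
  | H : Df _ ?h |- Df _ (fun v => ?h (fun n => v (@?r n))) => exact (Df_ren r H)
  | H : context [Df] |- _ => simple apply H
  | H : context [Sg] |- _ => simple apply H
  | H : context [Pi] |- _ => simple apply H
  end.

Ltac defn_step :=
  cbv beta;
  first [ simple apply Df_const | simple apply Sg_const | simple apply Pi_const |
  lazymatch goal with
  | |- Df _ (fun v => v _) => simple apply Df_var
  | |- Df _ (fun v => madd _ _) => simple apply Df_add
  | |- Df _ (fun v => mmul _ _) => simple apply Df_mul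
  | |- Sg _ (fun v => _ /\ _) => simple apply Sg_and
  | |- Pi _ (fun v => exists x, x < _ /\ _)%m => simple apply Pi_bex
  | |- Sg _ (fun v => exists x, _) => simple apply Sg_ex
  | |- Pi _ (fun v => _ /\ _) => simple apply Pi_and
  | |- Sg _ (fun v => _ \/ _) => simple apply Sg_or
  | |- Pi _ (fun v => _ \/ _) => simple apply Pi_or
  | |- Sg _ (fun v => ~ _) => simple apply Sg_not
  | |- Pi _ (fun v => ~ _) => simple apply Pi_not
  | |- Sg _ (fun v => _ <-> _) => simple apply Sg_and
  | |- Pi _ (fun v => _ <-> _) => simple apply Pi_and
  | |- Sg _ (fun v => forall x, x < _ -> _)%m => simple apply Sg_ball
  | |- Pi _ (fun v => forall x, x < _ -> _)%m => simple apply Pi_ball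
  | |- Sg _ (fun v => _ -> _) => simple apply Sg_imp
  | |- Pi _ (fun v => _ -> _) => simple apply Pi_imp
  | |- Pi _ (fun v => forall x : num_of _, _) => simple apply Pi_all
  | |- Sg _ (fun v => _ = _) => first [ simple apply Sg_eq | defn_hyp ]
  | |- Pi _ (fun v => _ = _) => simple apply Pi_eq
  | |- Sg _ (fun v => mlt _ _) => simple apply Sg_lt
  | |- Pi _ (fun v => mlt _ _) => simple apply Pi_lt
  | |- Sg _ (fun v => mmem _ _) => simple apply Sg_mem
  | |- Pi _ (fun v => mmem _ _) => simple apply Pi_mem
  | |- Sg _ _ => first [ defn_hyp | defn_named ]
  | |- Pi _ _ => first [ defn_hyp | defn_named ]
  | |- Df _ _ => first [ defn_hyp | defn_named ]
  end ].

Ltac defn := intros; repeat defn_step; try solve [ assumption | exact I ].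

(** * Least number, greatest number and collection principles *)

Section Principles.
Context {M : rca}.
Local Open Scope m_scope.
Notation al := (@allsets M).

Lemma m_strong_ind (P : M -> Prop) : Sg1 al P ->
  (forall n, (forall m, m < n -> P m) -> P n) -> forall n, P n.
Proof.
move=> HP H n; apply: (H) => m; move: n m; apply: (m_ind (P := fun n => forall m, m < n -> P m)).
- by defn.
- by move=> m Hm; mlra.
- move=> n IH m /mle_lteq [Hm|E]; first by apply: IH; mlra.
  have -> : m = n by mlra.
  exact: H.
Qed.

Lemma m_least (P : M -> Prop) n : Pi1 al P -> P n -> exists m, P m /\ forall y, y < m -> ~ P y.
Proof.
move=> HP Pn; apply: NNPP => N.
have : forall k, ~ P k.
  apply: m_strong_ind; first by move=> f Hf; apply: HP.
  by move=> k Hk Pk; apply: N; exists k.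
by move=> /(_ n).
Qed.

(** Contrapositive induction: it yields a place where [P] stops. This is the greatest element when
    [P] is closed downwards, as in most uses. *)
Lemma m_greatest (P : M -> Prop) b : Sg1 al P -> P 0 -> (forall n, P n -> n <= b) ->
  exists m, P m /\ ~ P (m + 1).
Proof.
move=> HP P0 Hb; apply: NNPP => N.
have : forall k, P k.
  apply: m_ind => //; first by defn.
  by move=> k Pk; apply: NNPP => K; apply: N; exists k.
by move=> /(_ (b + 1)) /Hb H; mlra.
Qed.

Lemma m_collection (P : M -> M -> Prop) n : Sg2 al P ->
  (forall x, x < n -> exists y, P x y) -> exists b, forall x, x < n -> exists y, y < b /\ P x y.
Proof.
move=> HP H.
suff : forall m, exists b, forall x, x < m -> exists y, y < b /\ (x < n -> P x y).
  by move/(_ n) => [b Hb]; exists b => x Hx; have [y [Hy K]] := Hb x Hx; exists y; auto.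
apply: m_ind; first by defn.
- by exists 0 => x Hx; mlra.
- move=> m [b /= Hb].
  have [y Hy] : exists y, m < n -> P m y.
    by case: (classic (m < n)) => [/H [y Hy]|K]; [exists y|exists 0].
  exists (b + y + 1) => x /mle_lteq [Hx|E].
    have {}Hx : x < m by mlra.
    have [y' [H1 H2]] := Hb x Hx; exists y'; split=> //; mlra.
  have -> : x = m by mlra.
  by exists y; split=> //; mlra.
Qed.
End Principles.

(** * Finite sequences *)

Section Sequences.
Context {M : rca}.
Local Open Scope m_scope.
Implicit Types x y z i n m a b s : M.
Notation al := (@allsets M).

Add Ring mring : (@msemiring M).

Lemma mmul_le x y z u : x <= y -> z <= u -> x * z <= y * u.
Proof.
move=> H1 H2.
have [d Ed] : exists d, x + d = y.
  by case: (proj1 (mle_lteq x y) H1) => [/mlt_diff //|->]; exists 0; rewrite madd0.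
have [e Ee] : exists d, z + d = u.
  by case: (proj1 (mle_lteq z u) H2) => [/mlt_diff //|->]; exists 0; rewrite madd0.
subst; have H3 := mle0 (x * e); have H4 := mle0 (d * z); have H5 := mle0 (d * e); mlra.
Qed.

Lemma mle_diff x y : x <= y -> exists d, y = x + d.
Proof.
by case/mle_lteq => [/mlt_diff [d <-]|->]; [exists d|exists 0; rewrite madd0].
Qed.

Lemma mmul_lt_cancel x y z : z * x < z * y -> x < y.
Proof.
move=> H; apply: mlt_by_contra => K.
have := mmul_le (mlt_S z) K; mlra.
Qed.

Lemma mmul_lt x y z : 0 < z -> x < y -> z * x < z * y.
Proof. by move=> Hz H; have := mlt_mul Hz H; rewrite mmulC [y * z]mmulC. Qed.

Definition pr x y : M := (x + y) * (x + y) + x.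

Lemma pr_inj x y x' y' : pr x y = pr x' y' -> x = x' /\ y = y'.
Proof.
(* For [a <= u] the number [u * u + a] lies below the next square, so a pair determines the sum of
   its components. *)
have K u v a b : u < v -> a <= u -> u * u + a = v * v + b -> False.
  move=> H1 H2 E; have [d Ed] := mlt_diff (proj1 (mlt_le1 _ _) H1).
  have [e Ee] : exists e, v = u + 1 + e by apply: mle_diff; mlra.
  subst v; have := mle0 (u * e); have := mle0 (e * e); mlra.
rewrite /pr => E; case: (mlt_total (x + y) (x' + y')) => [H|[H|H]].
- by case: (K _ _ _ _ H _ E); mlra.
- by rewrite H in E; have ? : x = x' by [mlra]; split=> //; mlra.
- by case: (K _ _ _ _ H _ (esym E)); mlra.
Qed.

Lemma pr_ge_sum x y : x + y <= pr x y.
Proof.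
rewrite /pr; case: (proj1 (mle_lteq 0 (x + y)) (mle0 _)) => [H|H].
  have : (x + y) * 1 <= (x + y) * (x + y) by apply: mmul_le; mlra.
  mlra.
mlra.
Qed.
Lemma pr_ge_l x y : x <= pr x y.
Proof. have := pr_ge_sum x y; mlra. Qed.
Lemma pr_ge_r x y : y <= pr x y.
Proof. have := pr_ge_sum x y; mlra. Qed.

Definition mrem a m x : Prop := x < m /\ exists q, q <= a /\ a = q * m + x.

Lemma mrem_intro q m x a : x < m -> a = q * m + x -> mrem a m x.
Proof.
move=> H E; split=> //; exists q; split=> //.
have : q * 1 <= q * m by apply: mmul_le; mlra.
mlra.
Qed.

Lemma mrem_fun a m x y : mrem a m x -> mrem a m y -> x = y.
Proof.
move=> [Hx [q [_ Eq]]] [Hy [r [_ Er]]].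
have K p p' u v : p < p' -> u < m -> p * m + u = p' * m + v -> False.
  move=> H1 H2 E; have : (p + 1) * m <= p' * m by apply: mmul_le; mlra.
  mlra.
case: (mlt_total q r) => [H|[H|H]].
- by case: (K q r x y) => //; mlra.
- by subst r; mlra.
- by case: (K r q y x) => //; mlra.
Qed.

Lemma mrem_exists a m : 0 < m -> exists x q, x < m /\ a = q * m + x.
Proof.
move=> Hm; move: a; apply: m_ind; first by defn.
- by exists 0, 0; split=> //; ring.
- move=> a [x [q [Hx E]]].
  case: (mlt_total (x + 1) m) => [H|[H|H]].
  + by exists (x + 1), q; split=> //; rewrite E; ring.
  + by exists 0, (q + 1); split=> //; mlra.
  + mlra.
Qed.

Lemma mdvd_sub m e c d : 0 < m -> e + m * c = m * d -> exists q, e = m * q.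
Proof.
move=> Hm E; have [q Eq] : exists q, d = c + q.
  apply: mle_diff; apply: mlt_by_contra => H.
  have H' : m * (d + 1) <= m * c by apply: mmul_le; mlra.
  mlra.
by exists q; subst d; mlra.
Qed.

Definition mnth s i x : Prop :=
  exists a, a <= s /\ exists b, b <= s /\ s = pr a b /\ mrem a (1 + (i + 1) * b) x.

Lemma mnth_pr a b i x : mnth (pr a b) i x <-> mrem a (1 + (i + 1) * b) x.
Proof.
split=> [[a' [_ [b' [_ [/pr_inj [-> ->]]]]]] //|H].
by exists a; split; [exact: pr_ge_l|exists b; split; first exact: pr_ge_r].
Qed.

Lemma mnth_fun s i x y : mnth s i x -> mnth s i y -> x = y.
Proof.
move=> [a [_ [b [_ [-> H]]]]] /mnth_pr; exact: mrem_fun H.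
Qed.

Lemma mnth_le s i x : mnth s i x -> x <= s.
Proof.
move=> [a [Ha [b [_ [Es [H [q [_ E]]]]]]]].
have := mle0 (q * (1 + (i + 1) * b)); mlra.
Qed.
End Sequences.

Section SeqDef.
Context {M : rca} (al : set_of M -> Prop).
Local Open Scope m_scope.

Lemma Df_pr : Df2 al (@pr M).
Proof. by move=> f g Hf Hg; rewrite /pr; defn. Qed.
Lemma Sg_mrem : Sg3 al (@mrem M).
Proof. by apply: Sg3I; rewrite /mrem; defn. Qed.
Lemma Pi_mrem : Pi3 al (@mrem M).
Proof. by apply: Pi3I; rewrite /mrem; defn. Qed.
Lemma Sg_mnth : Sg3 al (@mnth M).
Proof.
have H1 := Sg_mrem; have H2 := Df_pr.
by apply: Sg3I; rewrite /mnth; defn.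
Qed.
Lemma Pi_mnth : Pi3 al (@mnth M).
Proof.
have H1 := Pi_mrem; have H2 := Df_pr.
by apply: Pi3I; rewrite /mnth; defn.
Qed.
End SeqDef.

Ltac defn_seq :=
  first [ simple apply Df_pr | simple apply Sg_mnth | simple apply Pi_mnth | simple apply Sg_mrem
        | simple apply Pi_mrem ].
Ltac defn_named ::= defn_seq.

(** * Coding of sequences by the beta function *)

Section Beta.
Context {M : rca}.
Local Open Scope m_scope.
Implicit Types x y z i n m a b s : M.
Notation al := (@allsets M).

Add Ring mring : (@msemiring M).

(** A factorial, obtained as a pure existence statement by Sigma_1 induction: recursion is not at
    hand before sequences are coded. *)
Lemma common_multiple n : exists b, 0 < b /\ forall d, d < n -> 0 < d -> exists c, b = d * c.
Proof.
move: n; apply: m_ind; first by defn.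
- by exists 1; split=> [|d Hd]; mlra.
- move=> n [b [Hb H]]; case: (mnneg n) => Hn.
  + exists (b * n); split.
      by have := mmul_lt Hb Hn; have -> : b * 0 = 0 by ring.
    move=> d /mle_lteq [Hd|Hd] Hd0.
    * have {}Hd : d < n by mlra.
      by have [c ->] := H d Hd Hd0; exists (c * n); ring.
    * have -> : d = n by mlra.
      by exists b; ring.
  + by exists 1; split=> [|d Hd Hd0]; mlra.
Qed.

(* [P] is invertible modulo [m]: some multiple of it is congruent to [-1]. *)
Definition coprime_to (P m : M) : Prop := exists u v, u * P + 1 = v * m.

Lemma coprime_to_mul P R m : 0 < m -> coprime_to P m -> coprime_to R m -> coprime_to (P * R) m.
Proof.
move=> Hm [u [v E]] [w [z E']].
(* Modulo [m] both [u * P] and [w * R] are -1. Taking the first factor twice makes the product -1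
   again, without subtraction. *)
have [q Eq] : exists q, (u * P) * (u * P) * (w * R) + 1 = m * q.
  apply: (@mdvd_sub _ m _ (v * (w * R)) (u * P * v * (w * R) + z)) => //.
  have -> : m * (u * P * v * (w * R) + z) = (u * P) * (w * R) * (v * m) + z * m by ring.
  rewrite -E -E'.
  have -> : m * (v * (w * R)) = (v * m) * (w * R) by ring.
  by rewrite -E; ring.
by exists (u * (u * P) * w), q; rewrite [q * m]mmulC -Eq; ring.
Qed.

(** The difference [d + 1] of the indices divides [b], and this gives explicit Bezout
    coefficients. *)
Lemma beta_moduli_coprime b k d c : b = (d + 1) * c ->
  coprime_to (1 + (k + 1) * b) (1 + (k + (d + 1) + 1) * b).
Proof.
move=> ->.
exists ((k + (d + 1) + 1) * (k + (d + 1) + 1) * c), (1 + (k + (d + 1) + 1) * c * (k + 1)).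
ring.
Qed.

Lemma seq_exists (F : M -> M) n : Df1 al F -> exists s, forall i, i < n -> mnth s i (F i).
Proof.
move=> HF.
have [B HB] : exists B, forall i, i < n -> exists y, y < B /\ y = F i.
  by apply: m_collection => [f g Hf Hg|i _]; [defn|exists (F i)].
(* The range covers both the differences of indices below [n], for coprimality, and [B], so that [b]
   is at least [B] and the moduli exceed the values. *)
have [b [Hb Hdvd]] := common_multiple (n + B + 1).
have Fb i : i < n -> F i < b + 1.
  move=> Hi; have [y [Hy Ey]] := HB i Hi; subst y.
  have [c Ec] := Hdvd B ltac:(mlra) ltac:(mlra).
  case: (mnneg c) => Hc; last by subst c; move: Hb; rewrite Ec mmul0 => /mlt_irr.
  have : B * 1 <= B * c by apply: mmul_le; mlra.
  mlra.
pose m i := 1 + (i + 1) * b.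
have mpos i : 0 < m i by have := mle0 ((i + 1) * b); rewrite /m; mlra.
have Fm i : i < n -> F i < m i.
  by move=> /Fb; have := mle0 (i * b); rewrite /m; mlra.
(* Chinese remaindering without products of sequences: [P] is some common multiple of the moduli
   already treated that is coprime to those still to come. *)
suff : forall k, k <= n -> exists a P, (forall i, i < k -> mrem a (m i) (F i)) /\
    (forall i, i < k -> exists q, P = m i * q) /\
    (forall j, j < n -> k <= j -> coprime_to P (m j)).
  move=> /(_ n (mlt_S n)) [a [P [Ha _]]].
  by exists (pr a b) => i Hi; apply/mnth_pr; apply: Ha.
apply: m_ind.
- by rewrite /m /coprime_to; defn.
- move=> _; exists 0, 1; split; first by move=> i Hi; mlra.
  split; first by move=> i Hi; mlra.
  by move=> j _ _; exists ((j + 1) * b), 1; rewrite /m; ring.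
- move=> k IH Hk; have [|a [P [Ha [HP HC]]]] := IH; first mlra.
  have [u [v Euv]] := HC k ltac:(mlra) ltac:(mlra).
  (* Modulo [m k] both [P * u] and [(k + 1) * b] are -1. The added term thus cancels [a] and leaves
     [F k]; modulo the earlier moduli it vanishes, since they divide [P]. *)
  exists (a + P * u * (a + (k + 1) * b * F k)), (P * m k); split; [|split].
  + move=> i /mle_lteq [Hi|Hi].
      have {}Hi : i < k by mlra.
      have [Hlt [q [_ E]]] := Ha i Hi; have [r Er] := HP i Hi.
      apply: (mrem_intro (q := q + r * u * (a + (k + 1) * b * F k))) => //.
      by rewrite {1}E Er; ring.
    have -> : i = k by mlra.
    have Hkn : k < n by mlra.
    set w := a + (k + 1) * b * F k.
    have E : a + P * u * w + m k * F k = m k * (v * w) + F k.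
      have -> : m k * (v * w) = (v * m k) * w by ring.
      by rewrite -Euv /w /m; ring.
    have [q Eq] : exists q, v * w = F k + q.
      apply: mle_diff; apply: mlt_by_contra => H.
      have H' : m k * (v * w + 1) <= m k * F k by apply: mmul_le; mlra.
      have := Fm k Hkn; mlra.
    by apply: (mrem_intro (q := q)); [exact: Fm|rewrite Eq in E; mlra].
  + move=> i /mle_lteq [Hi|Hi].
      have {}Hi : i < k by mlra.
      by have [r ->] := HP i Hi; exists (r * m k); ring.
    have -> : i = k by mlra.
    by exists P; ring.
  + move=> j Hj Hkj; apply: coprime_to_mul => //; first by apply: HC => //; mlra.
    have [d Ed] : exists d, j = k + 1 + d by apply: mle_diff; mlra.
    have [c Ec] := Hdvd (d + 1) ltac:(mlra) ltac:(mlra).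
    have -> : j = k + (d + 1) by rewrite Ed; ring.
    exact: beta_moduli_coprime Ec.
Qed.

(** [R] is functional and total only below [n]; the default 0 beyond turns it into a total function
    with Sigma_1 graph. *)
Lemma seq_of_rel (R : M -> M -> Prop) n : Sg2 al R ->
  (forall i x y, i < n -> R i x -> R i y -> x = y) -> (forall i, i < n -> exists x, R i x) ->
  exists s, forall i, i < n -> exists x, mnth s i x /\ R i x.
Proof.
move=> HR Hfun Hex.
pose F i := epsilon (inhabits 0) (fun x => (i < n /\ R i x) \/ (n <= i /\ x = 0)).
have HF i : (i < n /\ R i (F i)) \/ (n <= i /\ F i = 0).
  apply: (epsilon_spec (inhabits 0) (fun x => (i < n /\ R i x) \/ (n <= i /\ x = 0))).
  case: (classic (i < n)) => [Hi|/mlt_nle Hi]; last by exists 0; right.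
  by have [x Hx] := Hex i Hi; exists x; left.
have [|s Hs] := @seq_exists F n.
  apply: Df1I; apply: (Sg_ext (P := fun v => (v 1%nat < n /\ R (v 1%nat) (v 0%nat)) \/ (n <= v 1%nat /\ v 0%nat = 0))); last by defn.
  move=> v; case: (HF (v 1%nat)) => -[H1 H2]; split.
  + move=> [[_ H]|[H _]]; [exact: (Hfun (v 1%nat))|mlra].
  + by move=> ->; left.
  + move=> [[H _]|[_ ->]]; [mlra|done].
  + by move=> ->; right.
exists s => i Hi; exists (F i); split; first exact: Hs.
by case: (HF i) => -[] //; mlra.
Qed.
End Beta.

(** * Primitive recursion and counting *)

Section PrimRec.
Context {M : rca}.
Local Open Scope m_scope.
Implicit Types x y z i n m a b s : M.
Notation al := (@allsets M).

Add Ring mring : (@msemiring M).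

(** The shape is that of the formula [Exp2], which is the case of start 1 and doubling. *)
Definition prim_rec_graph a (G : M -> M -> M) n y : Prop :=
  exists s, mnth s 0 a /\
    (forall i, i < n -> exists u, u <= s /\ (mnth s i u /\ mnth s (i + 1) (G i u))) /\ mnth s n y.

Definition prim_rec a (G : M -> M -> M) n : M :=
  epsilon (inhabits 0) (prim_rec_graph a G n).

Lemma prim_rec_graph_fun a G n y y' :
  prim_rec_graph a G n y -> prim_rec_graph a G n y' -> y = y'.
Proof.
move=> [s [H0 [HS Hy]]] [s' [H0' [HS' Hy']]].
suff : forall k, k <= n -> exists u, mnth s k u /\ mnth s' k u.
  by move=> /(_ n (mlt_S n)) [u [/(mnth_fun Hy) -> /(mnth_fun Hy') ->]].
apply: m_ind; first by defn.
- by exists a.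
- move=> k IH Hk; have [|u [Hu Hu']] := IH; first mlra.
  have [v [_ [Hv Hv1]]] := HS k ltac:(mlra).
  have [v' [_ [Hv' Hv1']]] := HS' k ltac:(mlra).
  exists (G k u); split.
  + by rewrite -(mnth_fun Hv Hu).
  + by rewrite -(mnth_fun Hv' Hu').
Qed.

Lemma prim_rec_graph_exists a G n : Df2 al G -> exists y, prim_rec_graph a G n y.
Proof.
move=> HG; move: n; apply: m_ind; first by rewrite /prim_rec_graph; defn.
- have [s Hs] := @seq_exists M (fun _ => a) 1 ltac:(intros; defn).
  by exists a, s; split; [apply: Hs; apply: mlt01|split; [move=> i; mlra|apply: Hs; apply: mlt01]].
- move=> n [y [s [H0 [HS Hy]]]].
  pose R i x := (i <= n /\ mnth s i x) \/ (n < i /\ x = G n y).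
  have [|||s' Hs'] := @seq_of_rel M R (n + 1 + 1).
  + by rewrite /R => f g Hf Hg; defn.
  + move=> i x z Hi [[H1 H2]|[H1 H2]] [[H3 H4]|[H3 H4]]; try mlra.
    exact: mnth_fun H2 H4.
  + move=> i Hi; rewrite /R; case: (mlt_total i n) => [H|[->|H]].
    * by have [u [_ [Hu _]]] := HS i H; exists u; left; split=> //; mlra.
    * by exists y; left; split=> //; mlra.
    * by exists (G n y); right.
  + have K i x : i <= n -> mnth s i x -> mnth s' i x.
      move=> Hi Hx; have [z [Hz [[_ H]|[H _]]]] := Hs' i ltac:(mlra); last by mlra.
      by rewrite (mnth_fun Hx H).
    have K' : mnth s' (n + 1) (G n y).
      have [z [Hz [[H _]|[_ <- //]]]] := Hs' (n + 1) ltac:(mlra); mlra.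
    exists (G n y), s'; split; first by apply: K => //; exact: mle0.
    split=> // i /mle_lteq [Hi|Hi].
      have {}Hi : i < n by mlra.
      have [u [_ [Hu Hu1]]] := HS i Hi.
      have Ku : mnth s' i u by apply: K => //; mlra.
      exists u; split; first exact: mnth_le Ku.
      by split=> //; apply: K => //; mlra.
    have -> : i = n by mlra.
    have Ky : mnth s' n y by apply: K => //; mlra.
    by exists y; split=> //; exact: mnth_le Ky.
Qed.

Lemma prim_recP a G n : Df2 al G -> prim_rec_graph a G n (prim_rec a G n).
Proof.
by move=> HG; apply: (epsilon_spec (inhabits 0)); apply: prim_rec_graph_exists.
Qed.

Lemma prim_rec_eq a G n y : Df2 al G -> (y = prim_rec a G n <-> prim_rec_graph a G n y).
Proof.
move=> HG; split=> [->|H]; first exact: prim_recP.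
exact: prim_rec_graph_fun H (prim_recP _ _ HG).
Qed.

Lemma prim_rec0 a G : Df2 al G -> prim_rec a G 0 = a.
Proof.
move=> HG; have [s [H0 [_ H]]] := prim_recP a 0 HG; exact: mnth_fun H H0.
Qed.

Lemma prim_recS a G n : Df2 al G -> prim_rec a G (n + 1) = G n (prim_rec a G n).
Proof.
move=> HG; have [s [H0 [HS H]]] := prim_recP a (n + 1) HG.
have [u [_ [Hu Hu1]]] := HS n (mlt_S n).
have -> : prim_rec a G n = u.
  symmetry; apply/prim_rec_eq => //; exists s; split=> //; split=> // i Hi; apply: HS; mlra.
exact: mnth_fun H Hu1.
Qed.
End PrimRec.

Section PrimRecDef.
Context {M : rca}.
Local Open Scope m_scope.

Lemma Sg_fix3 (al : set_of M -> Prop) (P : (nat -> M) -> M -> M -> M -> Prop) v :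
  Sg al (fun v => P (fun n => v (S (S (S n)))) (v 0%nat) (v 1%nat) (v 2%nat)) ->
  Sg allsets (fun e => P v (e 0%nat) (e 1%nat) (e 2%nat)).
Proof.
move=> /Sg_all_sets H.
exact: (Sg_subst (fun n => match n with 0 => PVar 0 | 1 => PVar 1 | 2 => PVar 2
  | S (S (S n)) => PConst (v n) end)%nat H).
Qed.

(** The recursion equations concern one fixed [G v]. Freezing the environment turns its entries into
    number parameters. *)
Lemma Df2_fix (al : set_of M -> Prop) (G : (nat -> M) -> M -> M -> M) v :
  Df al (fun v => G (fun n => v (S (S n))) (v 0%nat) (v 1%nat)) -> Df2 allsets (G v).
Proof. by move=> H; apply: Df2I; exact: (Sg_fix3 (P := fun v x y z => x = G v y z) v H). Qed.

Lemma Sg1_fix (al : set_of M -> Prop) (P : (nat -> M) -> M -> Prop) v :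
  Sg al (fun v => P (fun n => v (S n)) (v 0%nat)) -> Sg1 allsets (P v).
Proof.
move=> /Sg_all_sets H; apply: Sg1I.
exact: (Sg_subst (fun n => match n with 0 => PVar 0 | S n => PConst (v n) end)%nat H).
Qed.

Lemma Df_prim_rec (al : set_of M -> Prop) a (G : (nat -> M) -> M -> M -> M) n :
  Df al a -> Df al n -> Df al (fun v => G (fun n => v (S (S n))) (v 0%nat) (v 1%nat)) ->
  Df al (fun v => prim_rec (a v) (G v) (n v)).
Proof.
move=> Ha Hn HG.
apply: (Sg_ext (P := fun v => prim_rec_graph (a (fun n => v (S n))) (G (fun n => v (S n)))
  (n (fun n => v (S n))) (v 0%nat))).
  by move=> v; rewrite prim_rec_eq //; apply: Df2_fix HG.
have Ha' := Df_lift Ha; have Hn' := Df_lift Hn.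
rewrite /prim_rec_graph; apply: Sg_ex; apply: Sg_and; [|apply: Sg_and].
- by simple apply Sg_mnth; [defn|defn|exact: (Df_lift Ha')].
- apply: (Sg_ball (f := fun v => n (fun n => v (S (S n))))); first exact: (Df_lift Hn').
  apply: Sg_ex; apply: Sg_and; first by defn.
  apply: Sg_and; first by defn.
  simple apply Sg_mnth; [defn|defn|].
  exact: Sg_ext (Sg_ren (fun n => match n with 0 => 0 | 1 => 2 | 2 => 1 | S (S (S n)) => S (S (S (S (S n)))) end)%nat HG).
- by simple apply Sg_mnth; [defn|exact: (Df_lift Hn')|defn].
Qed.
End PrimRecDef.

Section Sums.
Context {M : rca}.
Local Open Scope m_scope.
Implicit Types x y z i m a b s w : M.
Implicit Types f g : M -> M.

Add Ring mring : (@msemiring M).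

Definition msum f n : M := prim_rec 0 (fun i c => c + f i) n.
Definition indic (P : Prop) : M := if excluded_middle_informative P then 1 else 0.
Definition cnt (P : M -> Prop) n : M := msum (fun i => indic (P i)) n.

Lemma indic1 P : P -> indic P = 1.
Proof. by rewrite /indic; case: excluded_middle_informative. Qed.
Lemma indic0 P : ~ P -> indic P = 0.
Proof. by rewrite /indic; case: excluded_middle_informative. Qed.

Lemma indic_eq P x : x = indic P <-> (P /\ x = 1) \/ (~ P /\ x = 0).
Proof. by rewrite /indic; case: excluded_middle_informative => H; split; intuition. Qed.

Lemma Df_indic (al : set_of M -> Prop) (P : (nat -> M) -> Prop) : Sg al P -> Pi al P -> Df al (fun v => indic (P v)).
Proof.
move=> H1 H2; apply: (Sg_ext (P := fun v => (P (fun n => v (S n)) /\ v 0%nat = 1) \/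
   (~ P (fun n => v (S n)) /\ v 0%nat = 0))).
  by move=> v; rewrite indic_eq.
have H3 := Sg_ren S H1; have H4 := Sg_ren S H2.
by apply: Sg_or; apply: Sg_and => //; defn.
Qed.

Lemma Df_msum (al : set_of M -> Prop) (f : (nat -> M) -> M -> M) n :
  Df al n -> Df al (fun v => f (fun n => v (S n)) (v 0%nat)) -> Df al (fun v => msum (f v) (n v)).
Proof.
move=> Hn Hf; apply: (Df_prim_rec (G := fun v i c => c + f v i)) => //; first by defn.
apply: Df_add; first by defn.
exact: Sg_ext (Sg_ren (fun n => match n with 0 => 0 | 1 => 1 | S (S n) => S (S (S n)) end)%nat Hf).
Qed.

Lemma Df_cnt (al : set_of M -> Prop) (P : (nat -> M) -> M -> Prop) n :
  Df al n -> Sg al (fun v => P (fun n => v (S n)) (v 0%nat)) -> Pi al (fun v => P (fun n => v (S n)) (v 0%nat)) ->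
  Df al (fun v => cnt (P v) (n v)).
Proof. by move=> Hn H1 H2; apply: Df_msum => //; apply: Df_indic. Qed.
End Sums.

Ltac defn_sum :=
  first [ simple apply Df_indic | simple apply Df_msum | simple apply Df_cnt ].
Ltac defn_named ::= first [ defn_seq | defn_sum ].

Section SumTheory.
Context {M : rca}.
Local Open Scope m_scope.
Implicit Types x y z i n m a b s w : M.
Implicit Types f g : M -> M.
Notation al := (@allsets M).

Add Ring mring : (@msemiring M).

Lemma msum0 f : Df1 al f -> msum f 0 = 0.
Proof. by move=> H; apply: prim_rec0; defn. Qed.
Lemma msumS f n : Df1 al f -> msum f (n + 1) = msum f n + f n.
Proof. by move=> H; apply: (@prim_recS M 0 (fun i c => c + f i)); defn. Qed.

Lemma msum_le f g n : Df1 al f -> Df1 al g -> (forall i, i < n -> f i <= g i) -> msum f n <= msum g n.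
Proof.
move=> Hf Hg H.
suff : forall k, k <= n -> msum f k <= msum g k by apply; exact: mlt_S.
apply: m_ind; first by defn.
- by rewrite !msum0 //; mlra.
- move=> k IH Hk; rewrite !msumS //.
  have := H k ltac:(mlra); have := IH ltac:(mlra); mlra.
Qed.

Lemma msum_eq f g n : Df1 al f -> Df1 al g -> (forall i, i < n -> f i = g i) -> msum f n = msum g n.
Proof.
move=> Hf Hg H.
have H1 := @msum_le f g n Hf Hg; have H2 := @msum_le g f n Hg Hf.
have : msum f n <= msum g n by apply: H1 => i /H ->; exact: mlt_S.
have : msum g n <= msum f n by apply: H2 => i /H ->; exact: mlt_S.
mlra.
Qed.

Lemma msum_add f g n : Df1 al f -> Df1 al g -> msum (fun i => f i + g i) n = msum f n + msum g n.
Proof.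
move=> Hf Hg.
have Hfg : Df1 al (fun i => f i + g i) by move=> h Hh; defn.
move: n; apply: m_ind; first by defn.
- by rewrite !msum0 //; ring.
- by move=> k IH; rewrite !msumS // IH; ring.
Qed.

Lemma msum_const c n : msum (fun _ => c) n = n * c.
Proof.
have H : Df1 al (fun _ => c) by move=> h Hh; defn.
move: n; apply: m_ind; first by defn.
- by rewrite msum0 //; ring.
- by move=> k IH; rewrite msumS // IH; ring.
Qed.

Lemma msum_mul c f n : Df1 al f -> msum (fun i => c * f i) n = c * msum f n.
Proof.
move=> Hf; have H : Df1 al (fun i => c * f i) by move=> h Hh; defn.
move: n; apply: m_ind; first by defn.
- by rewrite !msum0 //; ring.
- by move=> k IH; rewrite !msumS // IH; ring.
Qed.

Lemma msum_exch (F : M -> M -> M) n m : Df2 al F ->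
  msum (fun i => msum (fun j => F i j) m) n = msum (fun j => msum (fun i => F i j) n) m.
Proof.
move=> HF; move: n; apply: m_ind; first by defn.
- rewrite msum0; first by move=> h Hh; defn.
  have -> : msum (fun j => msum (fun i => F i j) 0) m = msum (fun _ => 0) m.
    by apply: msum_eq; [defn|defn|move=> i _; apply: msum0; defn].
  by rewrite msum_const; ring.
- move=> k IH; rewrite msumS; first by move=> h Hh; defn.
  rewrite IH -msum_add; [defn|defn|].
  apply: msum_eq; [defn..|].
  by move=> i _; rewrite msumS // => h Hh; defn.
Qed.

Lemma msum_split f a b : Df1 al f -> msum f (a + b) = msum f a + msum (fun i => f (a + i)) b.
Proof.
move=> Hf; have H : Df1 al (fun i => f (a + i)) by move=> h Hh; defn.
move: b; apply: m_ind; first by defn.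
- by rewrite msum0 // !madd0.
- by move=> b IH; rewrite -maddA !msumS // IH; ring.
Qed.

Section Counting.
Variable P : M -> Prop.
Hypotheses (SP : Sg1 al P) (PP : Pi1 al P).

Let DP : Df1 al (fun i => indic (P i)).
Proof. by move=> h Hh; defn. Qed.

Lemma cnt0 : cnt P 0 = 0.
Proof. exact: msum0. Qed.
Lemma cntS n : cnt P (n + 1) = cnt P n + indic (P n).
Proof. exact: msumS. Qed.
Lemma cntS1 n : P n -> cnt P (n + 1) = cnt P n + 1.
Proof. by move=> H; rewrite cntS indic1. Qed.
Lemma cntS0 n : ~ P n -> cnt P (n + 1) = cnt P n.
Proof. by move=> H; rewrite cntS indic0 // madd0. Qed.

Lemma cnt_mono n m : n <= m -> cnt P n <= cnt P m.
Proof.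
move=> /mle_diff [d ->]; rewrite /cnt msum_split //; have := mle0 (msum (fun i => @indic M (P (n + i))) d); mlra.
Qed.

Lemma cnt_le n : cnt P n <= n.
Proof.
have := @msum_le (fun i => indic (P i)) (fun _ => 1) n DP; rewrite msum_const mmul1; apply.
- by move=> h Hh; defn.
- by move=> i _; case: (classic (P i)) => H; rewrite ?(indic1 H) ?(indic0 H); mlra.
Qed.

Lemma cnt_eq0 n : (forall i, i < n -> ~ P i) -> cnt P n = 0.
Proof.
move=> H; rewrite /cnt (@msum_eq _ (fun _ => 0)) ?msum_const ?mmul0 //.
- by move=> h Hh; defn.
- by move=> i /H; apply: indic0.
Qed.

Lemma cnt_all n : (forall i, i < n -> P i) -> cnt P n = n.
Proof.
move=> H; rewrite /cnt (@msum_eq _ (fun _ => 1)) ?msum_const ?mmul1 //.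
- by move=> h Hh; defn.
- by move=> i /H; apply: indic1.
Qed.

Lemma cnt_unique n : (forall i j, i < n -> j < n -> P i -> P j -> i = j) -> cnt P n <= 1.
Proof.
move=> H.
have : forall k, k <= n -> cnt P k <= 1 /\ (cnt P k = 0 \/ exists i, i < k /\ P i).
  apply: m_ind; first by defn.
  - by rewrite cnt0; split; [mlra|left].
  - move=> k IH Hk; have [|H1 H2] := IH; first mlra.
    case: (classic (P k)) => Pk; last first.
      rewrite cntS0 //; split=> //; case: H2 => [->|[i [Hi Pi]]]; [by left|right].
      by exists i; split=> //; mlra.
    rewrite cntS1 //; case: H2 => [->|[i [Hi Pi]]].
      by split; [mlra|right; exists k; split=> //; mlra].
    have E := H i k ltac:(mlra) ltac:(mlra) Pi Pk; mlra.
by move=> /(_ n (mlt_S n)) [].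
Qed.

Lemma cnt_lt n i : i < n -> P i -> cnt P i < cnt P n.
Proof.
move=> Hi Pi; have := @cnt_mono (i + 1) n (proj1 (mlt_le1 _ _) Hi); rewrite cntS1 //; mlra.
Qed.

Lemma cnt_rank n k : k < cnt P n -> exists x, x < n /\ P x /\ cnt P x = k.
Proof.
move: n; apply: (m_ind (P := fun n => k < cnt P n -> exists x, x < n /\ P x /\ cnt P x = k)); first by defn.
- by rewrite cnt0; mlra.
- move=> n IH; case: (classic (P n)) => Pn.
    rewrite cntS1 // => /mle_lteq [H|H].
      have [|x [Hx H']] := IH; first mlra.
      by exists x; split=> //; mlra.
    by exists n; split; [exact: mlt_S|split=> //; mlra].
  rewrite cntS0 // => /IH [x [Hx H']].
  by exists x; split=> //; mlra.
Qed.
End Counting.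

Lemma cnt_sub (P Q : M -> Prop) n : Sg1 al P -> Pi1 al P -> Sg1 al Q -> Pi1 al Q ->
  (forall i, i < n -> P i -> Q i) -> cnt P n <= cnt Q n.
Proof.
move=> H1 H2 H3 H4 H; apply: msum_le; [defn..|].
move=> i Hi; case: (classic (P i)) => Hp; last by rewrite indic0 //; exact: mle0.
by rewrite (indic1 Hp) (indic1 (H i Hi Hp)); mlra.
Qed.

Lemma cnt_ext (P Q : M -> Prop) n : Sg1 al P -> Pi1 al P -> Sg1 al Q -> Pi1 al Q ->
  (forall i, i < n -> P i <-> Q i) -> cnt P n = cnt Q n.
Proof.
move=> H1 H2 H3 H4 H.
have := @cnt_sub P Q n H1 H2 H3 H4 (fun i Hi => proj1 (H i Hi)).
have := @cnt_sub Q P n H3 H4 H1 H2 (fun i Hi => proj2 (H i Hi)).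
mlra.
Qed.

Lemma cnt_or (P Q : M -> Prop) n : Sg1 al P -> Pi1 al P -> Sg1 al Q -> Pi1 al Q ->
  cnt (fun i => P i \/ Q i) n <= cnt P n + cnt Q n.
Proof.
move=> H1 H2 H3 H4; rewrite /cnt -msum_add; [defn|defn|].
apply: msum_le; [defn..|].
move=> i _; case: (classic (P i)) => Hp; case: (classic (Q i)) => Hq;
  rewrite ?(indic1 Hp) ?(indic1 Hq) ?(indic0 Hp) ?(indic0 Hq).
- rewrite indic1; [tauto|mlra].
- rewrite indic1; [tauto|mlra].
- rewrite indic1; [tauto|mlra].
- rewrite indic0; [tauto|mlra].
Qed.

Lemma cnt_split (P : M -> Prop) a b : Sg1 al P -> Pi1 al P ->
  cnt P (a + b) = cnt P a + cnt (fun i => P (a + i)) b.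
Proof. by move=> H1 H2; rewrite /cnt msum_split // => h Hh; defn. Qed.

(* Counting the pairs of [R] in two ways. *)
Lemma double_count (P Q : M -> Prop) (R : M -> M -> Prop) w n m :
  Sg1 al P -> Pi1 al P -> Sg1 al Q -> Pi1 al Q -> Sg2 al R -> Pi2 al R ->
  (forall s, s < n -> P s -> w <= cnt (R s) m) ->
  (forall s s' y, s < n -> s' < n -> y < m -> P s -> P s' -> R s y -> R s' y -> s = s') ->
  (forall s y, s < n -> y < m -> P s -> R s y -> Q y) ->
  w * cnt P n <= cnt Q m.
Proof.
move=> SP PP SQ PQ SR PR Hw Hu HQ.
pose F s y : M := indic (P s /\ R s y).
have DF : Df2 al F by move=> f g Hf Hg; rewrite /F; defn.
have H1 : w * cnt P n <= msum (fun s => msum (fun y => F s y) m) n.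
  rewrite /cnt -msum_mul; first by move=> h Hh; defn.
  apply: msum_le; [defn..|].
  move=> s Hs; case: (classic (P s)) => Ps; last by rewrite indic0 // mmul0; exact: mle0.
  rewrite indic1 // mmul1.
  have -> : msum (fun y => F s y) m = cnt (R s) m; last exact: Hw.
  apply: msum_eq; [defn..|].
  by move=> y _; apply/indic_eq; rewrite /F /indic; case: excluded_middle_informative => K; intuition.
have H2 : msum (fun y => msum (fun s => F s y) n) m <= cnt Q m.
  apply: msum_le; [defn..|].
  move=> y Hy; case: (classic (Q y)) => Qy.
    rewrite indic1 //; apply: (@cnt_unique (fun s => P s /\ R s y)).
    + by move=> h Hh; defn.
    + by move=> h Hh; defn.
    + by move=> s s' Hs Hs' [Ps Rs] [Ps' Rs']; apply: Hu Hs Hs' Hy Ps Ps' Rs Rs'.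
  rewrite indic0 //; have -> : msum (fun s => F s y) n = 0; last by mlra.
  apply: (@cnt_eq0 (fun s => P s /\ R s y)).
  + by move=> h Hh; defn.
  + by move=> h Hh; defn.
  + by move=> s Hs [Ps Rs]; apply: Qy; apply: HQ Hs Hy Ps Rs.
rewrite msum_exch // in H1; mlra.
Qed.

(** Choose [b] such that the number of [x < n] with a witness below [b] is maximal, which is
    possible since it never exceeds [n]. A further [x] with a witness would increase it. *)
Lemma strong_collection (P : M -> M -> Prop) n : Sg2 al P -> Pi2 al P ->
  exists b, forall x, x < n -> (exists y, P x y) -> exists y, y < b /\ P x y.
Proof.
move=> SP PP.
pose L b x := exists y, y < b /\ P x y.
have SL b : Sg1 al (L b) by rewrite /L; defn.
have PL b : Pi1 al (L b) by rewrite /L; defn.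
pose K c := exists b, c <= cnt (L b) n.
have [|||c [[b Hbc] Hmax]] := @m_greatest M K n.
- by rewrite /K /L; defn.
- by exists 0; exact: mle0.
- by move=> c [b Hbc]; have := @cnt_le _ (SL b) (PL b) n; mlra.
exists b => x Hx [y Pxy]; apply: NNPP => N; apply: Hmax; exists (b + y + 1).
have [e Ee] : exists e, n = x + 1 + e by apply: mle_diff; mlra.
have Hsub i : L b i -> L (b + y + 1) i by move=> [z [Hz Pz]]; exists z; split=> //; mlra.
have : cnt (L b) x <= cnt (L (b + y + 1)) x by apply: cnt_sub; [defn..|auto].
have : cnt (fun i => L b (x + 1 + i)) e <= cnt (fun i => L (b + y + 1) (x + 1 + i)) e.
  by apply: cnt_sub; [defn..|auto].
have : cnt (L b) (x + 1) = cnt (L b) x by apply: cntS0; [defn|defn|done].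
have : cnt (L (b + y + 1)) (x + 1) = cnt (L (b + y + 1)) x + 1.
  by apply: cntS1; [defn|defn|exists y; split=> //; mlra].
move: Hbc; rewrite Ee !(cnt_split _ _ (SL _) (PL _)); mlra.
Qed.
End SumTheory.

(** * Powers of two, cardinalities and binary strings *)

Section Strings.
Context {M : rca}.
Local Open Scope m_scope.
Implicit Types x y z i j n m k a b s t r p q : M.
Notation al := (@allsets M).

Add Ring mring : (@msemiring M).

Definition exp2 n : M := prim_rec 1 (fun _ c => c + c) n.

Lemma exp2_step : Df2 al (fun _ c : M => c + c).
Proof. defn. Qed.

Lemma exp2_0 : exp2 0 = 1.
Proof. exact: prim_rec0 exp2_step. Qed.
Lemma exp2_S n : exp2 (n + 1) = exp2 n + exp2 n.
Proof. exact: (@prim_recS M 1 _ n exp2_step). Qed.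

Definition mdiv a m : M :=
  epsilon (inhabits 0) (fun q => (0 < m /\ exists x, x < m /\ a = q * m + x) \/ (m = 0 /\ q = 0)).
Definition msub a b : M := epsilon (inhabits 0) (fun d => a = b + d \/ (a < b /\ d = 0)).
Definition is_len s n : Prop := exists p, p = exp2 n /\ p <= s /\ s < p + p.
Definition len s : M := epsilon (inhabits 0) (fun n => is_len s n \/ (s = 0 /\ n = 0)).
(** As strings are numbers with a leading digit 1, division drops the last [len s - i] digits. For
    [i] beyond the length the subtraction is truncated and [s] itself results. *)
Definition pre s i : M := mdiv s (exp2 (msub (len s) i)).

Lemma div_unique q r m x y : x < m -> y < m -> q * m + x = r * m + y -> q = r.
Proof.
move=> Hx Hy E; case: (mlt_total q r) => [H|[//|H]].
- have : (q + 1) * m <= r * m by apply: mmul_le; mlra.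
  mlra.
- have : (r + 1) * m <= q * m by apply: mmul_le; mlra.
  mlra.
Qed.

Lemma mdiv_eq a m q : q = mdiv a m <-> (0 < m /\ exists x, x < m /\ a = q * m + x) \/ (m = 0 /\ q = 0).
Proof.
have H : (0 < m /\ exists x, x < m /\ a = mdiv a m * m + x) \/ (m = 0 /\ mdiv a m = 0).
  apply: (epsilon_spec (inhabits 0) (fun q => (0 < m /\ exists x, x < m /\ a = q * m + x) \/ (m = 0 /\ q = 0))).
  case: (mnneg m) => Hm; last by exists 0; right.
  by have [x [q' [Hx E]]] := mrem_exists a Hm; exists q'; left; split=> //; exists x.
split=> [-> //|[[Hm [x [Hx E]]]|[Hm ->]]]; case: H => [[Hm' [x' [Hx' E']]]|[Hm' E']]; try mlra.
by apply: div_unique Hx Hx' _; rewrite -E -E'.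
Qed.

Lemma msub_eq a b d : d = msub a b <-> a = b + d \/ (a < b /\ d = 0).
Proof.
have H : a = b + msub a b \/ (a < b /\ msub a b = 0).
  apply: (epsilon_spec (inhabits 0) (fun d => a = b + d \/ (a < b /\ d = 0))).
  case: (classic (a < b)) => [K|/mlt_nle /mle_diff [e ->]]; first by exists 0; right.
  by exists e; left.
split=> [-> //|[K|[K ->]]]; case: H => [E|[E E']]; mlra.
Qed.

Lemma msubK a b : b <= a -> a = b + msub a b.
Proof. by move=> H; case: (proj1 (msub_eq a b _) erefl) => // -[]; mlra. Qed.

Lemma exp2_gt0 n : 0 < exp2 n.
Proof.
move: n; apply: m_ind.
- apply: (Sg_lt (f := fun _ => 0)); first by defn.
  by apply: Df_prim_rec; defn.
- by rewrite exp2_0; exact: mlt01.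
- by move=> n; rewrite exp2_S; mlra.
Qed.

Lemma is_lenE s n : is_len s n <-> exp2 n <= s /\ s < exp2 (n + 1).
Proof. by rewrite exp2_S; split=> [[p [-> H]]|H] //; exists (exp2 n). Qed.
End Strings.

Section StringDef.
Context {M : rca} (al : set_of M -> Prop).
Local Open Scope m_scope.

Lemma Df_exp2 : Df1 al (@exp2 M).
Proof. by move=> f Hf; apply: Df_prim_rec; defn. Qed.
Lemma Df_mdiv : Df2 al (@mdiv M).
Proof. by apply: Df2I; apply: Sg_ext => [v|]; [exact: iff_sym (mdiv_eq _ _ _)|defn]. Qed.
Lemma Df_msub : Df2 al (@msub M).
Proof. by apply: Df2I; apply: Sg_ext => [v|]; [exact: iff_sym (msub_eq _ _ _)|defn]. Qed.
Lemma Sg_is_len : Sg2 al (@is_len M).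
Proof.
have H := Df_exp2; apply: Sg2I; apply: Sg_ext => [v|]; [exact: iff_sym (is_lenE _ _)|defn].
Qed.
Lemma Pi_is_len : Pi2 al (@is_len M).
Proof.
have H := Df_exp2; apply: Pi2I.
have H' : Pi al (fun v : nat -> M => exp2 (v 1%nat) <= v 0%nat /\ v 0%nat < exp2 (v 1%nat + 1)).
  by apply: Pi_and; apply: Pi_lt; defn.
by apply: Sg_ext H' => v; rewrite is_lenE.
Qed.
End StringDef.

Ltac defn_string :=
  first [ simple apply Df_exp2 | simple apply Df_mdiv | simple apply Df_msub
        | simple apply Sg_is_len | simple apply Pi_is_len ].
Ltac defn_named ::= first [ defn_seq | defn_sum | defn_string ].

Section StringTheory.
Context {M : rca}.
Local Open Scope m_scope.
Implicit Types x y z i j n m k a b s t r p q : M.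
Notation al := (@allsets M).

Add Ring mring : (@msemiring M).

Lemma exp2_add n m : exp2 (n + m) = exp2 n * exp2 m.
Proof.
move: m; apply: m_ind; first by defn.
- by rewrite exp2_0 madd0 mmul1.
- by move=> m IH; rewrite -maddA !exp2_S IH; ring.
Qed.

Lemma exp2_le n m : n <= m -> exp2 n <= exp2 m.
Proof.
move=> /mle_diff [d ->]; rewrite exp2_add.
have := mmul_le (mlt_S (exp2 n)) (proj1 (mlt_le1 0 (exp2 d)) (exp2_gt0 d)); mlra.
Qed.

Lemma exp2_gt n : n < exp2 n.
Proof.
move: n; apply: m_ind; first by defn.
- by rewrite exp2_0; exact: mlt01.
- by move=> n; rewrite exp2_S; mlra.
Qed.

Lemma is_len_fun s n m : is_len s n -> is_len s m -> n = m.
Proof.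
move=> /is_lenE [H1 H2] /is_lenE [H3 H4]; case: (mlt_total n m) => [H|[//|H]].
- have : exp2 (n + 1) <= exp2 m by apply: exp2_le; mlra.
  mlra.
- have : exp2 (m + 1) <= exp2 n by apply: exp2_le; mlra.
  mlra.
Qed.

Lemma is_len_exists s : 0 < s -> exists n, is_len s n.
Proof.
move=> Hs; have [|||n [H1 H2]] := @m_greatest M (fun n => exp2 n <= s) s.
- by defn.
- by rewrite exp2_0; mlra.
- by move=> n; have := exp2_gt n; mlra.
by exists n; apply/is_lenE; split=> //; mlra.
Qed.

Lemma len_eq s n : n = len s <-> is_len s n \/ (s = 0 /\ n = 0).
Proof.
have H : is_len s (len s) \/ (s = 0 /\ len s = 0).
  apply: (epsilon_spec (inhabits 0) (fun n => is_len s n \/ (s = 0 /\ n = 0))).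
  by case: (mnneg s) => [/is_len_exists [m]|]; [exists m; left|exists 0; right].
have N : s = 0 -> ~ is_len s n /\ ~ is_len s (len s).
  by move=> E; split=> /is_lenE []; [have := exp2_gt0 n|have := exp2_gt0 (len s)]; mlra.
split=> [-> //|[K|[K ->]]]; case: H => [E|[E E']].
- exact: is_len_fun K E.
- by case: (N E).
- by case: (N K).
- by [].
Qed.

Lemma is_lenP s n : is_len s n <-> 0 < s /\ len s = n.
Proof.
split=> [H|[Hs E]].
  split; last by symmetry; apply/len_eq; left.
  by move/is_lenE: H => [H _]; have := exp2_gt0 n; mlra.
by case: (proj1 (len_eq s n) (esym E)) => // -[]; mlra.
Qed.

Lemma len_exp2 s n : exp2 n <= s -> s < exp2 n + exp2 n -> len s = n.
Proof. by move=> H1 H2; apply: (proj2 (proj1 (is_lenP s n) _)); apply/is_lenE; rewrite exp2_S. Qed.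

Lemma len_bounds s : 0 < s -> exp2 (len s) <= s /\ s < exp2 (len s) + exp2 (len s).
Proof. by move=> H; rewrite -exp2_S; apply/is_lenE/is_lenP. Qed.

Lemma mdivP a m q x : x < m -> a = q * m + x -> mdiv a m = q.
Proof.
by move=> Hx E; symmetry; apply/mdiv_eq; left; split; [mlra|exists x].
Qed.

Lemma mdiv_spec a m : 0 < m -> exists x, x < m /\ a = mdiv a m * m + x.
Proof. by move=> Hm; case: (proj1 (mdiv_eq a m _) erefl) => -[H H']; [|mlra]. Qed.

Lemma mdiv_mul a m k : 0 < m -> 0 < k -> mdiv (mdiv a m) k = mdiv a (m * k).
Proof.
move=> Hm Hk; have [x [Hx Ex]] := mdiv_spec a Hm.
have [y [Hy Ey]] := mdiv_spec (mdiv a m) Hk.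
symmetry; apply: (@mdivP _ _ _ (y * m + x)).
- have : (y + 1) * m <= k * m by apply: mmul_le; mlra.
  mlra.
- by rewrite {1}Ex {1}Ey; ring.
Qed.

Lemma mdiv1 a : mdiv a 1 = a.
Proof. by apply: (@mdivP _ _ _ 0); [exact: mlt01|ring]. Qed.

Lemma len_mdiv s k : 0 < s -> k <= len s -> len (mdiv s (exp2 k)) + k = len s /\ 0 < mdiv s (exp2 k).
Proof.
move=> Hs /mle_diff [d Ed]; have [H1 H2] := len_bounds Hs.
have [x [Hx Ex]] := mdiv_spec s (exp2_gt0 k).
set q := mdiv s (exp2 k) in Ex *.
rewrite Ed exp2_add in H1 H2.
have K1 : exp2 d <= q.
  apply: mlt_by_contra => K.
  have : exp2 k * (q + 1) <= exp2 k * exp2 d by apply: mmul_le; mlra.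
  mlra.
have K2 : q < exp2 d + exp2 d.
  apply: (@mmul_lt_cancel M _ _ (exp2 k)); mlra.
rewrite (len_exp2 K1 K2) Ed; split; first by ring.
by have := exp2_gt0 d; mlra.
Qed.

Lemma pre_mdiv s i k : len s = i + k -> pre s i = mdiv s (exp2 k).
Proof.
move=> E; rewrite /pre; congr (mdiv _ (exp2 _)).
by symmetry; apply/msub_eq; left.
Qed.

Lemma pre_len s i : 0 < s -> i <= len s -> 0 < pre s i /\ len (pre s i) = i.
Proof.
move=> Hs /mle_diff [k Ek]; rewrite (pre_mdiv Ek).
have [|H1 H2] := @len_mdiv s k Hs; first by mlra.
split=> //; mlra.
Qed.

Lemma pre_pre s i j : 0 < s -> j <= i -> i <= len s -> pre (pre s i) j = pre s j.
Proof.
move=> Hs /mle_diff [d Ed] Hi; have [Hp Hl] := pre_len Hs Hi.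
have [k Ek] := mle_diff Hi.
rewrite (@pre_mdiv (pre s i) j d) ?Hl // (pre_mdiv Ek) (@pre_mdiv s j (k + d)); last by rewrite exp2_add mdiv_mul //; exact: exp2_gt0.
by rewrite Ek Ed; ring.
Qed.

Lemma pre_id s : 0 < s -> pre s (len s) = s.
Proof. by move=> Hs; rewrite (@pre_mdiv s _ 0) ?exp2_0 ?mdiv1 // madd0. Qed.

Definition cat t r s : Prop :=
  0 < t /\ exists n, exists p, is_len r n /\ p = exp2 n /\ s + p = t * p + r.
Definition prefix t s : Prop := exists r, cat t r s.

Lemma prefixP t s : prefix t s <-> 0 < s /\ 0 < t /\ len t <= len s /\ t = pre s (len t).
Proof.
split=> [[r [Ht [n [p [/is_lenE [H1 H2] [-> E]]]]]]|[Hs [Ht [Hl E]]]].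
- rewrite exp2_S in H2.
  have [x Ex] := mle_diff H1.
  have Es : s = t * exp2 n + x by mlra.
  have [T1 T2] := len_bounds Ht.
  have Ls : len s = len t + n.
    apply: len_exp2; rewrite exp2_add.
    + have := mmul_le T1 (mlt_S (exp2 n)); mlra.
    + have : (t + 1) * exp2 n <= (exp2 (len t) + exp2 (len t)) * exp2 n.
        by apply: mmul_le; mlra.
      mlra.
  split.
    have := mmul_le (proj1 (mlt_le1 0 t) Ht) (proj1 (mlt_le1 0 _) (exp2_gt0 n)); mlra.
  split=> //; split; first by rewrite Ls; mlra.
  rewrite (pre_mdiv Ls); symmetry; apply: mdivP Es; mlra.
- have [k Ek] := mle_diff Hl; rewrite (pre_mdiv Ek) in E.
  have [x [Hx Ex]] := mdiv_spec s (exp2_gt0 k); rewrite -E in Ex.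
  exists (exp2 k + x); split=> //; exists k, (exp2 k); split; last by split=> //; mlra.
  by apply/is_lenE; rewrite exp2_S; mlra.
Qed.

(** ** Restrictions of sets *)

Definition restr (X : set_of M) n : M := prim_rec 1 (fun i s => s + s + indic (i \in X)) n.

Definition is_restr (X : set_of M) n s : Prop :=
  is_len s n /\ forall i, i < n -> (i \in X <-> exists t, is_len t i /\ prefix (t + t + 1) s).

Lemma restr0 X : restr X 0 = 1.
Proof. by apply: prim_rec0; defn. Qed.
Lemma restrS X n : restr X (n + 1) = restr X n + restr X n + indic (n \in X).
Proof. by apply: (@prim_recS M 1 (fun i s => s + s + indic (i \in X))); defn. Qed.

Lemma Df_restr (az : set_of M -> Prop) X : az X -> Df1 az (restr X).
Proof. by move=> HX f Hf; apply: Df_prim_rec; defn. Qed.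

Lemma indic_le1 (P : Prop) : indic P <= (1 : M).
Proof. case: (classic P) => H; rewrite ?(indic1 H) ?(indic0 H); mlra. Qed.

Lemma restr_len X n : 0 < restr X n /\ len (restr X n) = n.
Proof.
have D := @Df_restr al X I.
suff : is_len (restr X n) n by move/is_lenP.
apply/is_lenE; move: n; apply: m_ind; first by defn.
- by rewrite restr0 exp2_S exp2_0; mlra.
- move=> n [H1 H2]; rewrite restrS !exp2_S in H2 *.
  have := indic_le1 (n \in X); mlra.
Qed.

Lemma pre_S s i : 0 < s -> i < len s ->
  exists b, b <= 1 /\ pre s (i + 1) = pre s i + pre s i + b.
Proof.
move=> Hs Hi; have Hi' : i + 1 <= len s by mlra.
have [H1 H2] := pre_len Hs Hi'.
rewrite -(@pre_pre s (i + 1) i) //; first by mlra.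
rewrite (@pre_mdiv _ i 1) //.
have E2 : exp2 (1 : M) = 1 + 1 by have := exp2_S (0 : M); rewrite exp2_0 => <-; congr exp2; ring.
rewrite E2; have [x [Hx Ex]] := @mdiv_spec (pre s (i + 1)) (1 + 1) ltac:(have := @mlt01 M; mlra).
by exists x; split; [mlra|rewrite {1}Ex; ring].
Qed.

Lemma pre_restr X n i : i <= n -> pre (restr X n) i = restr X i.
Proof.
have D := @Df_restr al X I.
move: n i.
have K : forall n, pre (restr X (n + 1)) n = restr X n.
  move=> n; have [H1 H2] := restr_len X (n + 1).
  rewrite (@pre_mdiv _ n 1) //.
  have -> : exp2 (1 : M) = 1 + 1 by have := exp2_S (0 : M); rewrite exp2_0 => <-; congr exp2; ring.
  apply: (@mdivP _ _ _ (indic (n \in X))); first by have := indic_le1 (n \in X); mlra.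
  by rewrite restrS; ring.
move=> n i /mle_diff [d ->]; move: d.
apply: (m_ind (P := fun d => pre (restr X (i + d)) i = restr X i)).
- apply: Sg_eq; last by defn.
  rewrite /pre; apply: Df_mdiv; first by defn.
  apply: Df_exp2; apply: Df_msub; last by defn.
  have E d : len (restr X (i + d)) = i + d by case: (restr_len X (i + d)).
  apply: (Sg_ext (P := fun v => v 0%nat = i + v 1%nat)); last by defn.
  by move=> v; rewrite E.
- by rewrite madd0; have [H1 H2] := restr_len X i; rewrite -{2}H2 pre_id.
- move=> d IH; rewrite -maddA -IH -(K (i + d)).
  have [H1 H2] := restr_len X (i + d + 1).
  by rewrite pre_pre // ?H2; mlra.
Qed.

Lemma odd_even_neq x y b : b <= 1 -> x + x + 1 = y + y + b -> b = 1 /\ x = y.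
Proof.
move=> Hb E; case: (mlt_total x y) => [H|[H|H]]; [mlra|split; mlra|mlra].
Qed.

Lemma is_restrP X n s : is_restr X n s <-> s = restr X n.
Proof.
have D := @Df_restr al X I.
have L1 t i : is_len t i -> 0 < t + t + 1 /\ len (t + t + 1) = i + 1.
  move=> /is_lenE [H1 H2]; rewrite exp2_S in H2; split; first mlra.
  apply: len_exp2; rewrite !exp2_S; mlra.
split=> [[/is_lenP [Hs Hl] H]|->].
- suff : forall i, i <= n -> pre s i = restr X i.
    by move=> /(_ n (mlt_S n)) <-; rewrite -Hl pre_id.
  apply: m_ind.
  + apply: Sg_imp; first by defn.
    apply: Sg_eq; last by defn.
    by rewrite /pre; defn.
  + move=> _; rewrite restr0; have [H1 H2] := @pre_len s 0 Hs (mle0 _).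
    have [] := len_bounds H1; rewrite H2 exp2_0; mlra.
  + move=> i IH Hi; rewrite restrS -IH; first by mlra.
    have Hin : i < n by mlra.
    have Hil : i < len s by rewrite Hl.
    have [b [Hb Eb]] := pre_S Hs Hil.
    have [P1 P2] : 0 < pre s i /\ len (pre s i) = i by apply: pre_len => //; mlra.
    rewrite Eb; congr madd; apply/indic_eq.
    case: (classic (b = 1)) => Hb1; [left|right]; split=> //.
    * apply/(H i Hin); exists (pre s i); split; first by apply/is_lenP.
      have [L2 L3] := L1 (pre s i) i (proj2 (is_lenP _ _) (conj P1 P2)).
      apply/prefixP; split=> //; split=> //; rewrite L3; split; first mlra.
      by rewrite Eb Hb1.
    * move=> /(H i Hin) [t [Ht /prefixP [_ [_ [_ E]]]]].
      have [_ L3] := L1 t i Ht; rewrite L3 Eb in E.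
      by have [] := odd_even_neq Hb E.
    * by case: (proj1 (mle_lteq b 1) Hb) => [K|/Hb1 //]; mlra.
- have [H1 H2] := restr_len X n.
  split; first by apply/is_lenP.
  move=> i Hi; have E : pre (restr X n) (i + 1) = restr X (i + 1) by apply: pre_restr; mlra.
  have [R1 R2] := restr_len X i.
  split=> [HX|[t [Ht /prefixP [_ [_ [_ K]]]]]].
  + exists (restr X i); split; first by apply/is_lenP.
    have [L2 L3] := L1 (restr X i) i (proj2 (is_lenP _ _) (conj R1 R2)).
    apply/prefixP; split=> //; split=> //; rewrite L3 H2; split; first mlra.
    by rewrite E restrS indic1.
  + have [_ L3] := L1 t i Ht; rewrite L3 E restrS in K.
    have [Hb _] := odd_even_neq (indic_le1 _) K.
    by apply: NNPP => N; rewrite indic0 // in Hb; have := @mlt01 M; mlra.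
Qed.

(** ** Cardinalities *)

Definition is_card (A : M -> Prop) c : Prop :=
  exists s, (forall i, i < c -> exists x, x <= s /\ (mnth s i x /\ A x)) /\
    (forall i, i < c -> forall j, j < c -> forall x, x <= s -> mnth s i x /\ mnth s j x -> i = j) /\
    (forall x, A x -> exists i, i < c /\ mnth s i x).

(** From a listing, counting the pairs of a position and its entry yields both inequalities by
    [double_count]. Conversely, elements are listed by rank. *)
Lemma is_cardP (A : M -> Prop) n c : Sg1 al A -> Pi1 al A -> (forall x, A x -> x < n) ->
  (is_card A c <-> c = cnt A n).
Proof.
move=> SA PA Hn; split=> [[s [H1 [H2 H3]]]|->].
- have T1 : Sg1 al (fun _ : M => True) by defn.
  have T2 : Pi1 al (fun _ : M => True) by defn.
  have E : cnt (fun _ : M => True) c = c by apply: cnt_all.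
  have K1 : 1 * cnt (fun _ : M => True) c <= cnt A n.
    apply: (@double_count _ _ _ (fun i x => A x /\ mnth s i x)); [defn..| | |].
    + move=> i Hi _; have [x [_ [Hx Ax]]] := H1 i Hi.
      have : 0 < cnt (fun x => A x /\ mnth s i x) n.
        have := @cnt_lt M (fun x => A x /\ mnth s i x) ltac:(defn) ltac:(defn) n x (Hn x Ax) (conj Ax Hx).
        have := mle0 (cnt (fun x => A x /\ mnth s i x) x); mlra.
      mlra.
    + move=> i j x Hi Hj _ _ _ [_ Hx] [_ Hx'].
      by apply: (H2 i Hi j Hj x) => //; exact: mnth_le Hx.
    + by move=> i x _ _ _ [].
  have K2 : 1 * cnt A n <= cnt (fun _ : M => True) c.
    apply: (@double_count _ _ _ (fun x i => mnth s i x)); [defn..| | |by []].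
    + move=> x Hx /H3 [i [Hi Hix]].
      have := @cnt_lt M (fun i => mnth s i x) ltac:(defn) ltac:(defn) c i Hi Hix.
      have := mle0 (cnt (fun i => mnth s i x) i); mlra.
    + by move=> x y i _ _ _ _ _; exact: mnth_fun.
  rewrite E in K1 K2; mlra.
- have [|||s Hs] := @seq_of_rel M (fun i x => x < n /\ (A x /\ cnt A x = i)) (cnt A n).
  + by defn.
  + move=> i x y _ [Hx [Ax Ex]] [Hy [Ay Ey]]; case: (mlt_total x y) => [H|[//|H]].
    * have := cnt_lt SA PA H Ax; mlra.
    * have := cnt_lt SA PA H Ay; mlra.
  + by move=> i Hi; exact: cnt_rank.
  + exists s; split; [|split].
    * move=> i Hi; have [x [Hx [_ [Ax _]]]] := Hs i Hi; exists x; split=> //; exact: mnth_le Hx.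
    * move=> i Hi j Hj x _ [Hix Hjx].
      have [y [Hy [_ [_ Ey]]]] := Hs i Hi; have [z [Hz [_ [_ Ez]]]] := Hs j Hj.
      by rewrite -Ey -Ez -(mnth_fun Hix Hy) -(mnth_fun Hjx Hz).
    * move=> x Ax; have Hx := cnt_lt SA PA (Hn x Ax) Ax; exists (cnt A x); split=> //.
      have [y [Hy [Hyn [Ay Ey]]]] := Hs _ Hx.
      suff E : x = y by rewrite {2}E.
      case: (mlt_total x y) => [H|[//|H]].
      - have := cnt_lt SA PA H Ax; mlra.
      - have := cnt_lt SA PA H Ay; mlra.
Qed.
End StringTheory.

(** * Recursive functionals *)

Section Functionals.
Context {M : rca}.
Local Open Scope m_scope.
Implicit Types x y z i j m a b d e u w : M.
Notation al := (@allsets M).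

Add Ring mring : (@msemiring M).

Fixpoint mnum (k : nat) : M := match k with 0%nat => 0 | S k => mnum k + 1 end.

Definition op (k : nat) a b : M := pr (mnum k) (pr a b).

Lemma mnum_inj k l : mnum k = mnum l -> k = l.
Proof.
elim: k l => [|k IH] [|l] //= E; [mlra|mlra|rewrite (IH l) //; mlra].
Qed.

Lemma op_inj k a b l c d : op k a b = op l c d -> k = l /\ a = c /\ b = d.
Proof. by move=> /pr_inj [/mnum_inj -> /pr_inj [-> ->]]. Qed.

Lemma op_ge k a b : a <= op k a b /\ b <= op k a b.
Proof.
have := pr_ge_r (mnum k) (pr a b); have := pr_ge_l a b; have := pr_ge_r a b; rewrite /op; mlra.
Qed.

Definition occurs d k e x y : Prop := exists j, j < k /\ mnth d j (pr e (pr x y)).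

Definition justified (Z : set_of M) d k e x y : Prop :=
  (e = op 0 0 0 /\ y = 0) \/
  (e = op 1 0 0 /\ y = x + 1) \/
  (e = op 2 0 0 /\ y = x) \/
  (e = op 3 0 0 /\ exists v, v <= x /\ x = pr y v) \/
  (e = op 4 0 0 /\ exists v, v <= x /\ x = pr v y) \/
  (e = op 5 0 0 /\ ((x \in Z /\ y = 1) \/ (~ x \in Z /\ y = 0))) \/
  (exists a, a <= e /\ exists b, b <= e /\ (e = op 6 a b /\
     exists u, u <= y /\ exists v, v <= y /\
       (y = pr u v /\ (occurs d k a x u /\ occurs d k b x v)))) \/
  (exists a, a <= e /\ exists b, b <= e /\ (e = op 7 a b /\
     exists u, u <= d /\ (occurs d k a x u /\ occurs d k b u y))) \/
  (exists a, a <= e /\ exists b, b <= e /\ (e = op 8 a b /\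
     ((exists w, w <= x /\ (x = pr w 0 /\ occurs d k a w y)) \/
      (exists w, w <= x /\ exists n, n <= x /\ (x = pr w (n + 1) /\
         exists u, u <= d /\ (occurs d k e (pr w n) u /\
                    occurs d k b (pr (pr w n) u) y)))))) \/
  (exists a, a <= e /\ (e = op 9 a 0 /\
     (occurs d k a (pr x y) 0 /\
     forall z, z < y -> exists v, v <= d /\ occurs d k a (pr x z) (v + 1)))).

Definition deriv (Z : set_of M) d n : Prop :=
  forall k, k < n -> exists e, e <= d /\ exists x, x <= d /\ exists y, y <= d /\
    (mnth d k (pr e (pr x y)) /\ justified Z d k e x y).

Definition phi (Z : set_of M) e x y : Prop :=
  exists d n, deriv Z d n /\ occurs d n e x y.

(* [justified] without the bounds on its quantifiers, over any relation [O]
   of already computed values. *)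
Definition clause (Z : set_of M) (O : M -> M -> M -> Prop) (k : nat) e a b x y : Prop :=
  match k with
  | 0%nat => a = 0 /\ b = 0 /\ y = 0
  | 1%nat => a = 0 /\ b = 0 /\ y = x + 1
  | 2%nat => a = 0 /\ b = 0 /\ y = x
  | 3%nat => a = 0 /\ b = 0 /\ exists v, x = pr y v
  | 4%nat => a = 0 /\ b = 0 /\ exists v, x = pr v y
  | 5%nat => a = 0 /\ b = 0 /\ ((x \in Z /\ y = 1) \/ (~ x \in Z /\ y = 0))
  | 6%nat => exists u v, y = pr u v /\ O a x u /\ O b x v
  | 7%nat => exists u, O a x u /\ O b u y
  | 8%nat => (exists w, x = pr w 0 /\ O a w y) \/
         (exists w n u, x = pr w (n + 1) /\ O e (pr w n) u /\ O b (pr (pr w n) u) y)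
  | 9%nat => b = 0 /\ O a (pr x y) 0 /\ forall z, z < y -> exists v, O a (pr x z) (v + 1)
  | _ => False
  end.

Definition step Z O e x y : Prop := exists k a b, e = op k a b /\ clause Z O k e a b x y.

Lemma step_mono Z (O O' : M -> M -> M -> Prop) e x y :
  (forall e x y, O e x y -> O' e x y) -> step Z O e x y -> step Z O' e x y.
Proof.
move=> H [k [a [b [E C]]]]; exists k, a, b; split=> //.
case: k C {E} => [|[|[|[|[|[|[|[|[|[|k]]]]]]]]]] //=.
- by move=> [u [v [-> [H1 H2]]]]; exists u, v; auto.
- by move=> [u [H1 H2]]; exists u; auto.
- move=> [[w [-> H1]]|[w [n [u [-> [H1 H2]]]]]]; first by left; exists w; auto.
  by right; exists w, n, u; auto.
- move=> [Hb [H1 H2]]; split=> //; split; first by auto.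
  by move=> z /H2 [v Hv]; exists v; auto.
Qed.

Lemma occurs_le d k e x y : occurs d k e x y -> e <= d /\ x <= d /\ y <= d.
Proof.
move=> [j [_ /mnth_le]]; have := pr_ge_l e (pr x y); have := pr_ge_r e (pr x y).
have := pr_ge_l x y; have := pr_ge_r x y; mlra.
Qed.

Lemma occurs_mono d k l e x y : k <= l -> occurs d k e x y -> occurs d l e x y.
Proof. by move=> H [j [Hj K]]; exists j; split=> //; mlra. Qed.

(** The bounds, which make derivations Delta_1, hold automatically: components are at most their
    pair, and the entries of a sequence are at most its code. *)
Lemma justifiedP Z d k e x y : justified Z d k e x y <-> step Z (occurs d k) e x y.
Proof.
split.
- move=> [[-> H]|[[-> H]|[[-> H]|[[-> [v [_ H]]]|[[-> [v [_ H]]]|[[-> H]|[H|[H|[H|H]]]]]]]]].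
  + by exists 0%nat, 0, 0.
  + by exists 1%nat, 0, 0.
  + by exists 2%nat, 0, 0.
  + by exists 3%nat, 0, 0; split=> //=; split=> //; split=> //; exists v.
  + by exists 4%nat, 0, 0; split=> //=; split=> //; split=> //; exists v.
  + by exists 5%nat, 0, 0.
  + move: H => [a [_ [b [_ [-> [u [_ [v [_ [-> [H1 H2]]]]]]]]]]].
    by exists 6%nat, a, b; split=> //; exists u, v.
  + move: H => [a [_ [b [_ [-> [u [_ [H1 H2]]]]]]]].
    by exists 7%nat, a, b; split=> //; exists u.
  + move: H => [a [_ [b [_ [-> [[w [_ [-> H]]]|[w [_ [n [_ [-> [u [_ [H1 H2]]]]]]]]]]]]]].
    * by exists 8%nat, a, b; split=> //; left; exists w.
    * by exists 8%nat, a, b; split=> //; right; exists w, n, u.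
  + move: H => [a [_ [-> [H1 H2]]]].
    exists 9%nat, a, 0; split=> //; split=> //; split=> // z /H2 [v [_ Hv]]; by exists v.
- move=> [k' [a [b [E C]]]]; have [Ha Hb] := op_ge k' a b; rewrite -E in Ha Hb.
  case: k' E C => [|[|[|[|[|[|[|[|[|[|k']]]]]]]]]] E //= C.
  + by move: C E => [-> [-> ->]] ->; left.
  + by move: C E => [-> [-> ->]] ->; right; left.
  + by move: C E => [-> [-> ->]] ->; do 2 right; left.
  + move: C E => [-> [-> [v ->]]] ->; do 3 right; left; split=> //; exists v; split=> //; exact: pr_ge_r.
  + move: C E => [-> [-> [v ->]]] ->; do 4 right; left; split=> //; exists v; split=> //; exact: pr_ge_l.
  + by move: C E => [-> [-> C]] ->; do 5 right; left.
  + move: C => [u [v [-> [H1 H2]]]]; do 6 right; left.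
    exists a; split=> //; exists b; split=> //; split=> //; exists u; split; first exact: pr_ge_l.
    by exists v; split; first exact: pr_ge_r.
  + move: C => [u [H1 H2]]; do 7 right; left.
    exists a; split=> //; exists b; split=> //; split=> //; exists u; split=> //.
    by case: (occurs_le H1) => _ [].
  + do 8 right; left; exists a; split=> //; exists b; split=> //; split=> //.
    move: C => [[w [-> H]]|[w [n [u [-> [H1 H2]]]]]].
    * by left; exists w; split=> //; exact: pr_ge_l.
    * right; exists w; split; first exact: pr_ge_l.
      exists n; split; first by have := pr_ge_r w (n + 1); mlra.
      split=> //; exists u; split=> //; by case: (occurs_le H1) => _ [].
  + move: C E => [-> [H1 H2]] E; do 9 right.
    exists a; split=> //; split=> //; split=> // z /H2 [v Hv]; exists v; split=> //.
    have [_ [_ K]] := occurs_le Hv; mlra.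
Qed.
End Functionals.

Section FunctionalDef.
Context {M : rca} (al : set_of M -> Prop).
Local Open Scope m_scope.

Lemma Sg_occurs f g h k l : Df al f -> Df al g -> Df al h -> Df al k -> Df al l ->
  Sg al (fun v => @occurs M (f v) (g v) (h v) (k v) (l v)).
Proof. by rewrite /occurs; defn. Qed.
Lemma Pi_occurs f g h k l : Df al f -> Df al g -> Df al h -> Df al k -> Df al l ->
  Pi al (fun v => @occurs M (f v) (g v) (h v) (k v) (l v)).
Proof. by rewrite /occurs; defn. Qed.
End FunctionalDef.

Ltac defn_occurs :=
  first [ simple apply Sg_occurs | simple apply Pi_occurs ].
Ltac defn_named ::= first [ defn_seq | defn_sum | defn_string | defn_occurs ].

Section FunctionalDef2.
Context {M : rca} (al : set_of M -> Prop) (Z : set_of M).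
Hypothesis alZ : al Z.
Local Open Scope m_scope.

Lemma Sg_deriv : Sg2 al (deriv Z).
Proof. by rewrite /deriv /justified /op; defn. Qed.
Lemma Pi_deriv : Pi2 al (deriv Z).
Proof. by rewrite /deriv /justified /op; defn. Qed.
Lemma Sg_phi : Sg3 al (phi Z).
Proof. by have H := Sg_deriv; rewrite /phi; defn. Qed.
End FunctionalDef2.

Section FunctionalTheory.
Context {M : rca} (Z : set_of M).
Local Open Scope m_scope.
Implicit Types x y z i j m n a b d e u w : M.
Notation al := (@allsets M).

Add Ring mring : (@msemiring M).

Let SD : Sg2 al (deriv Z) := Sg_deriv (al := al) I.
Let PD : Pi2 al (deriv Z) := Pi_deriv (al := al) I.

Lemma deriv_intro d n :
  (forall k, k < n -> exists e x y, mnth d k (pr e (pr x y)) /\ step Z (occurs d k) e x y) ->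
  deriv Z d n.
Proof.
move=> H k /H [e [x [y [H1 H2]]]].
have [|He [Hx Hy]] := @occurs_le M d (k + 1) e x y; first by exists k; split=> //; exact: mlt_S.
exists e; split=> //; exists x; split=> //; exists y; split=> //; split=> //; exact/justifiedP.
Qed.

Lemma deriv_occurs d n e x y : deriv Z d n -> occurs d n e x y ->
  exists k, k < n /\ mnth d k (pr e (pr x y)) /\ step Z (occurs d k) e x y.
Proof.
move=> H [k [Hk Hn]]; exists k; split=> //; split=> //.
have [e' [_ [x' [_ [y' [_ [Hn' /justifiedP]]]]]]] := H k Hk.
by have [-> /pr_inj [-> ->]] := pr_inj (mnth_fun Hn Hn').
Qed.

(** There are two relations because the values to be compared stem from two derivations. *)
Lemma step_fun (O O' : M -> M -> M -> Prop) e x y y' :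
  (forall e x u u', O e x u -> O' e x u' -> u = u') ->
  step Z O e x y -> step Z O' e x y' -> y = y'.
Proof.
move=> H [k [a [b [E C]]]] [k' [a' [b' [E' C']]]].
have [Ek [Ea Eb]] := op_inj (eq_trans (esym E) E'); subst k' a' b'.
case: k E C E' C' => [|[|[|[|[|[|[|[|[|[|k]]]]]]]]]] E //= C _ C'.
- by move: C C' => [_ [_ ->]] [_ [_ ->]].
- by move: C C' => [_ [_ ->]] [_ [_ ->]].
- by move: C C' => [_ [_ ->]] [_ [_ ->]].
- by move: C C' => [_ [_ [v ->]]] [_ [_ [v' /pr_inj []]]].
- by move: C C' => [_ [_ [v ->]]] [_ [_ [v' /pr_inj []]]].
- by move: C C' => [_ [_ [[H1 ->]|[H1 ->]]]] [_ [_ [[H2 ->]|[H2 ->]]]].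
- by move: C C' => [u [v [-> [H1 H2]]]] [u' [v' [-> [/(H _ _ _ _ H1) -> /(H _ _ _ _ H2) ->]]]].
- by move: C C' => [u [H1 H2]] [u' [/(H _ _ _ _ H1) <- /(H _ _ _ _ H2)]].
- move: C C' => [[w [-> H1]]|[w [n [u [-> [H1 H2]]]]]] [[w' [E' H1']]|[w' [n' [u' [E' [H1' H2']]]]]].
  + by move/pr_inj: E' H1' => [<- _]; exact: H.
  + by have [_ K] := pr_inj E'; have := mle0 n'; mlra.
  + by have [_ K] := pr_inj E'; have := mle0 n; mlra.
  + have [K1 K2] := pr_inj E'; have K3 : n = n' by mlra.
    subst w' n'; move: H2'; rewrite -(H _ _ _ _ H1 H1'); exact: H.
- move: C C' => [_ [H1 H2]] [_ [H1' H2']]; case: (mlt_total y y') => [K|[//|K]].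
  + by have [v Hv] := H2' y K; have := H _ _ _ _ H1 Hv; have := mle0 v; mlra.
  + by have [v Hv] := H2 y' K; have := H _ _ _ _ Hv H1'; have := mle0 v; mlra.
Qed.

Lemma phi_fun e x y y' : phi Z e x y -> phi Z e x y' -> y = y'.
Proof.
move=> [d [n [D H]]] [d' [n' [D' H']]].
(* All variables are bounded by the two derivations, so the statement is Delta_1 and can be proved
   by induction on an initial part of the first one. *)
suff K : forall k, k <= n -> forall e, e <= d -> forall x, x <= d -> forall y, y <= d ->
   forall y', y' <= d' -> occurs d k e x y -> occurs d' n' e x y' -> y = y'.
  have [He [Hx Hy]] := occurs_le H; have [_ [_ Hy']] := occurs_le H'.
  exact: (K n (mlt_S n) e He x Hx y Hy y' Hy' H H').
move=> {e x y y' H H'}; apply: m_ind; first by defn.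
- by move=> _ e _ x _ y _ y' _ [j [Hj _]]; mlra.
- move=> k IH Hk e He x Hx y Hy y' Hy' H H'.
  have [j [Hj [_ S1]]] : exists j, j < k + 1 /\ mnth d j (pr e (pr x y)) /\ step Z (occurs d j) e x y.
    apply: deriv_occurs => // l Hl; apply: D; mlra.
  have [j' [Hj' [_ S2]]] := deriv_occurs D' H'.
  apply: step_fun S1 S2 => {e x y y' H H' He Hx Hy Hy'} e x y y' H H'.
  have [He [Hx Hy]] := occurs_le H; have [_ [_ Hy']] := occurs_le H'.
  apply: (IH _ e He x Hx y Hy y' Hy'); first by mlra.
  + by apply: occurs_mono H; mlra.
  + by apply: occurs_mono H'; mlra.
Qed.

Lemma deriv_extend d n e x y : deriv Z d n -> step Z (occurs d n) e x y -> phi Z e x y.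
Proof.
move=> D S.
have [|||s Hs] := @seq_of_rel M (fun i v => (i < n /\ mnth d i v) \/ (n <= i /\ v = pr e (pr x y))) (n + 1).
- by defn.
- move=> i u v _ [[H1 H2]|[H1 H2]] [[H3 H4]|[H3 H4]]; [exact: mnth_fun H2 H4|mlra|mlra|by rewrite H2 H4].
- move=> i Hi; case: (classic (i < n)) => [H|/mlt_nle H]; last by exists (pr e (pr x y)); right.
  by have [e' [_ [x' [_ [y' [_ [H' _]]]]]]] := D i H; exists (pr e' (pr x' y')); left.
have K i v : i < n -> mnth d i v -> mnth s i v.
  move=> Hi Hv; have [v' [Hv' [[_ H]|[H _]]]] := Hs i ltac:(mlra); last by mlra.
  by rewrite (mnth_fun Hv H).
have K' i e' x' y' : i <= n -> occurs d i e' x' y' -> occurs s i e' x' y'.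
  by move=> Hi [j [Hj H]]; exists j; split=> //; apply: K => //; mlra.
have Kn : mnth s n (pr e (pr x y)).
  by have [v [Hv [[H _]|[_ <- //]]]] := Hs n (mlt_S n); mlra.
exists s, (n + 1); split; last by exists n; split=> //; exact: mlt_S.
apply: deriv_intro => k /mle_lteq [Hk|Hk].
  have {}Hk : k < n by mlra.
  have [e' [_ [x' [_ [y' [_ [H /justifiedP H']]]]]]] := D k Hk.
  exists e', x', y'; split; first exact: K.
  by apply: step_mono H' => ? ? ?; apply: K'; mlra.
have -> : k = n by mlra.
exists e, x, y; split=> //; apply: step_mono S => ? ? ?; apply: K'; exact: mlt_S.
Qed.

(* Concatenates all derivations with code and length less than [K]: the [i]-th
   entry of derivation [d] with length [n] gets position [(d K + n) K + i]. *)
Lemma deriv_merge K : exists d n, deriv Z d n /\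
  forall d' n', d' < K -> n' < K -> deriv Z d' n' -> forall e x y, occurs d' n' e x y -> occurs d n e x y.
Proof.
case: (mnneg K) => HK; last by exists 0, 0; split=> [k|d' n']; mlra.
pose L : M := pr (op 0 0 0) (pr 0 0).
pose R j v := exists d, d < K /\ exists n, n < K /\ exists i, i < K /\ (j = (d * K + n) * K + i /\
  ((deriv Z d n /\ (i < n /\ mnth d i v)) \/ ((~ deriv Z d n \/ n <= i) /\ v = L))).
have Hpos d n i : d < K -> n < K -> i < K -> (d * K + n) * K + i < K * K * K.
  move=> Hd Hn Hi.
  have H1 : (d * K + n + 1) * K <= (K * K) * K.
    apply: mmul_le; last by mlra.
    have : (d + 1) * K <= K * K by apply: mmul_le; mlra.
    mlra.
  mlra.
have Hinj d n i d' n' i' : n < K -> i < K -> n' < K -> i' < K ->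
    (d * K + n) * K + i = (d' * K + n') * K + i' -> d = d' /\ n = n' /\ i = i'.
  move=> H1 H2 H3 H4 E; have E1 := div_unique H2 H4 E.
  have E2 := div_unique H1 H3 E1; subst d'; have E3 : n = n' by mlra.
  by subst n'; split=> //; split=> //; mlra.
have [|||s Hs] := @seq_of_rel M R (K * K * K).
- by rewrite /R; defn.
- move=> j u v _ [d [_ [n [Hn [i [Hi [-> H]]]]]]] [d' [_ [n' [Hn' [i' [Hi' [E H']]]]]]].
  have [Ed [En Ei]] := Hinj _ _ _ _ _ _ Hn Hi Hn' Hi' E; subst d' n' i'.
  case: H H' => [[H1 [H2 H3]]|[H1 H2]] [[H1' [H2' H3']]|[H1' H2']].
  + exact: mnth_fun H3 H3'.
  + by case: H1' => // H1'; mlra.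
  + by case: H1 => // H1; mlra.
  + by rewrite H2 H2'.
- move=> j Hj; have [i [q [Hi Ej]]] := mrem_exists j HK.
  have [n [d [Hn Eq]]] := mrem_exists q HK; subst q j.
  have Hd : d < K.
    apply: mlt_by_contra => H.
    have : K * K <= d * K by apply: mmul_le; mlra.
    move=> H'; have : (K * K) * K <= (d * K + n) * K by apply: mmul_le; mlra.
    mlra.
  have C : exists v, (deriv Z d n /\ (i < n /\ mnth d i v)) \/ ((~ deriv Z d n \/ n <= i) /\ v = L).
    case: (classic (deriv Z d n)) => D; last by exists L; right; split=> //; left.
    case: (classic (i < n)) => [H|/mlt_nle H]; last by exists L; right; split=> //; right.
    by have [e' [_ [x' [_ [y' [_ [H' _]]]]]]] := D i H; exists (pr e' (pr x' y')); left.
  by move: C => [v Hv]; exists v, d; split=> //; exists n; split=> //; exists i.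
have Hval d n i v : d < K -> n < K -> i < K -> deriv Z d n -> i < n -> mnth d i v ->
    mnth s ((d * K + n) * K + i) v.
  move=> Hd Hn Hi D Hin Hv.
  have [v' [Hv' [d' [_ [n' [Hn' [i' [Hi' [E H]]]]]]]]] := Hs _ (Hpos _ _ _ Hd Hn Hi).
  have [Ed [En Ei]] := Hinj _ _ _ _ _ _ Hn Hi Hn' Hi' E; subst d' n' i'.
  case: H => [[_ [_ H]]|[[//|H] _]]; last by mlra.
  by rewrite (mnth_fun Hv H).
exists s, (K * K * K); split; last first.
  move=> d n Hd Hn D e x y [i [Hi H]]; have HiK : i < K by mlra.
  exists ((d * K + n) * K + i); split; first exact: Hpos.
  exact: Hval.
apply: deriv_intro => j Hj; have [v [Hv [d [Hd [n [Hn [i [Hi [Ej [[D [Hin Hdi]]|[_ Ev]]]]]]]]]]] := Hs j Hj.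
- have [e [_ [x [_ [y [_ [H /justifiedP S]]]]]]] := D i Hin.
  exists e, x, y; rewrite (mnth_fun H Hdi); split=> //.
  apply: step_mono S => e' x' y' [i' [Hi' H']].
  exists ((d * K + n) * K + i'); split; first by rewrite Ej; mlra.
  apply: Hval => //; mlra.
- by exists (op 0 0 0), 0, 0; rewrite -/L -Ev; split=> //; exists 0%nat, 0, 0.
Qed.

(** Minimization has as many premises as its value, possibly a nonstandard number. Collection puts
    their derivations below one [K], and [deriv_merge] joins everything below [K]. *)
Lemma phi_step e x y : step Z (phi Z) e x y -> phi Z e x y.
Proof.
pose P K e x y := exists d, d < K /\ exists n, n < K /\ (deriv Z d n /\ occurs d n e x y).
have Pmono K K' e' x' y' : K <= K' -> P K e' x' y' -> P K' e' x' y'.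
  move=> H [d [Hd [n [Hn H']]]]; exists d; split; first by mlra.
  by exists n; split=> //; mlra.
have PK e' x' y' : phi Z e' x' y' -> exists K, P K e' x' y'.
  move=> [d [n [D H]]]; exists (d + n + 1), d; split; first by mlra.
  by exists n; split=> //; mlra.
have PK2 e1 x1 y1 e2 x2 y2 : phi Z e1 x1 y1 -> phi Z e2 x2 y2 ->
    exists K, P K e1 x1 y1 /\ P K e2 x2 y2.
  move=> /PK [K1 H1] /PK [K2 H2]; exists (K1 + K2).
  by split; [apply: Pmono H1|apply: Pmono H2]; mlra.
move=> [k [a [b [E C]]]].
suff [K HK] : exists K, clause Z (P K) k e a b x y.
  have [d [n [D H]]] := deriv_merge K.
  apply: (deriv_extend D); apply: (step_mono (O := P K)); last by exists k, a, b.
  by move=> e' x' y' [d' [Hd' [n' [Hn' [D' H']]]]]; apply: H D' _ _ _ H'.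
case: k E C => [|[|[|[|[|[|[|[|[|[|k]]]]]]]]]] E //= C; try by exists 0.
- move: C => [u [v [-> [H1 H2]]]]; have [K H] := PK2 _ _ _ _ _ _ H1 H2; by exists K, u, v.
- move: C => [u [H1 H2]]; have [K H] := PK2 _ _ _ _ _ _ H1 H2; by exists K, u.
- move: C => [[w [-> H1]]|[w [n [u [-> [H1 H2]]]]]].
  + by have [K H] := PK _ _ _ H1; exists K; left; exists w.
  + by have [K H] := PK2 _ _ _ _ _ _ H1 H2; exists K; right; exists w, n, u.
- move: C => [Eb [H1 H2]].
  have [||K HK] := @m_collection M (fun z K => exists v, P K a (pr x z) (v + 1)) y.
  + by rewrite /P; defn.
  + by move=> z /H2 [v /PK [K HK]]; exists K, v.
  have [K' HK'] := PK _ _ _ H1; exists (K + K'); split=> //; split.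
    by apply: Pmono HK'; mlra.
  move=> z /HK [K1 [HK1 [v Hv]]]; exists v; apply: Pmono Hv; mlra.
Qed.
End FunctionalTheory.

(** * Definable functions are recursive *)

Section Recursive.
Context {M : rca} (Z : set_of M).
Local Open Scope m_scope.
Implicit Types x y z a b d e u w : M.
Notation al := (@allsets M).

Add Ring mring : (@msemiring M).

Lemma phi_succ x : phi Z (op 1 0 0) x (x + 1).
Proof. by apply: phi_step; exists 1%nat, 0, 0. Qed.
Lemma phi_zero x : phi Z (op 0 0 0) x 0.
Proof. by apply: phi_step; exists 0%nat, 0, 0. Qed.
Lemma phi_id x : phi Z (op 2 0 0) x x.
Proof. by apply: phi_step; exists 2%nat, 0, 0. Qed.
Lemma phi_fst x y : phi Z (op 3 0 0) (pr x y) x.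
Proof. by apply: phi_step; exists 3%nat, 0, 0; split=> //; split=> //; split=> //; exists y. Qed.
Lemma phi_snd x y : phi Z (op 4 0 0) (pr x y) y.
Proof. by apply: phi_step; exists 4%nat, 0, 0; split=> //; split=> //; split=> //; exists x. Qed.
Lemma phi_oracle x : phi Z (op 5 0 0) x (indic (x \in Z)).
Proof.
apply: phi_step; exists 5%nat, 0, 0; split=> //; split=> //; split=> //.
by case: (classic (x \in Z)) => H; [left; rewrite indic1|right; rewrite indic0].
Qed.
Lemma phi_pair a b x u w : phi Z a x u -> phi Z b x w -> phi Z (op 6 a b) x (pr u w).
Proof. by move=> H1 H2; apply: phi_step; exists 6%nat, a, b; split=> //; exists u, w. Qed.
Lemma phi_comp a b x u y : phi Z a x u -> phi Z b u y -> phi Z (op 7 a b) x y.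
Proof. by move=> H1 H2; apply: phi_step; exists 7%nat, a, b; split=> //; exists u. Qed.

Lemma phi_rec a b w (F : M -> M) : Df1 al F -> phi Z a w (F 0) ->
  (forall n, phi Z b (pr (pr w n) (F n)) (F (n + 1))) -> forall n, phi Z (op 8 a b) (pr w n) (F n).
Proof.
move=> HF H0 HS; have HP := Sg_phi (al := al) (Z := Z) I.
apply: m_ind; first by defn.
- by apply: phi_step; exists 8%nat, a, b; split=> //; left; exists w.
- move=> n IH; apply: phi_step; exists 8%nat, a, b; split=> //; right; exists w, n, (F n).
  by split=> //; split=> //; apply: HS.
Qed.

Lemma phi_mu a x (F : M -> M) y : (forall z, phi Z a (pr x z) (F z)) -> F y = 0 ->
  (forall z, z < y -> 0 < F z) -> phi Z (op 9 a 0) x y.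
Proof.
move=> H H0 HS; apply: phi_step; exists 9%nat, a, 0; split=> //; split=> //; split; first by rewrite -H0.
move=> z /HS Hz; have [v Ev] := mlt_diff Hz; have [k Ek] := mle_diff (proj1 (mlt_le1 _ _) Hz).
by exists k; have -> : k + 1 = F z by rewrite Ek; ring.
Qed.

Definition computes1 e (F : M -> M) : Prop := forall x, phi Z e x (F x).
Definition computes2 e (F : M -> M -> M) : Prop := forall x y, phi Z e (pr x y) (F x y).

(** As [c] may be nonstandard, the index, a composition of [c] successors, is built by primitive
    recursion inside the model. *)
Lemma const_index c : exists e, computes1 e (fun _ => c).
Proof.
pose F : M -> M := prim_rec (op 0 0 0) (fun _ i => op 7 i (op 1 0 0)).
have HG : Df2 al (fun _ i : M => op 7 i (op 1 0 0)) by rewrite /op; defn.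
have HF : Df1 al F by move=> f Hf; apply: Df_prim_rec; rewrite /op; defn.
have HP := Sg_phi (al := al) (Z := Z) I.
exists (F c) => x; move: c; apply: m_ind; first by defn.
- by rewrite /F prim_rec0 //; apply: phi_zero.
- move=> n IH; rewrite /F prim_recS //; apply: phi_comp IH _; exact: phi_succ.
Qed.

Lemma add_index : exists e, computes2 e (fun x y => x + y).
Proof.
exists (op 8 (op 2 0 0) (op 7 (op 4 0 0) (op 1 0 0))) => x; apply: phi_rec.
- by defn.
- by rewrite madd0; apply: phi_id.
- by move=> n; rewrite -maddA; apply: phi_comp (phi_snd _ _) (phi_succ _).
Qed.

Lemma mul_index : exists e, computes2 e (fun x y => x * y).
Proof.
have [ea Ha] := add_index.
exists (op 8 (op 0 0 0) (op 7 (op 6 (op 4 0 0) (op 7 (op 3 0 0) (op 3 0 0))) ea)) => x; apply: phi_rec.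
- by defn.
- by rewrite mmul0; apply: phi_zero.
- move=> n; have -> : x * (n + 1) = x * n + x by ring.
  apply: phi_comp (Ha _ _); apply: phi_pair; first exact: phi_snd.
  by apply: phi_comp; apply: phi_fst.
Qed.

Lemma iszero_index : exists e, computes1 e (fun x => indic (x = 0)).
Proof.
have [e1 H1] := const_index 1.
exists (op 7 (op 6 (op 2 0 0) (op 2 0 0)) (op 8 e1 (op 0 0 0))) => x.
apply: (phi_comp (u := pr x x)); first by apply: phi_pair; apply: phi_id.
apply: (phi_rec (F := fun n => indic (n = 0))).
- by defn.
- by rewrite indic1.
- by move=> n; rewrite (@indic0 _ (n + 1 = 0)); [mlra|apply: phi_zero].
Qed.

Lemma sub_index : exists e, computes2 e (fun x y => msub x y).
Proof.
have [ep Hp] : exists e, computes1 e (fun x => msub x 1).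
  exists (op 7 (op 6 (op 2 0 0) (op 2 0 0)) (op 8 (op 0 0 0) (op 7 (op 3 0 0) (op 4 0 0)))) => x.
  apply: (phi_comp (u := pr x x)); first by apply: phi_pair; apply: phi_id.
  apply: (phi_rec (F := fun n => msub n 1)).
  - by defn.
  - have <- : 0 = msub 0 1 :> M by apply/msub_eq; right; split=> //; exact: mlt01.
    exact: phi_zero.
  - move=> n; have <- : n = msub (n + 1) 1 by apply/msub_eq; left; ring.
    by apply: phi_comp; [apply: phi_fst|apply: phi_snd].
exists (op 8 (op 2 0 0) (op 7 (op 4 0 0) ep)) => x; apply: phi_rec.
- by defn.
- have <- : x = msub x 0 by apply/msub_eq; left; ring.
  exact: phi_id.
- move=> n; have <- : msub (msub x n) 1 = msub x (n + 1).
    apply/msub_eq; case: (classic (x < n + 1)) => [H|/mlt_nle H].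
    + right; split=> //; symmetry; apply/msub_eq; right; split=> //.
      by have := proj1 (msub_eq x n _) erefl; case=> [|[]]; mlra.
    + left; have E := msubK (a := x) (b := n) ltac:(mlra).
      have E' := msubK (a := msub x n) (b := 1) ltac:(mlra); mlra.
  exact: phi_comp (phi_snd _ _) (Hp _).
Qed.

(** ** Compilation of bounded formulas *)

(** Variable 0 is the outermost component, so entering a quantifier amounts to one pairing. *)
Fixpoint tup (n : nat) (v : nat -> M) : M :=
  match n with 0%nat => 0 | S n => pr (tup n (fun i => v (S i))) (v 0%nat) end.

Definition env_computes (n : nat) e (f : (nat -> M) -> M) : Prop := forall v, phi Z e (tup n v) (f v).
Definition env_computable (n : nat) (f : (nat -> M) -> M) : Prop := exists e, env_computes n e f.

Lemma env_const n c : env_computable n (fun _ => c).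
Proof. by have [e He] := const_index c; exists e => v; apply: He. Qed.

Lemma env_var n i : (i < n)%nat -> env_computable n (fun v => v i).
Proof.
elim: n i => [|n IH] i Hi; first lia.
case: i Hi => [|i] Hi; first by exists (op 4 0 0) => v; apply: phi_snd.
have [|e He] := IH i; first lia.
exists (op 7 (op 3 0 0) e) => v.
by apply: phi_comp (phi_fst _ _) _; apply: (He (fun i => v (S i))).
Qed.

Lemma env_comp1 n f (F : M -> M) : (exists e, computes1 e F) -> env_computable n f ->
  env_computable n (fun v => F (f v)).
Proof. by move=> [e He] [e' He']; exists (op 7 e' e) => v; apply: phi_comp (He' _) (He _). Qed.

Lemma env_comp2 n f g (F : M -> M -> M) : (exists e, computes2 e F) -> env_computable n f ->
  env_computable n g -> env_computable n (fun v => F (f v) (g v)).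
Proof.
move=> [e He] [ef Hf] [eg Hg]; exists (op 7 (op 6 ef eg) e) => v.
by apply: phi_comp (He _ _); apply: phi_pair.
Qed.

Lemma env_ext n f g : (forall v, f v = g v) -> env_computable n f -> env_computable n g.
Proof. by move=> E [e He]; exists e => v; rewrite -E. Qed.

Lemma env_term n (t : pterm M) : (ptbound t <= n)%nat -> env_computable n (fun v => peval v t).
Proof.
elim: t => [i|c|t It u Iu|t It u Iu] /= H.
- exact: env_var.
- exact: env_const.
- apply: env_comp2 add_index _ _; [apply: It|apply: Iu]; lia.
- apply: env_comp2 mul_index _ _; [apply: It|apply: Iu]; lia.
Qed.

Lemma env_not n (P : (nat -> M) -> Prop) : env_computable n (fun v => indic (P v)) ->
  env_computable n (fun v => indic (~ P v)).
Proof.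
move=> H; apply: env_ext (env_comp1 iszero_index H) => v.
case: (classic (P v)) => K.
- by rewrite (indic1 K) (@indic0 _ (~ P v)) ?(@indic0 _ (1 = 0 :> M)) //; have := @mlt01 M; mlra.
- by rewrite (indic0 K) !indic1.
Qed.

Lemma env_and n (P Q : (nat -> M) -> Prop) : env_computable n (fun v => indic (P v)) ->
  env_computable n (fun v => indic (Q v)) -> env_computable n (fun v => indic (P v /\ Q v)).
Proof.
move=> H H'; apply: env_ext (env_comp2 mul_index H H') => v.
case: (classic (P v)) => K; last by rewrite (indic0 K) (@indic0 _ (P v /\ Q v)); [tauto|ring].
case: (classic (Q v)) => K'; first by rewrite (indic1 K) (indic1 K') (@indic1 _ (P v /\ Q v)) //; ring.
by rewrite (indic0 K') (@indic0 _ (P v /\ Q v)); [tauto|ring].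
Qed.

Lemma indic_ext (P Q : Prop) : (P <-> Q) -> indic P = indic Q :> M.
Proof. by move=> E; apply/indic_eq; rewrite -E; apply/indic_eq. Qed.

Lemma env_iff n (P Q : (nat -> M) -> Prop) : (forall v, P v <-> Q v) ->
  env_computable n (fun v => indic (P v)) -> env_computable n (fun v => indic (Q v)).
Proof. by move=> E; apply: env_ext => v; apply: indic_ext. Qed.

(** The truth value is the product of the truth values below the bound, computed by primitive
    recursion with the environment as parameter. *)
Lemma env_ball n (t : pterm M) (A : pform M) : env_computable n (fun v => peval v t) ->
  env_computable (S n) (fun v => indic (psat v A)) ->
  env_computable n (fun v => indic (forall x, x < peval v t -> psat (scons x v) A)).
Proof.
move=> [et Ht] [eA HA]; have [em Hm] := mul_index; have [e1 H1] := const_index 1.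
exists (op 7 (op 6 (op 2 0 0) et) (op 8 e1 (op 7 (op 6 (op 4 0 0) (op 7 (op 3 0 0) eA)) em))) => v.
apply: phi_comp; first by apply: phi_pair; [apply: phi_id|apply: Ht].
have S1 : Sg1 al (fun x => psat (scons x v) A).
  apply: (Sg1_fix (al := al) (P := fun v x => psat (scons x v) A)); apply: Sg_D0.
  exists A; split=> [|e]; last by rewrite scons_eta.
  by elim: (A) => //=.
have P1 : Pi1 al (fun x => psat (scons x v) A).
  apply: (Sg1_fix (al := al) (P := fun v x => ~ psat (scons x v) A)); apply: Pi_D0.
  exists A; split=> [|e]; last by rewrite scons_eta.
  by elim: (A) => //=.
apply: (phi_rec (F := fun m => indic (forall x, x < m -> psat (scons x v) A))).
- by defn.
- by rewrite indic1 => // x; mlra.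
- move=> m; set I := indic (forall x, x < m -> _).
  have -> : indic (forall x, x < m + 1 -> psat (scons x v) A) = I * indic (psat (scons m v) A).
    rewrite /I; case: (classic (psat (scons m v) A)) => K; last first.
      by rewrite (indic0 K) mmul0 indic0 // => H; apply: K; apply: H; exact: mlt_S.
    rewrite (indic1 K) mmul1; apply: indic_ext; split=> H x Hx; first by apply: H; mlra.
    case: (proj1 (mle_lteq x m) Hx) => [|->] //; exact: H.
  apply: phi_comp (Hm _ _); apply: phi_pair; first exact: phi_snd.
  apply: phi_comp (phi_fst _ _) _; exact: (HA (scons m v)).
Qed.

Lemma compile_form (A : pform M) n : psets (eq Z) A -> (pbound A <= n)%nat ->
  env_computable n (fun v => indic (psat v A)).
Proof.
elim: A n => [t u|t u|t X||A IA B IB|A IA B IB|A IA B IB|t A IA|t A IA] n; cbn [psets pbound psat].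
- move=> _ H.
  have Ht := @env_term n t ltac:(lia); have Hu := @env_term n u ltac:(lia).
  have := env_comp1 iszero_index (env_comp2 add_index (env_comp2 sub_index Ht Hu) (env_comp2 sub_index Hu Ht)).
  apply: env_iff => v.
  have := proj1 (msub_eq (peval v t) (peval v u) _) erefl.
  have := proj1 (msub_eq (peval v u) (peval v t) _) erefl.
  move=> [E1|[E1 E1']] [E2|[E2 E2']]; split=> E; mlra.
- move=> _ H.
  have Ht := @env_term n t ltac:(lia); have Hu := @env_term n u ltac:(lia).
  have := env_comp1 iszero_index (env_comp1 iszero_index (env_comp2 sub_index Hu Ht)).
  apply: env_iff => v.
  have := proj1 (msub_eq (peval v u) (peval v t) _) erefl.
  case: (classic (msub (peval v u) (peval v t) = 0)) => K.
  + rewrite (indic1 K) => E; split=> E'; case: E => [|[]]; have := @mlt01 M; mlra.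
  + rewrite (indic0 K) => E; split=> // _; case: E => [E|[]] //.
    by case: (mnneg (msub (peval v u) (peval v t))) => [|/esym //]; mlra.
- move=> <- H; apply: (env_comp1 (F := fun x => indic (x \in Z))); last exact: env_term.
  by exists (op 5 0 0) => x; apply: phi_oracle.
- move=> _ _; apply: env_ext (env_const n 0) => v; by rewrite indic0.
- move=> [HA HB] H.
  apply: (env_iff (P := fun v => ~ (psat v A /\ ~ psat v B))); first by move=> v; tauto.
  apply: env_not; apply: env_and; first by apply: IA => //; lia.
  by apply: env_not; apply: IB => //; lia.
- by move=> [HA HB] H; apply: env_and; [apply: IA|apply: IB] => //; lia.
- move=> [HA HB] H.
  apply: (env_iff (P := fun v => ~ (~ psat v A /\ ~ psat v B))); first by move=> v; tauto.
  by apply: env_not; apply: env_and; apply: env_not; [apply: IA|apply: IB] => //; lia.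
- move=> HA H; apply: env_ball; first by apply: env_term; lia.
  by apply: IA => //; lia.
- move=> HA H.
  apply: (env_iff (P := fun v => ~ forall x, x < peval v t -> psat (scons x v) (PImp A (PBot (M := M))))).
    move=> v; split=> [N|[x [Hx H']] N]; last exact: N Hx H'.
    by apply: NNPP => N'; apply: N => x Hx /= H'; apply: N'; exists x.
  apply: env_not; apply: env_ball; first by apply: env_term; lia.
  by apply: (env_not (P := fun v => psat v A)); apply: IA => //; lia.
Qed.

Lemma mu_index (Q : M -> M -> Prop) : D0 (eq Z) (fun v => Q (v 0%nat) (v 1%nat)) ->
  exists e, forall x, (exists y, Q y x) -> exists y, Q y x /\ phi Z e x y.
Proof.
move=> [A [HA E]].
have HQ : Pi2 al Q.
  by apply: Pi2I; apply: (Sg_all_sets (al := eq Z)); apply: Sg_D0; apply: D0_not; exists A.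
have [e He] := compile_form (n := S (S (pbound A))) HA ltac:(lia).
have {}He x y : phi Z e (pr (pr (tup (pbound A) (fun _ => 0)) x) y) (indic (Q y x)).
  by have := He (scons y (scons x (fun _ => 0))); rewrite (indic_ext (E _)).
have [ec Hc] := const_index (tup (pbound A) (fun _ => 0)).
have [ez Hz] := iszero_index.
exists (op 9 (op 7 (op 7 (op 6 (op 6 ec (op 3 0 0)) (op 4 0 0)) e) ez) 0) => x [y0 Qy0].
have [|y [Qy Ny]] := @m_least M (fun y => Q y x) y0 _ Qy0; first by defn.
exists y; split=> //; apply: (phi_mu (F := fun z => indic (indic (Q z x) = 0 :> M))).
- move=> z; apply: phi_comp (Hz _); apply: phi_comp (He _ _).
  apply: phi_pair; last exact: phi_snd.
  by apply: phi_pair; [exact: Hc|exact: phi_fst].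
- by rewrite (indic1 Qy); apply: indic0; have := @mlt01 M; mlra.
- by move=> z /Ny K; rewrite (indic0 K) indic1 //; exact: mlt01.
Qed.

(* The value is found by two successive searches: for a bound [c] on the value
   and on the Sigma_1 witness, then for the value below [c]. *)
Lemma graph_index (P : M -> M -> Prop) : Sg (eq Z) (fun v => P (v 0%nat) (v 1%nat)) ->
  (forall x y y', P x y -> P x y' -> y = y') -> exists e, forall x y, P x y -> phi Z e x y.
Proof.
move=> [A [HA E]] Pfun; pose z0 : nat -> M := fun _ => 0.
have {}E x y : P x y <-> exists a, psat (scons a (scons x (scons y z0))) A by rewrite E.
pose Q1 c x := exists y, y < c + 1 /\ exists a, a < c + 1 /\ psat (scons a (scons x (scons y z0))) A.
pose Q2 y p := exists x, x < p + 1 /\ exists c, c < p + 1 /\ (p = (x + c) * (x + c) + x /\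
  exists a, a < c + 1 /\ psat (scons a (scons x (scons y z0))) A).
have HD : D0 (eq Z) (fun v => psat v A) by exists A.
have [|e1 H1] := @mu_index Q1.
  apply: (D0_bex (P := fun v y => exists a, a < v 0%nat + 1 /\ psat (scons a (scons (v 1%nat) (scons y z0))) A)
    (PAdd (PVar 0) (PConst 1))).
  apply: (D0_bex (P := fun v a => psat (scons a (scons (v 2%nat) (scons (v 0%nat) z0))) A) (PAdd (PVar 1) (PConst 1))).
  apply: D0_ext (D0_subst (fun n => match n with 0 => PVar 0 | 1 => PVar 3 | 2 => PVar 1 | _ => PConst 0 end)%nat HD) => v.
  have -> : (fun n => peval v (match n with 0 => PVar 0 | 1 => PVar 3 | 2 => PVar 1 | _ => PConst 0 end)%nat) =
    scons (v 0%nat) (scons (v 3%nat) (scons (v 1%nat) z0)) by apply: functional_extensionality => -[|[|[|]]].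
  done.
have [|e2 H2] := @mu_index Q2.
  apply: (D0_bex (P := fun v x => exists c, c < v 1%nat + 1 /\ (v 1%nat = (x + c) * (x + c) + x /\
    exists a, a < c + 1 /\ psat (scons a (scons x (scons (v 0%nat) z0))) A)) (PAdd (PVar 1) (PConst 1))).
  apply: (D0_bex (P := fun v c => v 2%nat = (v 0%nat + c) * (v 0%nat + c) + v 0%nat /\
    exists a, a < c + 1 /\ psat (scons a (scons (v 0%nat) (scons (v 1%nat) z0))) A) (PAdd (PVar 2) (PConst 1))).
  apply: D0_and.
    by exists (PEq (PVar 3) (PAdd (PMul (PAdd (PVar 1) (PVar 0)) (PAdd (PVar 1) (PVar 0))) (PVar 1))).
  apply: (D0_bex (P := fun v a => psat (scons a (scons (v 1%nat) (scons (v 2%nat) z0))) A) (PAdd (PVar 0) (PConst 1))).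
  apply: D0_ext (D0_subst (fun n => match n with 0 => PVar 0 | 1 => PVar 2 | 2 => PVar 3 | _ => PConst 0 end)%nat HD) => v.
  have -> : (fun n => peval v (match n with 0 => PVar 0 | 1 => PVar 2 | 2 => PVar 3 | _ => PConst 0 end)%nat) =
    scons (v 0%nat) (scons (v 2%nat) (scons (v 3%nat) z0)) by apply: functional_extensionality => -[|[|[|]]].
  done.
exists (op 7 (op 6 (op 2 0 0) e1) e2) => x y Pxy; have [a Ha] := proj1 (E x y) Pxy.
have [|c [[y1 [Hy1 [a1 [Ha1 K1]]]] Hc]] := H1 x.
  by exists (y + a), y; split; [mlra|exists a; split; [mlra|]].
have [|y2 [[x' [_ [c' [_ [/pr_inj [<- _] [a2 [_ K2]]]]]]] Hy2]] := H2 (pr x c).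
  exists y1, x; split; first exact: pr_ge_l.
  by exists c; split; [exact: pr_ge_r|split=> //; exists a1].
have -> : y = y2 by apply: (Pfun x) => //; apply/E; exists a2.
by apply: phi_comp Hy2; apply: phi_pair; first exact: phi_id.
Qed.
End Recursive.

(** * Incompressibility implies 2-randomness *)

Section LenDef.
Context {M : rca} (al : set_of M -> Prop).
Local Open Scope m_scope.

Lemma Df_len : Df1 al (@len M).
Proof. by apply: Df1I; apply: Sg_ext => [v|]; [exact: iff_sym (len_eq _ _)|defn]. Qed.
Lemma Df_pre : Df2 al (@pre M).
Proof. by have H := Df_len; rewrite /pre; defn. Qed.
End LenDef.

Ltac defn_prefix :=
  first [ simple apply Df_len | simple apply Df_pre ].
Ltac defn_named ::= first [ defn_seq | defn_sum | defn_string | defn_occurs | defn_prefix ].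

(** * Counting strings of a given length *)

Section Levels.
Context {M : rca}.
Local Open Scope m_scope.
Implicit Types x y z i j k m n a b c d e p q r s t u w : M.
Notation al := (@allsets M).

Add Ring mring : (@msemiring M).

Lemma cnt_div (P : M -> Prop) k n : Sg1 al P -> Pi1 al P -> 0 < k ->
  cnt (fun y => P (mdiv y k)) (n * k) = k * cnt P n.
Proof.
move=> SP PP Hk; move: n; apply: m_ind; first by defn.
- by rewrite cnt0 // mmulC !mmul0 cnt0 //; defn.
- move=> n IH; have -> : (n + 1) * k = n * k + k by ring.
  rewrite cnt_split; [defn|defn|]; rewrite IH.
  have Hd i : i < k -> mdiv (n * k + i) k = n by move=> Hi; apply: mdivP Hi _.
  case: (classic (P n)) => H.
  + have -> : cnt (fun i => P (mdiv (n * k + i) k)) k = k by apply: cnt_all; [defn|defn|move=> i /Hd ->].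
    by rewrite cntS1 //; ring.
  + have -> : cnt (fun i => P (mdiv (n * k + i) k)) k = 0 by apply: cnt_eq0; [defn|defn|move=> i /Hd ->].
    by rewrite cntS0 //; ring.
Qed.

Lemma is_len_mdiv y n d : is_len (mdiv y (exp2 d)) n <-> is_len y (n + d).
Proof.
have [x [Hx Ex]] := mdiv_spec y (exp2_gt0 d); set q := mdiv y (exp2 d) in Ex *.
have E1 := exp2_add n d; have E2 := exp2_add (n + 1) d.
have E3 : n + d + 1 = n + 1 + d by ring.
rewrite !is_lenE E3 E1 E2; split=> -[H1 H2]; split.
- have := mmul_le H1 (mlt_S (exp2 d)); mlra.
- have : (q + 1) * exp2 d <= exp2 (n + 1) * exp2 d by apply: mmul_le; mlra.
  mlra.
- apply: mlt_by_contra => H.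
  have : (q + 1) * exp2 d <= exp2 n * exp2 d by apply: mmul_le; mlra.
  mlra.
- apply: mlt_by_contra => H.
  have := mmul_le H (mlt_S (exp2 d)); mlra.
Qed.

(** The codes of the strings of length [n] fill the interval from [2^n] to [2^(n+1)]. Divided by
    [2^n], this count is the measure of [P] seen at length [n]. *)
Definition level (P : M -> Prop) n : M := cnt (fun s => is_len s n /\ P s) (exp2 (n + 1)).

Lemma level_lift (P : M -> Prop) n d : Sg1 al P -> Pi1 al P ->
  level (fun y => P (pre y n)) (n + d) = exp2 d * level P n.
Proof.
move=> SP PP; rewrite /level -cnt_div; [defn|defn|exact: exp2_gt0|].
have -> : exp2 (n + d + 1) = exp2 (n + 1) * exp2 d by rewrite -exp2_add; congr exp2; ring.
apply: cnt_ext; [defn..|].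
move=> y _; rewrite is_len_mdiv; split=> -[H H']; split=> //; move/is_lenP: H => [_ E].
- by rewrite -(pre_mdiv E).
- by rewrite (pre_mdiv E).
Qed.

Lemma level_sub (P Q : M -> Prop) n : Sg1 al P -> Pi1 al P -> Sg1 al Q -> Pi1 al Q ->
  (forall s, is_len s n -> P s -> Q s) -> level P n <= level Q n.
Proof.
by move=> *; apply: cnt_sub; [defn..|move=> s _ [Hs Ps]; split; auto].
Qed.

Lemma level_ext (P Q : M -> Prop) n : Sg1 al P -> Pi1 al P -> Sg1 al Q -> Pi1 al Q ->
  (forall s, is_len s n -> P s <-> Q s) -> level P n = level Q n.
Proof.
by move=> SP PP SQ PQ H; apply: cnt_ext; [defn..|move=> s _; split=> -[Hs Ps]; split=> //; apply/(H s Hs)].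
Qed.

Lemma level_or (P Q : M -> Prop) n : Sg1 al P -> Pi1 al P -> Sg1 al Q -> Pi1 al Q ->
  level (fun s => P s \/ Q s) n <= level P n + level Q n.
Proof.
move=> SP PP SQ PQ; rewrite /level.
have := @cnt_or M (fun s => is_len s n /\ P s) (fun s => is_len s n /\ Q s) (exp2 (n + 1))
  ltac:(defn) ltac:(defn) ltac:(defn) ltac:(defn).
have <- : cnt (fun s => is_len s n /\ (P s \/ Q s)) (exp2 (n + 1)) =
  cnt (fun i => (is_len i n /\ P i) \/ (is_len i n /\ Q i)) (exp2 (n + 1)); last by [].
by apply: cnt_ext; [defn..|move=> s _; tauto].
Qed.

Lemma is_len_lt s n : is_len s n -> s < exp2 (n + 1).
Proof. by move/is_lenE=> []. Qed.

End Levels.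

(** * The universal machine, tests and compression *)

Section Machines.
Context {M : rca} (Z : set_of M).
Local Open Scope m_scope.
Implicit Types x y z i j k m n a b c d e p q r s t u w : M.
Notation al := (@allsets M).

Add Ring mring : (@msemiring M).

Definition univ t s : Prop :=
  0 < s /\ exists e p r, p = exp2 e /\ cat (p + p + 1) r t /\ phi Z e r s.
Definition complexity_lt s n : Prop := exists t l, is_len t l /\ l < n /\ univ t s.

(** [0^e 1] has code [2^(e+1) + 1]; on concatenation its last digit takes over the place of the
    leading 1 of [r], which leaves [2^(e+1+l) + r]. The index costs [e + 1] digits. *)
Lemma univ_intro e r s l : 0 < s -> is_len r l -> phi Z e r s ->
  univ (exp2 (e + 1 + l) + r) s /\ is_len (exp2 (e + 1 + l) + r) (e + 1 + l).
Proof.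
move=> Hs Hr Hp.
have Hlt : exp2 (l + 1) <= exp2 (e + 1 + l) by apply: exp2_le; mlra.
split; last by have := is_len_lt Hr; rewrite is_lenE (exp2_S (e + 1 + l)); mlra.
split=> //; exists e, (exp2 e), r; split=> //; split=> //; split; first by mlra.
by exists l, (exp2 l); split=> //; split=> //; rewrite exp2_add exp2_S; ring.
Qed.

Lemma univ_inv t s : univ t s -> 0 < s /\ exists e r l, is_len r l /\ phi Z e r s /\
  t = exp2 (e + 1 + l) + r /\ is_len t (e + 1 + l).
Proof.
move=> [Hs [e [p [r [-> [[_ [l [q [Hl [-> E]]]]] Hp]]]]]]; split=> //; exists e, r, l; split=> //; split=> //.
have Et : t = exp2 (e + 1 + l) + r by rewrite exp2_add exp2_S; mlra.
by split=> //; rewrite Et; have [_] := univ_intro Hs Hl Hp.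
Qed.

Lemma univ_fun t s s' : univ t s -> univ t s' -> s = s'.
Proof.
move=> /univ_inv [_ [e [r [l [Hr [Hp [E Ht]]]]]]] /univ_inv [_ [e' [r' [l' [Hr' [Hp' [E' Ht']]]]]]].
have El := is_len_fun Ht Ht'.
have Er : r = r' by rewrite -El in E'; mlra.
subst r'; have Ell := is_len_fun Hr Hr'; subst l'.
have Ee : e = e' by mlra.
subst e'; exact: phi_fun Hp Hp'.
Qed.

Definition io_inc (X : set_of M) : Prop :=
  exists b, forall m0, exists m, m0 <= m /\
    exists s, is_restr X m s /\ forall n, n + b = m -> ~ complexity_lt s n.

Definition turing_le (X : set_of M) : Prop :=
  exists e, forall x, (x \in X -> phi Z e x 1) /\ (~ x \in X -> phi Z e x 0).

Definition is_tree (T : M -> Prop) : Prop :=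
  forall s, T s -> 0 < s /\ forall t, prefix t s -> T t.

Definition in_sigma2 (X : set_of M) (T : M -> M -> Prop) : Prop :=
  exists i, forall n, exists s, is_restr X n s /\ T i s.

Definition measure_le (T : M -> M -> Prop) a b : Prop :=
  forall i, exists n p c, p = exp2 n /\ is_card (fun s => is_len s n /\ exists j, j <= i /\ T j s) c /\
    c * b <= a * p.

Definition tree_at (W : set_of M) n i s : Prop := pr n (pr i s) \in W.

Definition sigma2_test (W : set_of M) : Prop :=
  turing_le W /\ (forall n i, is_tree (tree_at W n i)) /\
  (forall n, exists p, p = exp2 n /\ measure_le (tree_at W n) 1 p).

Definition two_rand (X : set_of M) : Prop :=
  forall W, sigma2_test W -> ~ (forall n, in_sigma2 X (tree_at W n)).

Section Compression.
Variables (inW : M -> Prop).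
Hypotheses (SW : Sg1 (eq Z) inW) (PW : Pi1 (eq Z) inW).

Let approx n i s : Prop := exists j, j <= i /\ inW (pr n (pr j s)).

Let SA : Sg3 (eq Z) approx.
Proof. by rewrite /approx; defn. Qed.
Let PA : Pi3 (eq Z) approx.
Proof. by rewrite /approx; defn. Qed.

(** The counting lemmas are stated for all set parameters, while the machine must be definable from
    [Z] alone; so both versions are kept. *)
Let SA' : Sg3 al approx.
Proof. by apply: Sg3I; apply: (Sg_all_sets (al := eq Z)); defn. Qed.
Let PA' : Pi3 al approx.
Proof. by apply: Pi3I; apply: (Sg_all_sets (al := eq Z)); apply: PA; defn. Qed.

Let ranked n i m s : Prop := is_len s m /\ approx n i s.

(* A program [0^c 1 t] with [t] of length [l] denotes the [t]-th string of
   length [l + 2 c] in the largest approximation having at most [2^l] of them. *)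
Let machine r s : Prop := exists c l t m i,
  r = exp2 (c + 1 + l) + t /\ is_len t l /\ m = l + (c + c) /\ i <= m /\
  level (approx (c + c) i) m <= exp2 l /\
  (i = m \/ exp2 l < level (approx (c + c) (i + 1)) m) /\
  ranked (c + c) i m s /\ t = exp2 l + cnt (ranked (c + c) i m) s.

Let level_mono n i j m : i <= j -> level (approx n i) m <= level (approx n j) m.
Proof.
move=> H; apply: level_sub; [defn..|].
by move=> s _ [k [Hk Wk]]; exists k; split=> //; mlra.
Qed.

(** Decoding: the length of the program is [c + 1 + l], the rest after the leading part is [t], and
    its length [l] gives [c]. The stage [i] is unique because the counts grow with it, and the
    string because ranks increase strictly. *)
Let machine_fun r s s' : machine r s -> machine r s' -> s = s'.
Proof.
move=> [c [l [t [m [i [-> [Ht [-> [Hi [H1 [H2 [H3 H4]]]]]]]]]]]].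
move=> [c' [l' [t' [m' [i' [E [Ht' [-> [Hi' [H1' [H2' [H3' H4']]]]]]]]]]]].
have K c0 l0 t0 : is_len t0 l0 -> is_len (exp2 (c0 + 1 + l0) + t0) (c0 + 1 + l0).
  move=> /is_len_lt Hl; have : exp2 (l0 + 1) <= exp2 (c0 + 1 + l0) by apply: exp2_le; mlra.
  by rewrite is_lenE (exp2_S (c0 + 1 + l0)); mlra.
have El : c + 1 + l = c' + 1 + l'.
  by apply: is_len_fun (K _ _ _ Ht) _; rewrite E; apply: K.
have Et : t = t' by rewrite El in E; mlra.
rewrite -Et in Ht' H4'; have Ell := is_len_fun Ht Ht'.
rewrite -Ell in El H1' H2' H3' H4' Hi'; have Ec : c = c' by mlra.
rewrite -Ec in H1' H2' H3' H4' Hi'.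
have Ei : i = i'.
  case: (mlt_total i i') => [Hlt|[//|Hlt]].
  - case: H2 => [H2|H2]; first by mlra.
    by have := @level_mono (c + c) (i + 1) i' (l + (c + c)) ltac:(mlra); mlra.
  - case: H2' => [H2'|H2']; first by mlra.
    by have := @level_mono (c + c) (i' + 1) i (l + (c + c)) ltac:(mlra); mlra.
rewrite -Ei in H3' H4'.
have SR : Sg1 al (ranked (c + c) i (l + (c + c))) by rewrite /ranked; defn.
have PR : Pi1 al (ranked (c + c) i (l + (c + c))) by rewrite /ranked; defn.
case: (mlt_total s s') => [Hlt|[//|Hlt]].
- have := cnt_lt SR PR Hlt H3; mlra.
- have := cnt_lt SR PR Hlt H3'; mlra.
Qed.

Lemma machine_index : exists e, forall r s, machine r s -> phi Z e r s.
Proof.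
apply: graph_index; last exact: machine_fun.
rewrite /machine /ranked /level; defn.
Qed.

Lemma compress (X : set_of M) b :
  (forall n i s t, inW (pr n (pr i s)) -> prefix t s -> inW (pr n (pr i t))) ->
  (forall n i, exists k, level (approx n i) k * exp2 n <= exp2 k) ->
  (forall n, exists i, forall k, inW (pr n (pr i (restr X k)))) ->
  exists m0, forall m, m0 <= m -> exists n, n + b = m /\ complexity_lt (restr X m) n.
Proof.
move=> Htree Hmeas HX.
have [e He] := machine_index.
(* The description has length [(e + 1) + (c + 1) + l]. Since [m = l + 2c], this choice of [c] makes
   [m - b] just one larger. *)
pose c := e + b + 1 + 1 + 1.
have [i0 Hi0] := HX (c + c); have [k Hk] := Hmeas (c + c) i0.
(* From [k] on the measure bound seen at length [k] carries over to length [m]; [i0 <= m] respects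
   the cap [i <= m], which guarantees the machine a last stage to consider; [c + c] makes room for
   [l]. *)
exists (k + i0 + (c + c)) => m Hm.
have [l El] : exists l, m = l + (c + c).
  by have [l El] : exists l, m = c + c + l by [apply: mle_diff; mlra]; exists l; rewrite El; ring.
exists (l + c + e + 1 + 1 + 1); split; first by rewrite El /c; ring.
have [d Ed] : exists d, m = k + d by apply: mle_diff; mlra.
have Hlev : level (approx (c + c) i0) m <= exp2 l.
  have H1 : level (approx (c + c) i0) (k + d) <= exp2 d * level (approx (c + c) i0) k.
    rewrite -level_lift; [defn|defn|]; apply: level_sub; [defn..|].
    move=> s /is_lenP [Hs Ls] [j [Hj Wj]]; exists j; split=> //; apply: Htree Wj _.
    have Hks : k <= len s by rewrite Ls; mlra.
    have [P1 P2] := pre_len Hs Hks.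
    by apply/prefixP; split=> //; split=> //; rewrite P2.
  rewrite -Ed in H1.
  have H2 : exp2 d * (level (approx (c + c) i0) k * exp2 (c + c)) <= exp2 d * exp2 k by apply: mmul_le; mlra.
  have H3 : exp2 d * exp2 k = exp2 l * exp2 (c + c) by rewrite -!exp2_add -El Ed; congr exp2; ring.
  apply: mlt_by_contra => H4.
  have H5 : (exp2 l + 1) * exp2 (c + c) <= (exp2 d * level (approx (c + c) i0) k) * exp2 (c + c).
    by apply: mmul_le; mlra.
  have := exp2_gt0 (c + c); mlra.
have [|||i [[Hi1 Hi2] Hi3]] := @m_greatest M (fun i => i <= m /\ level (approx (c + c) i) m <= exp2 l) m.
- by rewrite /level; defn.
- by have := @level_mono (c + c) 0 i0 m (mle0 _); mlra.
- by move=> i [].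
have Hii : i0 <= i.
  apply: mlt_by_contra => H; apply: Hi3; have := @level_mono (c + c) (i + 1) i0 m ltac:(mlra); mlra.
have [R1 R2] := restr_len X m.
have Hr : ranked (c + c) i m (restr X m).
  by split; [apply/is_lenP|exists i0].
have SR : Sg1 al (ranked (c + c) i m) by rewrite /ranked; defn.
have PR : Pi1 al (ranked (c + c) i m) by rewrite /ranked; defn.
have Hlt : restr X m < exp2 (m + 1) by apply: is_len_lt; apply/is_lenP.
have Hrank := cnt_lt SR PR Hlt Hr.
have Hc : cnt (ranked (c + c) i m) (restr X m) < exp2 l by move: Hi2 Hrank; rewrite /level /ranked; mlra.
set t := exp2 l + cnt (ranked (c + c) i m) (restr X m).
have Lt : is_len t l by apply/is_lenE; rewrite exp2_S /t; mlra.
have Hmach : machine (exp2 (c + 1 + l) + t) (restr X m).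
  exists c, l, t, m, i; split=> //; split=> //; split=> //; split=> //; split=> //; split=> //.
  case: (classic (i = m)) => Him; [by left|right].
  have Him' : i + 1 <= m by case: (proj1 (mle_lteq i m) Hi1) => // K; mlra.
  by apply: mlt_by_contra => K; apply: Hi3.
have Lr : is_len (exp2 (c + 1 + l) + t) (c + 1 + l).
  have H1 := is_len_lt Lt; have : exp2 (l + 1) <= exp2 (c + 1 + l) by apply: exp2_le; mlra.
  by rewrite is_lenE (exp2_S (c + 1 + l)); mlra.
have [U1 U2] := univ_intro R1 Lr (He _ _ Hmach).
by eexists; eexists; split; first exact: U2; split=> //; mlra.
Qed.
End Compression.

Lemma level_card (A : M -> Prop) n c : Sg1 al A -> Pi1 al A ->
  is_card (fun s => is_len s n /\ A s) c <-> c = level A n.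
Proof. by move=> SA PA; apply: is_cardP; [defn|defn|move=> s [/is_len_lt]]. Qed.

Theorem io_inc_two_rand X : io_inc X -> two_rand X.
Proof.
move=> [b Hb] W [[e He] [Htree Hmeas]] HX.
(* [W] is not a parameter allowed by [eq Z], so membership is expressed through the values 1 and 0
   of the functional reducing it to [Z]. *)
have SW : Sg1 (eq Z) (fun x => x \in W).
  move=> f Hf; have H := Sg_phi (al := eq Z) (Z := Z) erefl.
  apply: (Sg_ext (P := fun v => phi Z e (f v) 1)); last by defn.
  move=> v; have [K1 K2] := He (f v); split=> // H1; apply: NNPP => /K2 H2.
  by have := phi_fun H1 H2; have := @mlt01 M; mlra.
have PW : Pi1 (eq Z) (fun x => x \in W).
  move=> f Hf; have H := Sg_phi (al := eq Z) (Z := Z) erefl.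
  apply: (Sg_ext (P := fun v => phi Z e (f v) 0)); last by defn.
  move=> v; have [K1 K2] := He (f v); split=> // H1 /K1 H2.
  by have := phi_fun H1 H2; have := @mlt01 M; mlra.
have [|||m0 Hm0] := @compress (fun x => x \in W) SW PW X b.
- by move=> n i s t Ws Hp; case: (Htree n i s Ws) => _; apply.
- move=> n i; have [p [-> /(_ i) [k [q [c [-> [Hc Hle]]]]]]] := Hmeas n.
  exists k; have <- : c = level (fun s => exists j, j <= i /\ pr n (pr j s) \in W) k.
    by apply/(level_card (A := fun s => exists j, j <= i /\ pr n (pr j s) \in W)) => //; defn.
  by mlra.
- move=> n; have [i Hi] := HX n; exists i => k.
  by have [s [/is_restrP -> K]] := Hi k.
have [m [Hm [s [/is_restrP -> Hn]]]] := Hb m0.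
by have [n [En K]] := Hm0 m Hm; apply: Hn En K.
Qed.
End Machines.

(** * 2-randomness implies incompressibility *)

Section Cover.
Context {M : rca}.
Local Open Scope m_scope.
Implicit Types x y z i j k l m n b c d e p q r s t u w : M.
Implicit Types K A : M -> M -> Prop.
Notation al := (@allsets M).

Add Ring mring : (@msemiring M).

Variable U : M -> M -> M -> Prop.

(* [U t x z]: by stage [t] the program [x] is known to print [z]. *)
Definition comp b t z : Prop := exists x, x < z /\ (0 < x /\ len x + b < len z /\ U t x z).
Definition inU b t i y : Prop := i <= len y /\ comp b t (pre y i).
(* [K j s]: a level below [j] acts at stage [s].  So the range of level [l] reaches
   beyond its last stage of action at level at most [l]. *)
Definition range K l t i : Prop :=
  l <= i /\ (i = l \/ exists s, s < t /\ (K (l + 1) s /\ i <= l + s + 1)).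
Definition cover b K j t y : Prop :=
  exists l, l < j /\ forall i, i < l + t + 1 -> range K l t i -> inU b t i y.
(* The measure is at most [2^-b (2 - 2^-j)]. *)
Definition fits b K j t i : Prop :=
  level (fun y => cover b K j t y \/ inU b t i y) t * (exp2 j * exp2 b) + exp2 t <=
  exp2 t * (exp2 j + exp2 j).
Definition violated b K j t : Prop :=
  exists i, i < t + 1 /\ (j < i /\ ~ range K j t i /\ ~ fits b K (j + 1) t i).
Definition below A j s : Prop := exists v, v < j /\ A v s.

Hypotheses (SU : Sg3 al U) (PU : Pi3 al U).
Hypothesis U_mono : forall t t' x z, t <= t' -> U t x z -> U t' x z.
Hypothesis U_fun : forall t x z z', U t x z -> U t x z' -> z = z'.

(** Distinct strings have distinct programs, and those for strings of length [b + l] are shorter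
    than [l], so their codes are below [2^l]. *)
Lemma comp_small b t i : exp2 b * level (comp b t) i <= exp2 i.
Proof.
have SC : Sg1 al (comp b t) by rewrite /comp; defn.
have PC : Pi1 al (comp b t) by rewrite /comp; defn.
case: (classic (i <= b)) => [Hi|/mlt_nle Hi].
  have -> : level (comp b t) i = 0.
    apply: cnt_eq0; [defn|defn|].
    by move=> z _ [/is_lenP [_ Lz] [x [_ [_ [H _]]]]]; have := mle0 (len x); mlra.
  by rewrite mmul0; exact: mle0.
have [l El] : exists l, i = b + l by apply: mle_diff; mlra.
subst i; suff H : level (comp b t) (b + l) <= exp2 l.
  by rewrite exp2_add; apply: mmul_le; mlra.
have T1 : Sg1 al (fun _ : M => True) by defn.
have T2 : Pi1 al (fun _ : M => True) by defn.
have E : cnt (fun _ : M => True) (exp2 l) = exp2 l by apply: cnt_all.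
rewrite -E -(mmul1 (level _ _)) mmulC.
apply: (@double_count M _ _ (fun z x => U t x z)); [defn..| | |by []].
- move=> z Hz [/is_lenP [_ Lz] [x [_ [Hx [Hl Ux]]]]].
  have Hxl : x < exp2 l.
    have [_ H1] := len_bounds Hx; rewrite -exp2_S in H1.
    have : exp2 (len x + 1) <= exp2 l by apply: exp2_le; mlra.
    mlra.
  have := @cnt_lt M (fun x => U t x z) ltac:(defn) ltac:(defn) _ x Hxl Ux.
  have := mle0 (cnt (fun x => U t x z) x); mlra.
- by move=> z z' x _ _ _ _ _; exact: U_fun.
Qed.

Lemma inU_mono b t t' i y : t <= t' -> inU b t i y -> inU b t' i y.
Proof.
move=> Ht [H [x [H1 [H2 [H3 H4]]]]]; split=> //; exists x; split=> //; split=> //; split=> //.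
exact: U_mono H4.
Qed.

Lemma inU_pre b t i y n : 0 < y -> n <= len y -> inU b t i (pre y n) -> inU b t i y.
Proof.
move=> Hy Hn [H1 H2]; have [P1 P2] := pre_len Hy Hn; rewrite P2 in H1.
by split; [mlra|rewrite -(@pre_pre M y n i) //].
Qed.

Lemma inU_small b t i n : i <= n -> exp2 b * level (inU b t i) n <= exp2 n.
Proof.
have SC : Sg1 al (comp b t) by rewrite /comp; defn.
have PC : Pi1 al (comp b t) by rewrite /comp; defn.
move=> /mle_diff [d ->].
have -> : level (inU b t i) (i + d) = level (fun y => comp b t (pre y i)) (i + d).
  apply: level_ext; [rewrite /inU; defn..|].
  move=> y /is_lenP [_ Ly]; rewrite /inU Ly; split=> [[]|] //; split=> //; mlra.
rewrite level_lift // exp2_add.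
have := mmul_le (comp_small b t i) (mlt_S (exp2 d)); mlra.
Qed.

(** ** Independence from later stages *)

Lemma range_ext K K' l t i : (forall j s, s < t -> (K j s <-> K' j s)) -> range K l t i <-> range K' l t i.
Proof.
move=> H; split=> -[H1 [H2|[s [Hs [Ks Hi]]]]]; split=> //; [by left|right|by left|right].
- by exists s; split=> //; split=> //; apply/(H _ s Hs).
- by exists s; split=> //; split=> //; apply/(H _ s Hs).
Qed.

Lemma cover_ext K K' b j t y : (forall j s, s < t -> (K j s <-> K' j s)) ->
  cover b K j t y <-> cover b K' j t y.
Proof.
move=> H; split=> -[l [Hl H']]; exists l; split=> // i Hi /(range_ext l i H) Hr; exact: H'.
Qed.

Lemma fits_ext K K' b j t i : (forall j s, s < t -> (K j s <-> K' j s)) ->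
  fits b K j t i <-> fits b K' j t i.
Proof.
move=> H; rewrite /fits.
have -> : (fun y => cover b K j t y \/ inU b t i y) = (fun y => cover b K' j t y \/ inU b t i y); last by [].
apply: functional_extensionality => y; apply: propositional_extensionality.
by rewrite (cover_ext b j y H).
Qed.

(** Whether a level is violated depends on earlier actions only. This permits running the
    construction on a finite history in place of the full action relation. *)
Lemma violated_ext K K' b j t : (forall j s, s < t -> (K j s <-> K' j s)) ->
  violated b K j t <-> violated b K' j t.
Proof.
move=> H; split=> -[i [Hi [H1 [H2 H3]]]]; exists i; split=> //; split=> //.
- by rewrite -(range_ext j i H) -(fits_ext b (j + 1) i H).
- by rewrite (range_ext j i H) (fits_ext b (j + 1) i H).
Qed.

(** ** Bounding the number of actions *)

Section Actions.
Variables (b : M) (A : M -> M -> Prop).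
Hypotheses (SAct : Sg2 al A) (PAct : Pi2 al A).
(** The condition [j <= s] makes the search for the acting level bounded. *)
Hypothesis rule : forall j s, A j s <-> j <= s /\ violated b (below A) j s /\
  forall j', j' < j -> ~ violated b (below A) j' s.

Notation K := (below A).

Let SK : Sg2 al K.
Proof. by rewrite /below; defn. Qed.
Let PK : Pi2 al K.
Proof. by rewrite /below; defn. Qed.
Let SinU f g h : Df al f -> Df al g -> Df al h -> Sg al (fun v => inU b (f v) (g v) (h v)).
Proof. by rewrite /inU /comp; defn. Qed.
Let PinU f g h : Df al f -> Df al g -> Df al h -> Pi al (fun v => inU b (f v) (g v) (h v)).
Proof. by rewrite /inU /comp; defn. Qed.
Let Srange : Sg3 al (range K).
Proof. by rewrite /range; defn. Qed.
Let Prange : Pi3 al (range K).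
Proof. by rewrite /range; defn. Qed.
Let Scover : Sg3 al (cover b K).
Proof. by rewrite /cover; defn. Qed.
Let Pcover : Pi3 al (cover b K).
Proof. by rewrite /cover; defn. Qed.
Let Sfits : Sg3 al (fits b K).
Proof. by rewrite /fits /level; defn. Qed.
Let Pfits : Pi3 al (fits b K).
Proof. by rewrite /fits /level; defn. Qed.

Lemma below_mono j j' s : j <= j' -> K j s -> K j' s.
Proof. by move=> Hj [v [Hv H]]; exists v; split=> //; mlra. Qed.

Lemma A_fun j j' s : A j s -> A j' s -> j = j'.
Proof.
move=> /rule [_ [H1 H2]] /rule [_ [H1' H2']]; case: (mlt_total j j') => [/H2' //|[//|/H2 //]].
Qed.

(** Otherwise the least violated level would be at most [j], hence at most the stage, and would
    act. *)
Lemma not_violated j s : j <= s -> ~ K (j + 1) s -> ~ violated b K j s.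
Proof.
move=> Hj HK Hv; have Pv : Pi1 al (fun j => violated b K j s) by rewrite /violated; defn.
have [k [Hk Hmin]] := m_least (P := fun j => violated b K j s) Pv Hv.
have Hkj : k <= j by apply: mlt_by_contra => H; apply: (Hmin j) => //; mlra.
by apply: HK; exists k; split=> //; apply/rule; split=> //; mlra.
Qed.

(** Without actions below [j] the ranges of these levels stay fixed while the sets [U_i] grow, so
    the intersections can only grow. *)
Lemma cover_lift j t t' y : 0 < y -> t <= t' -> t' <= len y ->
  (forall s, t <= s -> s < t' -> ~ K j s) -> cover b K j t (pre y t) -> cover b K j t' y.
Proof.
move=> Hy Ht Hl HK [l [Hlj H]]; exists l; split=> // i _ [Hli Hr].
have Hr' : i = l \/ exists s, s < t /\ (K (l + 1) s /\ i <= l + s + 1).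
  case: Hr => [|[s [Hs [Ks Hi]]]]; [by left|right; exists s; split=> //].
  by apply: mlt_by_contra => Hts; apply: (HK s) => //; apply: below_mono Ks; mlra.
have Hit : i < l + t + 1 by case: Hr' => [|[s [Hs [_ Hi]]]]; have := mle0 t; mlra.
have HU := H i Hit (conj Hli Hr').
have Htl : t <= len y by mlra.
exact: inU_mono Ht (inU_pre Hy Htl HU).
Qed.

(** This is the absence of a violation at level [j - 1]. For [j = 0] the union is empty, and the
    budget [2^-b] is the bound on [U_i] alone. *)
Lemma fits_stage j t i : j <= t + 1 -> j < i -> i <= t -> ~ K j t ->
  (forall l, l < j -> ~ range K l t i) -> fits b K j t i.
Proof.
move=> Hj Hji Hi HK Hr; case: (mnneg j) => Hj0.
- have [k Ek] : exists k, j = k + 1.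
    by have [k Ek] := mle_diff (proj1 (mlt_le1 _ _) Hj0); exists k; rewrite Ek; ring.
  have HN : ~ violated b K k t by apply: not_violated; [mlra|rewrite -Ek].
  apply: NNPP => HF; apply: HN; exists i; split=> //; split; first by mlra.
  by split; [apply: Hr; mlra|rewrite -Ek].
- rewrite /fits -Hj0 exp2_0.
  have -> : level (fun y => cover b K 0 t y \/ inU b t i y) t = level (inU b t i) t.
    apply: level_ext; [defn..|].
    by move=> y _; split=> [[[l [Hl _]]|]|]; [mlra|done|right].
  have := inU_small b t Hi; mlra.
Qed.

(* During a period without actions of level below [j], each action of level [j]
   removes from the intersection attached to [j] a part of measure more than
   [2^-(b+j+1)], and these parts are disjoint subsets of the [j]-th set. *)
Lemma period_bound j p t : (forall s, p <= s -> s < t -> ~ K j s) ->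
  cnt (fun s => p <= s /\ A j s) t <= exp2 (j + 1).
Proof.
move=> Hper; pose P s := p <= s /\ A j s.
have SP : Sg1 al P by rewrite /P; defn.
have PP : Pi1 al P by rewrite /P; defn.
case: (classic (exists s, s < t /\ P s)) => [[s0 [Hs0 Ps0]]|N]; last first.
  have -> : cnt P t = 0 by apply: cnt_eq0 => // s Hs Ps; apply: N; exists s.
  exact: mle0.
(* All actions of the period are compared at the last one: no lower level acts at [T], because [j]
   does. *)
have [T [HT [PT Hlast]]] : exists T, T < t /\ P T /\ forall s, s < t -> P s -> s <= T.
  have [|||T [HT Hmax]] := @m_greatest M (fun n => exists s, s < t /\ (P s /\ n <= s)) t.
  - by defn.
  - by exists s0; split=> //; split=> //; exact: mle0.
  - by move=> n [s [Hs [_ Hn]]]; mlra.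
  move: HT => [T0 [H1 [H2 H3]]]; exists T0; split=> //; split=> // s Hs Ps.
  apply: mlt_by_contra => H; apply: Hmax; exists s; split=> //; split=> //; mlra.
have -> : cnt P t = cnt P (T + 1).
  have [d Ed] : exists d, t = T + 1 + d by apply: mle_diff; mlra.
  rewrite Ed cnt_split // (_ : cnt (fun i => P (T + 1 + i)) d = 0) ?madd0 //.
  apply: cnt_eq0; [defn|defn|].
  move=> i Hi Pi; have Hit : T + 1 + i < t by rewrite Ed; mlra.
  have := Hlast _ Hit Pi; have := mle0 i; mlra.
(* The range is that of stage [s], but the sets [U_i] are always taken at stage [T]. A string in
   [R s] misses some [U_i] with [i <= s]; the action at [s] puts this [i] into all later ranges, so
   the sets [R s] are disjoint. *)
pose inter s y := forall i, i < j + s + 1 -> range K j s i -> inU b T i y.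
pose R s y := is_len y T /\ (inter s y /\ exists i, i < s + 1 /\
  ((j < i /\ ~ range K j s i /\ ~ fits b K (j + 1) s i) /\ ~ inU b T i y)).
pose Q y := is_len y T /\ inU b T j y.
have SR : Sg2 al R by rewrite /R /inter; defn.
have PR : Pi2 al R by rewrite /R /inter; defn.
have SQ : Sg1 al Q by rewrite /Q; defn.
have PQ : Pi1 al Q by rewrite /Q; defn.
pose c := exp2 (j + 1) * exp2 b.
(* [w] is the least integer above [2^T / c], the number of strings of length [T] corresponding to
   measure [2^-(b+j+1)]. *)
have [w [Hw Hwmin]] : exists w, exp2 T < w * c /\ forall w', w' < w -> ~ exp2 T < w' * c.
  apply: (m_least (P := fun w => exp2 T < w * c) (n := exp2 T + 1)); first by defn.
  have Hc : 0 < c by rewrite /c -exp2_add; apply: exp2_gt0.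
  have := mmul_le (mlt_S (exp2 T + 1)) (proj1 (mlt_le1 _ _) Hc); mlra.
have [HpT AT] := PT.
have HjT : j <= T by move/rule: AT => [].
have HKT : ~ K j T by move=> [v [Hv Av]]; have := A_fun AT Av; mlra.
have Hbound : w * cnt P (T + 1) <= cnt Q (exp2 (T + 1)).
  apply: (@double_count M P Q R) => //.
  - move=> s Hs [Hps /rule [Hjs [[i [Hi [Hji [Hri Hfi]]]] _]]].
    have HsT : s <= T by mlra.
    apply: mlt_by_contra => Hlt; apply: (Hwmin (cnt (R s) (exp2 (T + 1)))); first by mlra.
    have [d Ed] := mle_diff HsT.
    pose D y := inter s y /\ ~ inU b T i y.
    have SI : Sg1 al (inter s) by rewrite /inter; defn.
    have PI : Pi1 al (inter s) by rewrite /inter; defn.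
    have HD : level D T <= cnt (R s) (exp2 (T + 1)).
      apply: cnt_sub; [rewrite /D; defn..|].
      by move=> y _ [Hy [H1 H2]]; split=> //; split=> //; exists i.
    have Hlift : exp2 d * level (fun y => cover b K (j + 1) s y \/ inU b s i y) s <=
        level (fun y => cover b K j T y \/ inU b T i y) T + level D T.
      rewrite -level_lift; [defn|defn|]; rewrite -Ed.
      have H1 := @level_or M (fun y => cover b K j T y \/ inU b T i y) D T
        ltac:(defn) ltac:(defn) ltac:(rewrite /D; defn) ltac:(rewrite /D; defn).
      suff H2 : level (fun y => cover b K (j + 1) s (pre y s) \/ inU b s i (pre y s)) T <=
        level (fun y => (cover b K j T y \/ inU b T i y) \/ D y) T by mlra.
      apply: level_sub; [rewrite /D; defn..|].
      move=> y /is_lenP [Hy Ly].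
      have Hsl : s <= len y by rewrite Ly.
      case=> [[l [Hl Hcov]]|HU]; last first.
        by left; right; apply: inU_mono HsT _; apply: inU_pre HU.
      case: (classic (l < j)) => [Hlj|/mlt_nle Hlj].
        left; left; apply: (@cover_lift j s T) => //; first by rewrite Ly; mlra.
          by move=> s' H1' H2'; apply: Hper; mlra.
        by exists l.
      have Elj : l = j by mlra.
      subst l; case: (classic (inU b T i y)) => HU; first by left; right.
      right; split=> // i' Hi' Hr'; apply: inU_mono HsT _.
      exact: inU_pre Hy Hsl (Hcov i' Hi' Hr').
    have Hfit : fits b K j T i.
      apply: fits_stage => //; [mlra|mlra|].
      (* If a lower range contained [i], this would be due to an action before [s], and such an
         action extends the range of [j] too. *)
      move=> l Hl [_ [H|[s' [Hs' [Ks' Hi']]]]]; first by mlra.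
      apply: Hri; split; first by mlra.
      right; exists s'; split.
        apply: mlt_by_contra => H; apply: (Hper s'); [mlra|mlra|].
        by apply: below_mono Ks'; mlra.
      by split; [apply: below_mono Ks'; mlra|mlra].
    rewrite /fits in Hfi Hfit.
    set L1 := level _ s in Hlift Hfi; set L2 := level _ T in Hlift Hfit; set L3 := level D T in HD Hlift.
    set L4 := cnt (R s) _ in HD *.
    have E2 : exp2 (j + 1) = exp2 j + exp2 j by apply: exp2_S.
    have ET : exp2 T = exp2 s * exp2 d by rewrite Ed exp2_add.
    (* The failed budget at [s] and the respected one at [T] differ by [2^-(b+j+1)], so the strings
       of [D] must account for more than this. *)
    have {}Hfi : exp2 s * (exp2 (j + 1) + exp2 (j + 1)) + 1 <= L1 * c + exp2 s by rewrite /c; mlra.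
    have F1 := mmul_le (mlt_S (exp2 d)) Hfi.
    have F2 : (exp2 d * L1) * c <= (L2 + L4) * c by apply: mmul_le; mlra.
    have F3 : L2 * c + exp2 T + exp2 T <= exp2 T * (exp2 (j + 1) + exp2 (j + 1)).
      by rewrite /c E2; mlra.
    have F4 := exp2_gt0 d.
    rewrite ET in F3 *; mlra.
  - move=> s s' y Hs Hs' Hy [Hps As] [Hps' As'].
    have X u u' : u < u' -> A j u -> R u y -> R u' y -> False.
      move=> Huu Au [_ [_ [i [Hi [[Hji _] HU]]]]] [_ [Hint _]]; apply: HU; apply: Hint; first by mlra.
      split; first by mlra.
      right; exists u; split=> //; split; last by mlra.
      by exists j; split=> //; exact: mlt_S.
    by move=> Rs Rs'; case: (mlt_total s s') => [H|[//|H]]; [case: (X s s')|case: (X s' s)].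
  - move=> s y _ _ _ [Hy [Hint _]]; split=> //; apply: Hint; first by have := mle0 s; mlra.
    by split; [exact: mlt_S|left].
have HQ : exp2 b * cnt Q (exp2 (T + 1)) <= exp2 T by apply: inU_small.
apply: mlt_by_contra => Hr.
set r := cnt P (T + 1) in Hbound Hr; set q := cnt Q _ in Hbound HQ.
have G1 : (exp2 T + 1) * r <= (w * c) * r by apply: mmul_le; mlra.
have G2 : c * (w * r) <= c * q by apply: mmul_le; mlra.
have G3 : exp2 (j + 1) * (exp2 b * q) <= exp2 (j + 1) * exp2 T by apply: mmul_le; mlra.
have G4 : exp2 T * (exp2 (j + 1) + 1) <= exp2 T * r by apply: mmul_le; mlra.
have := exp2_gt0 T; rewrite /c in G1 G2; mlra.
Qed.

Lemma below_S j s : K (j + 1) s <-> K j s \/ A j s.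
Proof.
split=> [[v [Hv H]]|[[v [Hv H]]|H]].
- case: (proj1 (mle_lteq v j) Hv) => [H'|E]; first by left; exists v.
  by right; rewrite -E.
- by exists v; split=> //; mlra.
- by exists j; split=> //; exact: mlt_S.
Qed.

(** Each action below [j] ends a period, so there is at most one period more than such actions, each
    with at most [2^(j+1)] actions of level [j]. In the induction [p] is the start of the current
    period. *)
Lemma action_step j t : cnt (A j) t <= exp2 (j + 1) * cnt (K j) t + exp2 (j + 1).
Proof.
have SKj : Sg1 al (K j) by defn.
have PKj : Pi1 al (K j) by defn.
have SAj : Sg1 al (A j) by defn.
have PAj : Pi1 al (A j) by defn.
suff [p [_ [Hp H]]] : exists p, p < t + 1 /\ ((forall s, s < t -> p <= s -> ~ K j s) /\
    cnt (A j) t <= exp2 (j + 1) * cnt (K j) t + cnt (fun s => p <= s /\ A j s) t).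
  have HB := @period_bound j p t (fun s H1 H2 => Hp s H2 H1); mlra.
move: t; apply: (m_ind (P := fun t => exists p, p < t + 1 /\ ((forall s, s < t -> p <= s -> ~ K j s) /\
    cnt (A j) t <= exp2 (j + 1) * cnt (K j) t + cnt (fun s => p <= s /\ A j s) t))).
- by defn.
- have SP : Sg1 al (fun s => 0 <= s /\ A j s) by defn.
  have PP : Pi1 al (fun s => 0 <= s /\ A j s) by defn.
  exists 0; rewrite (cnt0 SAj PAj) (cnt0 SKj PKj) (cnt0 SP PP); split; first by mlra.
  by split=> [s Hs|]; [have := mle0 s|]; mlra.
- move=> t [p [Hpt [Hp H]]].
  have SP q : Sg1 al (fun s => q <= s /\ A j s) by defn.
  have PP q : Pi1 al (fun s => q <= s /\ A j s) by defn.
  case: (classic (K j t)) => HK.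
    exists (t + 1); split; first by mlra.
    split; first by move=> s H1 H2; mlra.
    have HA : ~ A j t by move=> HA; move: HK => [v [Hv Av]]; have := A_fun HA Av; mlra.
    have HB := @period_bound j p t (fun s H1 H2 => Hp s H2 H1).
    rewrite (cntS0 SAj PAj HA) (cntS1 SKj PKj HK).
    by have := mle0 (cnt (fun s => t + 1 <= s /\ A j s) (t + 1)); mlra.
  exists p; split; first by mlra.
  split.
    move=> s Hs Hps; case: (proj1 (mle_lteq s t) Hs) => [H1|->] //; exact: Hp.
  rewrite (cntS0 SKj PKj HK); case: (classic (A j t)) => HA.
    rewrite (cntS1 SAj PAj HA) (cntS1 (SP p) (PP p)); [by split=> //; mlra|mlra].
  rewrite (cntS0 SAj PAj HA) (cntS0 (SP p) (PP p)); [by case|mlra].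
Qed.

(** With [c] actions below [j], adding level [j] makes [c + 1] grow at most by the factor [2^(j+2)],
    and [(j+1)^2 + (j+2)] is at most [(j+2)^2]. The stage [t] is fixed during the induction on
    [j]. *)
Lemma action_bound j t : cnt (K j) t < exp2 ((j + 1) * (j + 1)).
Proof.
move: j; apply: (m_ind (P := fun j => cnt (K j) t < exp2 ((j + 1) * (j + 1)))); first by defn.
  have -> : cnt (K 0) t = 0; last exact: exp2_gt0.
  by apply: cnt_eq0; [defn|defn|]; move=> s _ [v [Hv _]]; have := mle0 v; mlra.
move=> j IH.
have H : cnt (K (j + 1)) t <= cnt (K j) t + cnt (A j) t.
  have := @cnt_or M (K j) (A j) t ltac:(defn) ltac:(defn) ltac:(defn) ltac:(defn).
  have -> : (fun i => K j i \/ A j i) = K (j + 1); last by [].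
  by apply: functional_extensionality => s; apply: propositional_extensionality; rewrite below_S.
have HS := action_step j t.
have HE : exp2 ((j + 1) * (j + 1)) * exp2 (j + 1 + 1) <= exp2 ((j + 1 + 1) * (j + 1 + 1)).
  by rewrite -exp2_add; apply: exp2_le; have := mle0 j; mlra.
have HD := exp2_S (j + 1); have H1 := exp2_gt0 (j + 1).
set c := cnt (K j) t in IH H HS; set r := exp2 (j + 1) in HS HD H1.
have G1 : (r + r) * (c + 1) <= (r + r) * exp2 ((j + 1) * (j + 1)) by apply: mmul_le; mlra.
rewrite HD in HE.
have G2 : 1 * (c + 1) <= r * (c + 1) by rewrite !(mmulC _ (c + 1)); apply: mmul_le; mlra.
mlra.
Qed.

(** The bound is independent of the stage, so the number of actions below [j] attains a maximum,
    after which none can follow. *)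
Lemma stability j : exists t0, forall t, t0 <= t -> ~ K j t.
Proof.
have SKj : Sg1 al (K j) by defn.
have PKj : Pi1 al (K j) by defn.
have [|||c [[t0 Ht0] Hmax]] :=
  @m_greatest M (fun c => exists t, c <= cnt (K j) t) (exp2 ((j + 1) * (j + 1))).
- by defn.
- by exists 0; exact: mle0.
- by move=> c [t Ht]; have := action_bound j t; mlra.
exists t0 => t Ht HK; apply: Hmax; exists (t + 1).
rewrite (cntS1 SKj PKj HK); have := cnt_mono SKj PKj Ht; mlra.
Qed.

(** The index [pr j t] guesses that no level up to [j] acts from stage [t] on. A refuting action
    stops the tree at that length; a correct guess leaves a clopen set, fixed by prefixes of length
    [t]. Strings shorter than [t] meet no covering condition, which keeps the tree closed under
    prefixes. *)
Definition tree i y : Prop := 0 < y /\ exists j, j < i + 1 /\ exists t, t < i + 1 /\ (i = pr j t /\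
  ((forall s, s < len y -> t <= s -> ~ K (j + 1) s) /\ (t <= len y -> cover b K (j + 1) t (pre y t)))).

Lemma Sg_tree : Sg2 al tree.
Proof. by rewrite /tree; defn. Qed.
Lemma Pi_tree : Pi2 al tree.
Proof. by rewrite /tree; defn. Qed.

Lemma tree_prefix i : is_tree (tree i).
Proof.
move=> y [Hy [j [Hj [t [Ht [E [H1 H2]]]]]]]; split=> // z /prefixP [_ [Hz [Hl Ez]]]; split=> //.
exists j; split=> //; exists t; split=> //; split=> //; split=> [s Hs|H].
  by apply: H1; mlra.
rewrite Ez (pre_pre Hy H Hl); apply: H2; mlra.
Qed.

(** At a length where all wrong guesses up to [i] are refuted, the surviving trees lie in one
    [cover], that of the greatest level guessed correctly, and [fits] bounds it. *)
Lemma tree_measure i : exists n,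
  level (fun y => exists k, k <= i /\ tree k y) n * exp2 b <= exp2 n + exp2 n.
Proof.
have St := Sg_tree; have Pt := Pi_tree.
pose P x s := exists j, j < x + 1 /\ exists t, t < x + 1 /\ (x = pr j t /\ (t <= s /\ K (j + 1) s)).
have [||B HB] := @strong_collection M P (i + 1); [by rewrite /P; defn..|].
(* [B] passes all refutations. The range of a level [l <= i] that is quiet from some [t <= i] on
   reaches at most [2i], so [n] lies outside. *)
pose n := B + i + i + 1 + 1; exists n.
pose alive j := exists t, t < i + 1 /\ (pr j t <= i /\ forall s, t <= s -> ~ K (j + 1) s).
have Halive k y : k <= i -> is_len y n -> tree k y -> exists j t, k = pr j t /\ t <= i /\ j <= i /\
    (forall s, t <= s -> ~ K (j + 1) s) /\ cover b K (j + 1) t (pre y t).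
  move=> Hk /is_lenP [Hy Ly] [_ [j [Hj [t [Ht [E [H1 H2]]]]]]].
  exists j, t; split=> //; split; first by mlra.
  split; first by mlra.
  have HBn : B <= n by rewrite /n; have := mle0 i; mlra.
  have Hin : i <= n by rewrite /n; have := mle0 i; have := mle0 B; mlra.
  split; last by apply: H2; rewrite Ly; mlra.
  move=> s Hs HK; have Hki : k < i + 1 by mlra.
  have Pk : exists s, P k s by exists s, j; split; [mlra|exists t; split; [mlra|]].
  have [s' [Hs' [j' [_ [t' [_ [E' [Ht' HK']]]]]]]] := HB k Hki Pk.
  rewrite E in E'; have [Ej Et] := pr_inj E'; subst j' t'.
  by apply: (H1 s') => //; rewrite Ly; mlra.
case: (classic (exists j, alive j)) => [[j0 Hj0]|N]; last first.
  have -> : level (fun y => exists k, k <= i /\ tree k y) n = 0.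
    apply: cnt_eq0; [defn|defn|] => y _ [Ly [k [Hk Hty]]].
    have [j [t [E [Ht [Hj [H1 _]]]]]] := Halive k y Hk Ly Hty.
    by apply: N; exists j, t; split; [mlra|rewrite -E].
  have := mle0 (exp2 n); mlra.
have [J [[t [Ht [HJ Hal]]] HJmax]] : exists J, alive J /\ forall j, alive j -> j <= J.
  have SB j : alive j -> j <= i.
    by move=> [t [_ [H _]]]; have := pr_ge_l j t; mlra.
  (* Being alive is Pi_1; [B] turns it into a bounded condition, to which [m_greatest] applies. *)
  pose live j := exists t, t < i + 1 /\ (pr j t <= i /\ forall s, s < B -> t <= s -> ~ K (j + 1) s).
  have live_alive j : live j <-> alive j.
    split=> -[t [Ht [Hp H]]]; exists t; split=> //; split=> // s Hs; last by move=> H'; apply: H.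
    move=> HK; have Hki : pr j t < i + 1 by mlra.
    have Pk : exists s, P (pr j t) s.
      exists s, j; split; first by have := pr_ge_l j t; mlra.
      by exists t; split=> //; have := pr_ge_r j t; mlra.
    have [s' [Hs' [j' [_ [t' [_ [E' [Ht' HK']]]]]]]] := HB (pr j t) Hki Pk.
    by have [Ej Et] := pr_inj E'; subst j' t'; apply: (H s').
  have [|||c [[J [Hc HJ]] Hmax]] := @m_greatest M (fun c => exists j, c <= j /\ live j) i.
  - by rewrite /live; defn.
  - by exists j0; split; [exact: mle0|apply/live_alive].
  - by move=> c [j [Hc /live_alive /SB]]; mlra.
  exists J; split; first by apply/live_alive.
  move=> j Hj; apply: mlt_by_contra => H; apply: Hmax; exists j.
  by split; [mlra|apply/live_alive].
have HJi : J <= i by have := pr_ge_l J t; mlra.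
have Hn : i + i + 1 < n by rewrite /n; have := mle0 B; mlra.
have Hi0 := mle0 i.
(* [fits] is about adding some [U_i] outside the ranges; here [n] itself serves as this [i]. *)
have Hfit : fits b K (J + 1) n n.
  apply: fits_stage; [mlra|mlra|mlra|by apply: Hal; mlra|].
  move=> l Hl [_ [H|[s [Hs [HK Hi]]]]]; first by mlra.
  have : s < t.
    apply: mlt_by_contra => H; apply: (Hal s) => //; apply: below_mono HK; mlra.
  mlra.
have HL : level (fun y => exists k, k <= i /\ tree k y) n <=
    level (fun y => cover b K (J + 1) n y \/ inU b n n y) n.
  apply: level_sub; [defn..|] => y Ly [k [Hk Hty]]; left.
  have [Hy El] := proj1 (is_lenP _ _) Ly.
  have [j [u [E [Hu [Hj [H1 H2]]]]]] := Halive k y Hk Ly Hty.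
  have HjJ : j <= J by apply: HJmax; exists u; split; [mlra|rewrite -E].
  have Hun : u <= n by mlra.
  have Hny : n <= len y by rewrite El; mlra.
  have [l [Hl Hc]] := @cover_lift (j + 1) u n y Hy Hun Hny (fun s Hs _ => H1 s Hs) H2.
  by exists l; split=> //; mlra.
move: Hfit; rewrite /fits; set L := level _ n in HL *; set L' := level _ n in HL *.
move=> Hfit; apply: mlt_by_contra => Hlt.
have G1 : exp2 (J + 1) * (exp2 n + exp2 n + 1) <= exp2 (J + 1) * (L * exp2 b) by apply: mmul_le; mlra.
have G2 : (exp2 (J + 1) * exp2 b) * L <= (exp2 (J + 1) * exp2 b) * L' by apply: mmul_le; mlra.
have := exp2_gt0 (J + 1); have := mle0 (exp2 n); mlra.
Qed.

(** By stability the final range of level [N] is finite, so collection finds a stage at which [X] is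
    seen in each of its sets [U_i]. Level and stage form a correct guess. *)
Lemma tree_cover (X : set_of M) N : (forall m, N <= m -> exists t, comp b t (restr X m)) ->
  exists i, forall n, tree i (restr X n).
Proof.
move=> H; have [t0 Ht0] := stability (N + 1).
have DX := @Df_restr M al X I.
have [||B HB] := @m_collection M (fun i t => N <= i -> comp b t (restr X i)) (N + t0 + 1).
- by rewrite /comp; defn.
- move=> i _; case: (classic (N <= i)) => Hi; last by exists 0.
  by have [t Ht] := H i Hi; exists t.
pose t := B + N + t0 + 1.
have [B0 N0] := conj (mle0 B) (mle0 N); have T0 := mle0 t0.
have Hc : cover b K (N + 1) t (restr X t).
  exists N; split; first exact: mlt_S.
  move=> i _ [HNi Hr].
  have Hi : i < N + t0 + 1.
    case: Hr => [->|[s [Hs [HK Hi]]]]; first by mlra.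
    have : s < t0 by apply: mlt_by_contra => Hst; apply: (Ht0 s).
    mlra.
  have Hit : i <= t by rewrite /t; mlra.
  have [_ Lt] := restr_len X t; split; first by rewrite Lt.
  have [u [Hu Hcu]] := HB i Hi; rewrite pre_restr //.
  have [x [H1 [H2 [H3 H4]]]] := Hcu HNi.
  exists x; split=> //; split=> //; split=> //; apply: U_mono H4; rewrite /t; mlra.
have Hst s : t <= s -> ~ K (N + 1) s by move=> Hs; apply: Ht0; move: Hs; rewrite /t; mlra.
exists (pr N t) => n; have [Hp Hl] := restr_len X n; split=> //.
exists N; split; first by have := pr_ge_l N t; mlra.
exists t; split; first by have := pr_ge_r N t; mlra.
split=> //; split=> [s _|]; first exact: Hst.
by rewrite Hl => Htn; rewrite pre_restr.
Qed.
End Actions.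
End Cover.

(** ** The construction relative to an oracle *)

Section Staged.
Context {M : rca} (Z : set_of M).
Local Open Scope m_scope.
Implicit Types x y z i j k l m n b c d e p q r s t u w h : M.

Add Ring mring : (@msemiring M).

(** One number [w] bounds all witnesses, which makes the approximation to [univ] Delta_1 and
    increasing in [w]. *)
Definition ustage w t s : Prop := 0 < s /\ exists e, e < w /\ exists r, r < w /\ exists l, l < w /\
  exists d, d < w /\ exists n, n < w /\
  (is_len r l /\ t = exp2 (e + 1 + l) + r /\ (deriv Z d n /\ occurs d n e r s)).

(* Entry [s] of a history [h] is [0] if no level acts at stage [s], and [j + 1] if
   level [j] does. *)
Definition acted h j s : Prop := exists v, v < j /\ mnth h s (v + 1).

Definition viol h b j t : Prop := violated ustage b (acted h) j t.

Definition next h b t v : Prop :=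
  (exists j, j < t + 1 /\ (v = j + 1 /\ (viol h b j t /\ forall j', j' < j -> ~ viol h b j' t))) \/
  (v = 0 /\ forall j, j < t + 1 -> ~ viol h b j t).

(** Each stage consults all earlier actions, so the recursion is run on codes of finite sequences;
    this makes [act] Sigma_1 in [Z]. *)
Definition history h b n : Prop := forall t, t < n -> exists v, v < t + 1 + 1 /\ (mnth h t v /\ next h b t v).

Definition act b j t : Prop := exists h, history h b (t + 1) /\ mnth h t (j + 1).

Section StagedDef.
Variable az : set_of M -> Prop.
Hypothesis HZ : az Z.

Lemma Sg_ustage : Sg3 az ustage.
Proof. by have H1 := Sg_deriv HZ; have H2 := Pi_deriv HZ; rewrite /ustage; defn. Qed.
Lemma Pi_ustage : Pi3 az ustage.
Proof. by have H1 := Sg_deriv HZ; have H2 := Pi_deriv HZ; rewrite /ustage; defn. Qed.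

Lemma Sg_inU : Sg4 az (inU ustage).
Proof. by have H1 := Sg_ustage; have H2 := Pi_ustage; rewrite /inU /comp; defn. Qed.
Lemma Pi_inU : Pi4 az (inU ustage).
Proof. by have H1 := Sg_ustage; have H2 := Pi_ustage; rewrite /inU /comp; defn. Qed.

Lemma Sg_viol : Sg4 az viol.
Proof.
have H1 := Sg_inU; have H2 := Pi_inU.
by rewrite /viol /violated /fits /level /cover /range /acted; defn.
Qed.
Lemma Pi_viol : Pi4 az viol.
Proof.
have H1 := Sg_inU; have H2 := Pi_inU.
by rewrite /viol /violated /fits /level /cover /range /acted; defn.
Qed.
Lemma Sg_next : Sg4 az next.
Proof. by have H1 := Sg_viol; have H2 := Pi_viol; rewrite /next; defn. Qed.
Lemma Pi_next : Pi4 az next.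
Proof. by have H1 := Sg_viol; have H2 := Pi_viol; rewrite /next; defn. Qed.
Lemma Sg_history : Sg3 az history.
Proof. by have H1 := Sg_next; have H2 := Pi_next; rewrite /history; defn. Qed.
Lemma Sg_act : Sg3 az act.
Proof. by have H1 := Sg_history; rewrite /act; defn. Qed.
End StagedDef.

Notation al := (@allsets M).

Lemma ustage_mono t t' x z : t <= t' -> ustage t x z -> ustage t' x z.
Proof.
move=> H [H0 [e [He [r [Hr [l [Hl [d [Hd [n [Hn K]]]]]]]]]]]; split=> //.
exists e; split; [mlra|exists r; split; [mlra|exists l; split; [mlra|exists d; split; [mlra|]]]].
by exists n; split; [mlra|].
Qed.

Lemma ustage_univ t s : univ Z t s <-> exists w, ustage w t s.
Proof.
split=> [/univ_inv [Hs [e [r [l [Hl [[d [n [Hd Ho]]] [E _]]]]]]]|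
         [w [Hs [e [_ [r [_ [l [_ [d [_ [n [_ [Hl [-> [Hd Ho]]]]]]]]]]]]]]]].
  have He := mle0 e; have Hr := mle0 r; have Hl0 := mle0 l; have Hd0 := mle0 d; have Hn := mle0 n.
  exists (e + r + l + d + n + 1); split=> //; exists e; split; [mlra|exists r; split; [mlra|]].
  by exists l; split; [mlra|exists d; split; [mlra|exists n; split; [mlra|]]].
by have [] := @univ_intro M Z e r s l Hs Hl; first by exists d, n.
Qed.

Lemma ustage_fun t x z z' : ustage t x z -> ustage t x z' -> z = z'.
Proof. by move=> H H'; apply: (@univ_fun M Z x); apply/ustage_univ; exists t. Qed.

Lemma history_le h b n n' : n <= n' -> history h b n' -> history h b n.
Proof. by move=> Hn H t Ht; apply: H; mlra. Qed.

Lemma next_fun h b t v v' : next h b t v -> next h b t v' -> v = v'.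
Proof.
move=> [[j [Hj [-> [Vj Nj]]]]|[-> N]] [[j' [Hj' [-> [Vj' Nj']]]]|[-> N']] //.
- by case: (mlt_total j j') => [/Nj' //|[->//|/Nj //]].
- by case: (N' j Hj).
- by case: (N j' Hj').
Qed.

Lemma next_total h b t : exists v, v < t + 1 + 1 /\ next h b t v.
Proof.
case: (classic (exists j, j < t + 1 /\ viol h b j t)) => [[j Hj]|N].
  have P : Pi1 al (fun j => j < t + 1 /\ viol h b j t) by have H := @Pi_viol al I; defn.
  have [k [[Hk Vk] Hmin]] := m_least (P := fun j => j < t + 1 /\ viol h b j t) P Hj.
  exists (k + 1); split; first by mlra.
  left; exists k; split=> //; split=> //; split=> // j' Hj' V; apply: (Hmin j') => //; split=> //; mlra.
exists 0; split; first by have := mle0 t; mlra.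
by right; split=> // j Hj V; apply: N; exists j.
Qed.

Lemma next_ext h h' b t v : (forall s, s < t -> forall u, mnth h s u <-> mnth h' s u) ->
  next h b t v <-> next h' b t v.
Proof.
move=> H; have E j : viol h b j t <-> viol h' b j t.
  by apply: violated_ext => k s Hs; split=> -[u [Hu K]]; exists u; split=> //; apply/(H s Hs).
by rewrite /next; split=> -[[j [Hj [-> [V N]]]]|[-> N]]; [left|right|left|right];
  (try (exists j; split=> //; split=> //; split; first exact/E); (try split=> //));
  move=> j' Hj' /E; apply: N.
Qed.

Lemma history_exists b n : exists h, history h b n.
Proof.
have S3 := @Sg_history al I.
move: n; apply: (m_ind (P := fun n => exists h, history h b n)); first by defn.
  by exists 0 => t Ht; have := mle0 t; mlra.
move=> n [h Hh]; have [v [Hv Nv]] := next_total h b n.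
pose R t u := (t < n /\ mnth h t u) \/ (t = n /\ u = v).
have [|||h' Hh'] := @seq_of_rel M R (n + 1).
- by rewrite /R; defn.
- move=> t x y Ht [[H1 H2]|[H1 H2]] [[H3 H4]|[H3 H4]]; [exact: mnth_fun H2 H4|mlra|mlra|by rewrite H2].
- move=> t Ht; case: (proj1 (mle_lteq t n) Ht) => H; last by exists v; right.
  by have [u [_ [K _]]] := Hh t H; exists u; left.
have Hagree s : s < n -> forall u, mnth h s u <-> mnth h' s u.
  move=> Hs; have [|x [K [[_ Hx]|[H _]]]] := Hh' s; [mlra| |mlra].
  by move=> u; split=> H; [have <- := mnth_fun Hx H|have <- := mnth_fun K H].
have Hagree' t : t <= n -> forall s, s < t -> forall u, mnth h s u <-> mnth h' s u.
  by move=> Ht s Hs; apply: Hagree; mlra.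
exists h' => t Ht; case: (proj1 (mle_lteq t n) Ht) => [H|E].
  have [u [Hu [K N]]] := Hh t H; exists u; split=> //; split; first by apply/(Hagree t H).
  by apply/(next_ext b u (Hagree' t Ht)).
subst t; have [x [K [[H _]|[_ Ex]]]] := Hh' n (mlt_S n); first by mlra.
subst x; exists v; split=> //; split=> //.
by apply/(next_ext b v (Hagree' n (mlt_S n))).
Qed.

Lemma history_agree h h' b n : history h b n -> history h' b n ->
  forall s, s < n -> forall u, mnth h s u <-> mnth h' s u.
Proof.
move=> H H'.
suff Heq : forall s, s < n -> exists u, u < s + 1 + 1 /\ (mnth h s u /\ mnth h' s u).
  move=> s Hs u; have [x [_ [K K']]] := Heq s Hs.
  by split=> K1; [have <- := mnth_fun K K1|have <- := mnth_fun K' K1].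
apply: (m_strong_ind (P := fun s => s < n -> exists u, u < s + 1 + 1 /\ (mnth h s u /\ mnth h' s u))).
  by defn.
move=> s IH Hs; have [u [Hu [K N]]] := H s Hs; have [u' [_ [K' N']]] := H' s Hs.
exists u; split=> //; split=> //; suff -> : u = u' by [].
apply: next_fun N _; apply/(@next_ext h h') => // r Hr w.
have [x [_ [K1 K1']]] : exists x, x < r + 1 + 1 /\ (mnth h r x /\ mnth h' r x) by apply: IH => //; mlra.
by split=> K2; [have <- := mnth_fun K1 K2|have <- := mnth_fun K1' K2].
Qed.

Lemma act_history h b n j s : history h b n -> s < n -> act b j s <-> mnth h s (j + 1).
Proof.
move=> Hh Hs; have Hs1 : s + 1 <= n by mlra.
split=> [[h' [Hh' K]]|K]; last by exists h; split=> //; exact: history_le Hh.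
by apply/(history_agree (history_le Hs1 Hh) Hh' (mlt_S s)).
Qed.

Lemma act_rule b j s : act b j s <-> j <= s /\ violated ustage b (below (act b)) j s /\
  forall j', j' < j -> ~ violated ustage b (below (act b)) j' s.
Proof.
have [h Hh] := history_exists b (s + 1).
have E k : viol h b k s <-> violated ustage b (below (act b)) k s.
  apply: violated_ext => i r Hr; have Hrs : r < s + 1 by mlra.
  by split=> -[v [Hv K]]; exists v; split=> //; apply/(act_history v Hh Hrs).
rewrite (act_history j Hh (mlt_S s)).
have [v [_ [K N]]] := Hh s (mlt_S s).
split=> [K'|[Hj [V Nj]]].
  have Ev := mnth_fun K K'; subst v.
  case: N => [[k [Hk [Ek [V Nk]]]]|[E0 _]]; last by have := mle0 j; mlra.
  have Ekj : k = j by mlra.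
  subst k; split=> //; split; first exact/E.
  by move=> j' Hj' /E; apply: Nk.
suff <- : v = j + 1 by [].
apply: next_fun N _; left; exists j; split=> //; split=> //; split; first exact/E.
by move=> j' Hj' /E; apply: Nj.
Qed.

(** Histories exist and agree, so a level does not act exactly if some history has another entry at
    this stage. *)
Lemma Pi_act (az : set_of M -> Prop) : az Z -> Pi3 az act.
Proof.
move=> HZ; have H1 := Sg_history HZ.
apply: Pi3I; apply: (Sg_ext (P := fun v => exists h u, history h (v 0%nat) (v 2%nat + 1) /\
  (mnth h (v 2%nat) u /\ (u < v 1%nat + 1 \/ v 1%nat + 1 < u)))); last by defn.
move=> v; have [h Hh] := history_exists (v 0%nat) (v 2%nat + 1).
have [u [_ [K _]]] := Hh _ (mlt_S (v 2%nat)).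
split=> [[h' [u' [Hh' [K' Hu]]]] Ha|N].
  have := mnth_fun K' (proj1 (act_history (v 1%nat) Hh' (mlt_S (v 2%nat))) Ha); case: Hu; mlra.
exists h, u; split=> //; split=> //; case: (mlt_total u (v 1%nat + 1)) => [|[E|]]; [by left| |by right].
by case: N; apply/(act_history (v 1%nat) Hh (mlt_S (v 2%nat))); rewrite -E.
Qed.

(** [tree_measure] yields measure at most [2^(1-b)], hence [b = n + 1]. *)
Definition test_tree n i y : Prop := tree ustage (n + 1) (act (n + 1)) i y.

Lemma Sg_test_tree (az : set_of M -> Prop) : az Z -> Sg3 az test_tree.
Proof.
move=> HZ; have A1 := Sg_act HZ; have A2 := Pi_act HZ; have I1 := Sg_inU HZ; have I2 := Pi_inU HZ.
by rewrite /test_tree /tree /cover /range /below; defn.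
Qed.
Lemma Pi_test_tree (az : set_of M -> Prop) : az Z -> Pi3 az test_tree.
Proof.
move=> HZ; have A1 := Sg_act HZ; have A2 := Pi_act HZ; have I1 := Sg_inU HZ; have I2 := Pi_inU HZ.
by rewrite /test_tree /tree /cover /range /below; defn.
Qed.

Definition in_test x : Prop := exists n, n < x + 1 /\ exists i, i < x + 1 /\ exists y, y < x + 1 /\
  (x = pr n (pr i y) /\ test_tree n i y).

Lemma in_test_pr n i y : in_test (pr n (pr i y)) <-> test_tree n i y.
Proof.
split=> [[n' [_ [i' [_ [y' [_ [E H]]]]]]]|H].
  by have [E1 E2] := pr_inj E; have [E3 E4] := pr_inj E2; subst.
have H1 := pr_ge_l n (pr i y); have H2 := pr_ge_r n (pr i y).
have H3 := pr_ge_l i y; have H4 := pr_ge_r i y.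
exists n; split; [mlra|exists i; split; [mlra|exists y; split; [mlra|by split]]].
Qed.

Theorem two_rand_io_inc (X : set_of M) : two_rand Z X -> io_inc Z X.
Proof.
move=> HR; apply: NNPP => HN.
have HC b : exists N, forall m, N <= m -> exists t, comp ustage b t (restr X m).
  apply: NNPP => H; apply: HN; exists b => m0; apply: NNPP => H'; apply: H; exists m0 => m Hm.
  apply: NNPP => H''; apply: H'; exists m; split=> //; exists (restr X m); split; first exact/is_restrP.
  move=> n En [t [l [Hl [Hln /ustage_univ [w Hw]]]]]; apply: H''; exists w, t.
  have [Ht Lt] := proj1 (is_lenP _ _) Hl; have [Hr Lr] := restr_len X m.
  have Hlt : len t + b < len (restr X m) by rewrite Lt Lr; mlra.
  split; last by [].
  have [_ L1] := len_bounds Ht; have [L2 _] := len_bounds Hr; rewrite -exp2_S in L1.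
  have : exp2 (len t + 1) <= exp2 (len (restr X m)) by apply: exp2_le; have := mle0 b; mlra.
  mlra.
(* Both parameter classes are needed: [allsets] for the comprehension that forms [W], and [eq Z] for
   the reduction of [W] to [Z]. *)
have T1 az : az Z -> Sg1 az in_test.
  by move=> HZ; have H1 := Sg_test_tree HZ; rewrite /in_test; defn.
have T2 az : az Z -> Pi1 az in_test.
  by move=> HZ; have H1 := Pi_test_tree HZ; rewrite /in_test; defn.
have [W HW] := @m_comprehension M in_test (T1 al I _ (Df_var 0)) (T2 al I _ (Df_var 0)).
have SU := @Sg_ustage al I; have PU := @Pi_ustage al I.
have SA b : Sg2 al (act b) by have H := @Sg_act al I; defn.
have PA b : Pi2 al (act b) by have H := @Pi_act al I; defn.
have HWE n i y : tree_at W n i y <-> test_tree n i y by rewrite /tree_at HW in_test_pr.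
have HWe n : tree_at W n = test_tree n.
  by apply: functional_extensionality => i; apply: functional_extensionality => y; apply: propositional_extensionality.
apply: (HR W); last first.
  move=> n; have [N HN'] := HC (n + 1).
  have [i Hi] := tree_cover SU PU ustage_mono ustage_fun (SA _) (PA _) (act_rule (n + 1)) HN'.
  exists i => k; exists (restr X k); split; [exact/is_restrP|apply/HWE; exact: Hi].
split; last split.
- pose P x y := (in_test x /\ y = 1) \/ (~ in_test x /\ y = 0).
  have [||e He] := @graph_index M Z P.
  + by have H1 := T1 (eq Z) erefl; have H2 := T2 (eq Z) erefl; rewrite /P; defn.
  + by move=> x y y' [[H1 ->]|[H1 ->]] [[H2 ->]|[H2 ->]].
  by exists e => x; rewrite HW; split=> H; apply: He; [left|right].
- by move=> n i; rewrite HWe; exact: tree_prefix.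
- move=> n; exists (exp2 n); split=> // i.
  have [k Hk] := tree_measure SU PU ustage_mono ustage_fun (SA _) (PA _) (act_rule (n + 1)) i.
  have S2 := @Sg_test_tree al I; have P2 := @Pi_test_tree al I.
  exists k, (exp2 k), (level (fun y => exists j, j <= i /\ test_tree n j y) k).
  split=> //; split.
    by rewrite HWe; apply/(level_card (A := fun s => exists j, j <= i /\ test_tree n j s)); [defn|defn|].
  move: Hk; rewrite exp2_S /test_tree; mlra.
Qed.
End Staged.

(** * Meaning of the formalized notions *)

Section Worlds.
Context {M : rca}.
Local Open Scope m_scope.
Implicit Types a b c : M.

(* A world records the numbers of quantifiers passed so far and the values of the
   variables bound by them.  Denotations have to persist in deeper worlds, since
   terms and formulas with named binders are used below further quantifiers. *)
Record world : Type := World { wd : nat; ws : nat; wv : nat -> M; ww : nat -> set_of M }.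
Implicit Types o : world.

Definition wle o o' : Prop := exists k l : nat,
  wd o' = (k + wd o)%nat /\ ws o' = (l + ws o)%nat /\
  (forall i, wv o' (k + i)%nat = wv o i) /\ (forall i, ww o' (l + i)%nat = ww o i).

Definition den o (t : tm) a : Prop := forall o', wle o o' -> teval (wv o') (t (wd o')) = a.
Definition sden o (X : sv) (Y : set_of M) : Prop := forall o', wle o o' -> ww o' (X (ws o')) = Y.
Definition fden o (F : fm) (P : Prop) : Prop :=
  forall o', wle o o' -> (sat (wv o') (ww o') (F (wd o') (ws o')) <-> P).
Definition pden o (F : tm -> fm) (P : M -> Prop) : Prop :=
  forall o', wle o o' -> forall x a, den o' x a -> fden o' (F x) (P a).
Definition pden2 o (F : tm -> tm -> fm) (P : M -> M -> Prop) : Prop :=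
  forall o', wle o o' -> forall x a, den o' x a -> pden o' (F x) (P a).

Lemma wle_refl o : wle o o.
Proof. by exists 0%nat, 0%nat. Qed.

Lemma wle_trans o o' o'' : wle o o' -> wle o' o'' -> wle o o''.
Proof.
move=> [k [l [H1 [H2 [H3 H4]]]]] [k' [l' [H1' [H2' [H3' H4']]]]].
exists (k' + k)%nat, (l' + l)%nat; split; first by lia.
split; first by lia.
by split=> i; [rewrite -H3 -H3'|rewrite -H4 -H4']; congr (_ _); lia.
Qed.

Lemma den_mono o o' t a : wle o o' -> den o t a -> den o' t a.
Proof. by move=> H K o'' H'; apply: K; exact: wle_trans H H'. Qed.
Lemma sden_mono o o' X Y : wle o o' -> sden o X Y -> sden o' X Y.
Proof. by move=> H K o'' H'; apply: K; exact: wle_trans H H'. Qed.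
Lemma pden_mono o o' F P : wle o o' -> pden o F P -> pden o' F P.
Proof. by move=> H K o'' H'; apply: K; exact: wle_trans H H'. Qed.
Lemma pden2_mono o o' F P : wle o o' -> pden2 o F P -> pden2 o' F P.
Proof. by move=> H K o'' H'; apply: K; exact: wle_trans H H'. Qed.

Definition push o a : world := World (S (wd o)) (ws o) (scons a (wv o)) (ww o).
Definition spush o X : world := World (wd o) (S (ws o)) (wv o) (scons X (ww o)).

Lemma wle_push o a : wle o (push o a).
Proof. by exists 1%nat, 0%nat. Qed.
Lemma wle_spush o X : wle o (spush o X).
Proof. by exists 0%nat, 1%nat. Qed.

Lemma den_level o a : den (push o a) (fun d => Var (Defs.level (wd o) d)) a.
Proof.
move=> o' [k [l [Hd [_ [Hv _]]]]]; rewrite /= /Defs.level Hd /=.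
by have <- : wv o' (k + 0)%nat = a := Hv 0%nat; congr (wv o' _); lia.
Qed.
Lemma sden_level o X : sden (spush o X) (Defs.level (ws o)) X.
Proof.
move=> o' [k [l [_ [Hs [_ Hw]]]]]; rewrite /Defs.level Hs /=.
by have <- : ww o' (l + 0)%nat = X := Hw 0%nat; congr (ww o' _); lia.
Qed.

Lemma den_zero o : den o bzero 0.
Proof. by []. Qed.
Lemma den_one o : den o bone 1.
Proof. by []. Qed.
Lemma den_add o t u a b : den o t a -> den o u b -> den o (badd t u) (a + b).
Proof. by move=> H K o' Ho; rewrite /= H // K. Qed.
Lemma den_mul o t u a b : den o t a -> den o u b -> den o (bmul t u) (a * b).
Proof. by move=> H K o' Ho; rewrite /= H // K. Qed.
Lemma den_num o n : den o (num n) (mnum n).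
Proof. by elim: n => [|n IH]; [exact: den_zero|apply: den_add => //; exact: den_one]. Qed.

Lemma fden_iff o F P Q : (P <-> Q) -> fden o F P -> fden o F Q.
Proof. by move=> E H o' Ho; rewrite H. Qed.
Lemma fden_eq o t u a b : den o t a -> den o u b -> fden o (beq t u) (a = b).
Proof. by move=> H K o' Ho; rewrite /= H // K. Qed.
Lemma fden_lt o t u a b : den o t a -> den o u b -> fden o (blt t u) (a < b).
Proof. by move=> H K o' Ho; rewrite /= H // K. Qed.
Lemma fden_mem o t X a Y : den o t a -> sden o X Y -> fden o (bmem t X) (a \in Y).
Proof. by move=> H K o' Ho; rewrite /= H // K. Qed.
Lemma fden_neg o F P : fden o F P -> fden o (bneg F) (~ P).
Proof. by move=> H o' Ho; rewrite /= H. Qed.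
Lemma fden_imp o F G P Q : fden o F P -> fden o G Q -> fden o (bimp F G) (P -> Q).
Proof. by move=> H K o' Ho; rewrite /= H // K. Qed.
Lemma fden_and o F G P Q : fden o F P -> fden o G Q -> fden o (band F G) (P /\ Q).
Proof. by move=> H K o' Ho; rewrite /= H // K. Qed.
Lemma fden_or o F G P Q : fden o F P -> fden o G Q -> fden o (bor F G) (P \/ Q).
Proof. by move=> H K o' Ho; rewrite /= H // K. Qed.
Lemma fden_biff o F G P Q : fden o F P -> fden o G Q -> fden o (biff F G) (P <-> Q).
Proof. by move=> H K o' Ho; rewrite /= H // K. Qed.
Lemma fden_all o F P : pden o F P -> fden o (ball F) (forall a, P a).
Proof.
move=> H o' Ho; have E a := H _ (wle_trans Ho (wle_push o' a)) _ _ (den_level (o := o') (a := a)) _ (wle_refl _).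
by split=> K a; apply/E; exact: K.
Qed.
Lemma fden_ex o F P : pden o F P -> fden o (bex F) (exists a, P a).
Proof.
move=> H o' Ho; have E a := H _ (wle_trans Ho (wle_push o' a)) _ _ (den_level (o := o') (a := a)) _ (wle_refl _).
by split=> -[a K]; exists a; apply/E; exact: K.
Qed.
Lemma fden_allS o F (P : set_of M -> Prop) :
  (forall o', wle o o' -> forall X Y, sden o' X Y -> fden o' (F X) (P Y)) ->
  fden o (ballS F) (forall X, P X).
Proof.
move=> H o' Ho; have E X := H _ (wle_trans Ho (wle_spush o' X)) _ _ (sden_level (o := o') (X := X)) _ (wle_refl _).
by split=> K a; apply/E; exact: K.
Qed.
Lemma fden_exS o F (P : set_of M -> Prop) :
  (forall o', wle o o' -> forall X Y, sden o' X Y -> fden o' (F X) (P Y)) ->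
  fden o (bexS F) (exists X, P X).
Proof.
move=> H o' Ho; have E X := H _ (wle_trans Ho (wle_spush o' X)) _ _ (sden_level (o := o') (X := X)) _ (wle_refl _).
by split=> -[a K]; exists a; apply/E; exact: K.
Qed.
Lemma fden_app o F P x a : pden o F P -> den o x a -> fden o (F x) (P a).
Proof. by move=> H; apply: H; exact: wle_refl. Qed.
Lemma pden_app o F P x a : pden2 o F P -> den o x a -> pden o (F x) (P a).
Proof. by move=> H; apply: H; exact: wle_refl. Qed.
End Worlds.

(** * Computing the denotations of the formulas *)

Ltac lift_hyps Ho :=
  repeat match type of Ho with wle ?o ?o' =>
    match goal with
    | H : den o _ _ |- _ => apply (den_mono Ho) in H
    | H : sden o _ _ |- _ => apply (sden_mono Ho) in H
    | H : pden o _ _ |- _ => apply (pden_mono Ho) in H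
    | H : pden2 o _ _ |- _ => apply (pden2_mono Ho) in H
    end end; clear Ho.

Ltac enter :=
  let o := fresh "o" in let Ho := fresh "Ho" in let x := fresh "x" in let a := fresh "a" in
  let H := fresh "Hx" in intros o Ho x a H; lift_hyps Ho; cbv beta.

Ltac denote_named := fail.
Ltac denote_step :=
  first
  [ assumption
  | match goal with
    | |- den _ bzero _ => apply den_zero
    | |- den _ bone _ => apply den_one
    | |- den _ (badd _ _) _ => apply den_add
    | |- den _ (bmul _ _) _ => apply den_mul
    | |- den _ (num _) _ => apply den_num
    | |- pden2 _ _ _ => enter
    | |- pden _ _ _ => enter
    | |- fden _ (beq _ _) _ => apply fden_eq
    | |- fden _ (blt _ _) _ => apply fden_lt
    | |- fden _ (bmem _ _) _ => apply fden_mem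
    | |- fden _ (bneg _) _ => apply fden_neg
    | |- fden _ (bimp _ _) _ => apply fden_imp
    | |- fden _ (band _ _) _ => apply fden_and
    | |- fden _ (bor _ _) _ => apply fden_or
    | |- fden _ (biff _ _) _ => apply fden_biff
    | |- fden _ (ball _) _ => apply fden_all
    | |- fden _ (bex _) _ => apply fden_ex
    | |- fden _ (ballS _) _ => apply fden_allS; enter
    | |- fden _ (bexS _) _ => apply fden_exS; enter
    end
  | denote_named
  | eapply fden_app; [eassumption|]
  | eapply fden_app; [eapply pden_app; [eassumption|]|]
  | eapply pden_app; [eassumption|] ].
Ltac denote := intros; repeat denote_step.

(** Only here is a formula replaced by something of another form, the function [exp2]. The other
    notions were defined in the model with the shape of their formulas, so that [denote] matches
    them clause by clause. *)
Lemma fden_Exp2 (M : rca) (o : @world M) tn tp n p : den o tn n -> den o tp p ->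
  fden o (Exp2 tn tp) (p = exp2 n).
Proof.
move=> Hn Hp; apply: fden_iff (iff_sym (prim_rec_eq 1%m n p (@exp2_step M))) _.
by rewrite /Exp2 /Nth /Rem /Pair /prim_rec_graph /mnth /mrem /pr; denote.
Qed.

Ltac denote_named ::= apply fden_Exp2.

Lemma fden_Phi (M : rca) (o : @world M) TZ te tx ty Z e x y : sden o TZ Z ->
  den o te e -> den o tx x -> den o ty y -> fden o (Phi TZ te tx ty) (phi Z e x y).
Proof.
by rewrite /Phi /Justified /Occurs /Defs.op /Nth /Rem /Pair
  /phi /deriv /justified /occurs /op /mnth /mrem /pr; denote.
Qed.

Ltac denote_named ::= first [apply fden_Exp2 | apply fden_Phi].

Lemma fden_io_incompressible (M : rca) (o : @world M) TX TZ X Z : sden o TX X -> sden o TZ Z ->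
  fden o (io_incompressible TX TZ) (io_inc Z X).
Proof.
by rewrite /io_incompressible /ComplexityLt /UnivMachine /Restr /Prefix /Cat /Len /Str
  /io_inc /complexity_lt /univ /is_restr /prefix /cat /is_len; denote.
Qed.

Lemma fden_two_random (M : rca) (o : @world M) TX TZ X Z : sden o TX X -> sden o TZ Z ->
  fden o (two_random TX TZ) (two_rand Z X).
Proof.
by rewrite /two_random /Sigma2_test /TuringLe /Tree /MeasureLe /InSigma2 /Tree_at /Card /Nth /Rem /Pair
  /Restr /Prefix /Cat /Len /Str /two_rand /sigma2_test /turing_le /is_tree /measure_le /in_sigma2
  /tree_at /is_card /mnth /mrem /pr /is_restr /prefix /cat /is_len; denote.
Qed.

Lemma io_inc_iff_two_rand (M : rca) (Z X : set_of M) : io_inc Z X <-> two_rand Z X.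
Proof. by split; [exact: io_inc_two_rand|exact: two_rand_io_inc]. Qed.

Lemma proves_sentence (F : fm) : (forall M : rca, exists P : Prop, P /\ forall o : @world M, fden o F P) ->
  proves RCA0 (sentence F).
Proof.
move=> H; apply: completeness; first exact: RCA0_closed.
move=> M HM v w; have [P [HP K]] := H (@Rca M (w 0) HM).
exact/(K (World (M := Rca (w 0) HM) 0 0 v w) _ (wle_refl _)).
Qed.

Theorem corollary4p10 :
  proves RCA0 incompressible_iff_two_random /\ proves RCA0 C_INC_iff_MLR2.
Proof.
split; apply: proves_sentence => M.
- exists (forall X Z : set_of M, io_inc Z X <-> two_rand Z X); split=> [X Z|o].
    exact: io_inc_iff_two_rand.
  by denote; [apply: fden_io_incompressible|apply: fden_two_random].
- exists ((forall Z : set_of M, exists X, io_inc Z X) <-> (forall Z : set_of M, exists X, two_rand Z X)); split=> [|o].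
    by split=> H Z; have [X HX] := H Z; exists X; apply/io_inc_iff_two_rand.
  by rewrite /C_INC /MLR2; denote; [apply: fden_io_incompressible|apply: fden_two_random].
Qed.
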